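(* The self-crossing wriggle polynomial $T\mapsto W_{sc,T}(t_1,\ldots,t_n)$, defined on diagrams of oriented virtual tangles with ordered components, is an invariant of virtual tangles, and it is a Vassiliev invariant of virtual tangles of order one (that is, of order $\le 1$ but not of order $\le 0$).
   Context: **Virtual tangles.** A virtual tangle diagram is a generic immersion in a square of finitely many circles (closed components) and arcs (long components), with the ends of the arcs at fixed distinguished points on the top and bottom sides of the square, in which every double point is marked as a classical crossing (with over/under information) or a virtual crossing. The tangle is an $(m,n)$-tangle if it has $m$ endpoints on top and $n$ on the bottom. The most general setting is allowed: closed components may be present, the numbers of top and bottom endpoints need not agree, and long components need not connect top to bottom. All tangles are oriented (each component is oriented) and their components are ordered $T_1,\ldots,T_n$. A virtual tangle is an equivalence class of diagrams up to planar isotopy fixing endpoints, the classical Reidemeister moves R1, R2, R3, and the virtual Reidemeister moves (the analogues of R1, R2, R3 with all crossings virtual, and the mixed move in which a strand with two consecutive virtual crossings is moved across a classical crossing). Each classical crossing $c$ has a sign $sgn(c)=\pm1$ in the usual way. **Wriggle number.** For an ordered pair $(L_1,L_2)$ of components of an oriented virtual diagram, $vlk(L_1,L_2)=\sum_{d} sgn(d)$, summed over classical crossings $d$ where $L_1$ goes over $L_2$. The wriggle number is $W(L_1,L_2)=vlk(L_1,L_2)-vlk(L_2,L_1)$. **Smoothing.** A self-crossing of $T_i$ is a classical crossing both of whose strands belong to $T_i$. The oriented smoothing at $c$ joins the incoming understrand to the outgoing overstrand and the incoming overstrand to the outgoing understrand. Smoothing $T_i$ at a self-crossing $c$ gives a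 two-component object $L_c$ with inherited orientation (all other components of $T$, and all crossings with them, are ignored). Component one of $L_c$ is the component containing the incoming understrand at $c$ (the paper marks this strand with a black dot), and component two is the other. $W(L_c)$ denotes the wriggle number of (component one, component two). **Self-crossing wriggle polynomial.** Assigning a variable $t_i$ to each component $T_i$, $$W_{sc,T}(t_1,\ldots,t_n)=\sum_{i}\ \sum_{c} sgn(c)\,\bigl(t_i^{W(L_c)}-1\bigr),$$ where the inner sum is over all self-crossings $c$ of $T_i$. It is a Laurent polynomial. **Vassiliev invariants.** A singular virtual tangle is a virtual tangle that may also have finitely many transverse double points as an additional type of crossing (considered up to planar isotopy fixing endpoints, the classical Reidemeister moves R1, R2, R3, the virtual Reidemeister moves (the analogues of R1, R2, R3 with all crossings virtual, and the mixed move in which a strand with two consecutive virtual crossings is moved across a classical crossing), and rigid vertex isotopy); components run straight through double points. An invariant $\nu$ of virtual tangles is extended to singular virtual tangles by the rule $\nu(\text{double point})=\nu(\text{positive crossing})-\nu(\text{negative crossing})$ applied at each double point. $\nu$ is a Vassiliev invariant of order $\le n$ if the extension vanishes on every singular virtual tangle with more than $n$ double points; it is of order $n$ if it is of order $\le n$ but not of order $\le n-1$. *)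

(* Defs.v *)
From HB Require Import structures.
From Stdlib Require Import Relation_Operators.
From Stdlib Require List.
From mathcomp Require Import all_boot all_order all_algebra.
From mathcomp Require mpoly.

(* The Laurent polynomial ring Z[t_0^±1, ..., t_(k-1)^±1] is used through its
   embedding in its fraction field Q(t_0, ..., t_(k-1)).  The module confines
   the notations of mpoly, which are incompatible with those of analysis. *)
Module Laurent.
Import mpoly.
Local Open Scope ring_scope.
Definition field (k : nat) : fieldType := {fraction {mpoly int[k]}}.
Definition var {k : nat} (i : 'I_k) : field k :=
  tofrac ('X_i : {mpoly int[k]}).
End Laurent.

From mathcomp Require Import all_classical all_reals all_analysis.
Set Implicit Arguments.
Unset Strict Implicit.
Unset Printing Implicit Defensive.
Import Order.TTheory GRing.Theory Num.Theory numFieldNormedType.Exports.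
Local Open Scope ring_scope.

Inductive crossing_kind := Classical | Virtual | Double.

Definition crossing_kind_code (K : crossing_kind) : option bool :=
  match K with Classical => None | Virtual => Some true | Double => Some false end.
Definition crossing_kind_decode (o : option bool) : crossing_kind :=
  match o with None => Classical | Some true => Virtual | Some false => Double end.
Lemma crossing_kind_codeK : cancel crossing_kind_code crossing_kind_decode.
Proof. by case. Qed.
HB.instance Definition _ :=
  Equality.copy crossing_kind (can_type crossing_kind_codeK).

Section Diagrams.
Variables (R : realType) (k : nat).

Local Notation plane := (R * R)%type.

Definition det2 (u v : plane) : R := u.1 * v.2 - u.2 * v.1.

Definition sqdist (x y : plane) : R := (y.1 - x.1) ^+ 2 + (y.2 - x.2) ^+ 2.

Definition in_square (x : plane) : bool := (0 <= x.1 <= 1) && (0 <= x.2 <= 1).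

Definition in_open_square (x : plane) : bool := (0 < x.1 < 1) && (0 < x.2 < 1).

(* The fixed distinguished points, m on the top side and n on the bottom side
   of the square. *)
Definition endpoints (m n : nat) : seq plane :=
  [seq (j.+1%:R / m.+1%:R, 1) | j <- iota 0 m] ++
  [seq (j.+1%:R / n.+1%:R, 0) | j <- iota 0 n].

(* A point of the source of the immersion: a component and a parameter. *)
Definition strand : Type := ('I_k * R)%type.

(* At a classical crossing strand1 is the overstrand and strand2 the
   understrand; at the other crossings the order of the strands is immaterial. *)
Definition crossing : Type := (crossing_kind * (strand * strand))%type.
Definition kind (c : crossing) : crossing_kind := c.1.
Definition strand1 (c : crossing) : strand := c.2.1.
Definition strand2 (c : crossing) : strand := c.2.2.

(* Raw data of a diagram with k ordered components.  A long component is
   parametrized by [0, 1], a closed one by [0, 1) through a 1-periodic map; only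
   the values on [0, 1] of the curve of a long component matter. *)
Record diagram := Diagram {
  comp_closed : 'I_k -> bool;
  curve : 'I_k -> R -> plane;
  crossings : seq crossing }.

Definition with_crossings (D : diagram) (s : seq crossing) : diagram :=
  Diagram (comp_closed D) (curve D) s.

Definition position (D : diagram) (p : strand) : plane := curve D p.1 p.2.

Definition velocity (D : diagram) (p : strand) : plane :=
  derive1 (curve D p.1) p.2.

Definition in_source (D : diagram) (p : strand) : bool :=
  (0 <= p.2) && (if comp_closed D p.1 then p.2 < 1 else p.2 <= 1).

Definition of_class_C1 (V : normedModType R) (f : R -> V) : Prop :=
  (forall t, derivable f t 1) /\ continuous (derive1 f).

Definition lies_at (p q : strand) (c : crossing) : bool :=
  ((strand1 c == p) && (strand2 c == q)) ||
  ((strand1 c == q) && (strand2 c == p)).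

(* Singular virtual (m, n)-tangle diagrams. *)
Record singular_diagram (m n : nat) (D : diagram) : Prop := {
  diag_C1 : forall i, of_class_C1 (curve D i);
  diag_immersed : forall p, 0 <= p.2 <= 1 -> velocity D p != 0;
  diag_closed : forall i, comp_closed D i ->
    forall t, curve D i (t + 1) = curve D i t /\ in_open_square (curve D i t);
  diag_long : forall i, ~~ comp_closed D i ->
    forall t, 0 < t < 1 -> in_open_square (curve D i t);
  diag_boundary_transverse : forall i, ~~ comp_closed D i ->
    (velocity D (i, 0)).2 != 0 /\ (velocity D (i, 1)).2 != 0;
  diag_endpoints : perm_eq (endpoints m n)
    [seq curve D i e | i <- [seq i <- enum 'I_k | ~~ comp_closed D i],
                       e <- [:: 0; 1]];
  diag_crossings : forall c, c \in crossings D ->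
    [/\ in_source D (strand1 c), in_source D (strand2 c),
        strand1 c != strand2 c,
        position D (strand1 c) = position D (strand2 c) &
        det2 (velocity D (strand1 c)) (velocity D (strand2 c)) != 0];
  diag_all_crossings : forall p q, in_source D p -> in_source D q ->
    p != q -> position D p = position D q -> count (lies_at p q) (crossings D) = 1%N;
  diag_no_triple : forall p q r,
    in_source D p -> in_source D q -> in_source D r ->
    position D p = position D q -> position D q = position D r ->
    [\/ p = q, q = r | p = r] }.

Definition num_double (D : diagram) : nat :=
  count (fun c => kind c == Double) (crossings D).

(* Virtual (m, n)-tangle diagrams. *)
Definition virtual_diagram (m n : nat) (D : diagram) : Prop :=
  singular_diagram m n D /\ num_double D = 0%N.

Section Equivalence.
Variables (m n : nat).

(* Equality of crossings up to a correspondence between source points. *)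
Definition corresponds (rel : strand -> strand -> Prop) (c c' : crossing) : Prop :=
  kind c = kind c' /\
  ((rel (strand1 c) (strand1 c') /\ rel (strand2 c) (strand2 c')) \/
   [/\ kind c <> Classical, rel (strand1 c) (strand2 c')
     & rel (strand2 c) (strand1 c')]).

Definition same_crossings (rel : strand -> strand -> Prop)
    (s s' : seq crossing) : Prop :=
  (forall c, c \in s -> exists2 c', c' \in s' & corresponds rel c c') /\
  (forall c', c' \in s' -> exists2 c, c \in s & corresponds rel c c').

Definition differential_at (F : plane -> plane) (x v : plane) : plane := 'd F x v.

(* Ambient isotopies, parametrized by all of R by letting them be constant
   before time 0 and after time 1. *)
Record isotopy (Phi : R -> plane -> plane) : Prop := {
  isotopy_start : forall x, Phi 0 x = x;
  isotopy_bij : forall u, bijective (Phi u);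
  isotopy_square : forall u x, in_square (Phi u x) = in_square x;
  isotopy_endpoints : forall u x, x \in endpoints m n -> Phi u x = x;
  isotopy_cont : continuous (fun y : R * plane => Phi y.1 y.2);
  isotopy_diff : forall u (x : plane), differentiable (Phi u) x;
  isotopy_diff_inj : forall u (x v : plane), differential_at (Phi u) x v = 0 -> v = 0;
  isotopy_diff_cont : forall v : plane,
    continuous (fun y : R * plane => differential_at (Phi y.1) y.2 v) }.

Definition planar_isotopic (D D' : diagram) : Prop :=
  exists2 Phi, isotopy Phi &
  [/\ comp_closed D =1 comp_closed D',
      forall i t, 0 <= t <= 1 -> curve D' i t = Phi 1 (curve D i t) &
      same_crossings eq (crossings D) (crossings D')].

(* Diagrams are unparametrized oriented curves: orientation preserving changes
   of parameter are allowed on each component. *)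
Definition reparametrized (D D' : diagram) : Prop :=
  exists h : 'I_k -> R -> R,
  [/\ comp_closed D =1 comp_closed D',
      forall i, of_class_C1 (h i) /\ forall t, 0 < derive1 (h i) t,
      forall i, if comp_closed D i then forall t, h i (t + 1) = h i t + 1
                else h i 0 = 0 /\ h i 1 = 1,
      forall i t, 0 <= t <= 1 -> curve D' i t = curve D i (h i t) &
      same_crossings
        (fun p p' => p.1 = p'.1 /\
           if comp_closed D p.1 then exists z : int, h p'.1 p'.2 = p.2 + z%:~R
           else h p'.1 p'.2 = p.2)
        (crossings D) (crossings D')].

Record subarc := Subarc { arc_comp : 'I_k; arc_start : R; arc_end : R }.

Definition on_arc (A : subarc) (p : strand) : bool :=
  (p.1 == arc_comp A) && (arc_start A < p.2 < arc_end A).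

Definition on_closed_arc (A : subarc) (p : strand) : bool :=
  (p.1 == arc_comp A) && (arc_start A <= p.2 <= arc_end A).

Definition disjoint_arcs (A B : subarc) : bool :=
  [|| arc_comp A != arc_comp B, arc_end A < arc_start B
    | arc_end B < arc_start A].

Definition straight (D : diagram) (A : subarc) : Prop :=
  forall t, arc_start A <= t <= arc_end A ->
  det2 (curve D (arc_comp A) t - curve D (arc_comp A) (arc_start A))
       (curve D (arc_comp A) (arc_end A) - curve D (arc_comp A) (arc_start A)) = 0.

(* The part of D in the closed disc of centre o and radius r consists of the
   arcs in s, which are properly embedded or immersed in the disc. *)
Definition disc_arcs (o : plane) (r : R) (s : seq subarc) (D : diagram) : Prop :=
  (forall p, 0 <= p.2 <= 1 ->
     (sqdist o (position D p) <= r ^+ 2) = has (on_closed_arc^~ p) s /\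
     (sqdist o (position D p) < r ^+ 2) = has (on_arc^~ p) s) /\
  (forall c, c \in crossings D -> sqdist o (position D (strand1 c)) != r ^+ 2).

Definition touches (C : subarc) (c : crossing) : bool :=
  on_arc C (strand1 c) || on_arc C (strand2 c).

(* D and D' coincide except for an arc C inside a disc, which contains no other
   part of the diagrams than straight chords s.  Up to planar isotopy and
   reparametrization, every local move is the motion of one strand C inside a
   round disc with the other strands straight (parameter 0 of a closed
   component being put outside the disc). *)
Definition moves_strand (C : subarc) (s : seq subarc) (D D' : diagram) : Prop :=
  exists (o : plane) (r : R),
  [/\ 0 < r /\ (forall x, sqdist o x <= r ^+ 2 -> in_open_square x),
      all (fun A => (0 < arc_start A) && (arc_start A < arc_end A)
                    && (arc_end A < 1)) (C :: s) /\
        pairwise disjoint_arcs (C :: s),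
      disc_arcs o r (C :: s) D /\ disc_arcs o r (C :: s) D',
      List.Forall (straight D) s &
      [/\ comp_closed D =1 comp_closed D',
      forall p, 0 <= p.2 <= 1 -> ~~ on_arc C p -> position D p = position D' p &
      same_crossings eq [seq c <- crossings D | ~~ touches C c]
                        [seq c <- crossings D' | ~~ touches C c]]].

Definition strand_crossings (D : diagram) (C : subarc) : seq crossing :=
  [seq c <- crossings D | touches C c].

Definition meet (K : crossing_kind) (A B : subarc) (c : crossing) : bool :=
  (kind c == K) &&
  ((on_arc A (strand1 c) && on_arc B (strand2 c)) ||
   [&& K != Classical, on_arc B (strand1 c) & on_arc A (strand2 c)]).

Inductive passage := Over | Under | Through.

(* The arc C goes over A, under A, or crosses A virtually. *)
Definition passes (w : passage) (C A : subarc) (c : crossing) : bool :=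
  match w with
  | Over => meet Classical C A c
  | Under => meet Classical A C c
  | Through => meet Virtual C A c
  end.

(* R1 and its virtual analogue. *)
Definition move1 (D D' : diagram) : Prop :=
  exists (C : subarc) (K : crossing_kind) (c : crossing),
  [/\ moves_strand C [::] D D', K <> Double,
      strand_crossings D C = [::], strand_crossings D' C = [:: c] &
      meet K C C c].

(* R2 and its virtual analogue. *)
Definition move2 (D D' : diagram) : Prop :=
  exists (C A : subarc) (w : passage) (c d : crossing),
  [/\ moves_strand C [:: A] D D',
      strand_crossings D C = [::],
      perm_eq (strand_crossings D' C) [:: c; d],
      passes w C A c & passes w C A d].

(* The strand C is moved across a crossing of kind K between A and B. *)
Definition slide (w : passage) (K : crossing_kind) (D D' : diagram) : Prop :=
  exists C A B : subarc,
  [/\ moves_strand C [:: A; B] D D',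
      has (meet K A B) (crossings D) &
      forall E, E = D \/ E = D' ->
        exists c d, [/\ perm_eq (strand_crossings E C) [:: c; d],
                        passes w C A c & passes w C B d]].

(* R3, its virtual analogue and the mixed move. *)
Definition move3 (D D' : diagram) : Prop :=
  [\/ slide Over Classical D D', slide Under Classical D D',
      slide Through Virtual D D' | slide Through Classical D D'].

(* The strand C meets A in a double point x and in a classical crossing y; the
   half turn of the rigid vertex x carries y from one side of x to the other
   and exchanges over and under. *)
Definition vertex_turn (D D' : diagram) : Prop :=
  exists (C A : subarc) (x y x' y' : crossing) (over : bool),
  let param c := if on_arc C (strand1 c) then (strand1 c).2 else (strand2 c).2 in
  [/\ moves_strand C [:: A] D D',
      perm_eq (strand_crossings D C) [:: x; y],
      perm_eq (strand_crossings D' C) [:: x'; y'],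
      [/\ meet Double C A x, passes (if over then Over else Under) C A y &
          param x < param y] &
      [/\ meet Double C A x', passes (if over then Under else Over) C A y' &
          param y' < param x']].

(* A strand is moved over, under or virtually across a double point, or the
   double point is turned. *)
Definition rigid_vertex_move (D D' : diagram) : Prop :=
  [\/ slide Over Double D D', slide Under Double D D',
      slide Through Double D D' | vertex_turn D D'].

Definition tangle_move (D D' : diagram) : Prop :=
  planar_isotopic D D' \/ reparametrized D D' \/
  [\/ move1 D D', move2 D D' | move3 D D'].

Definition virtual_equiv : diagram -> diagram -> Prop :=
  clos_refl_sym_trans diagram (fun D D' =>
    [/\ virtual_diagram m n D, virtual_diagram m n D' & tangle_move D D']).

Definition singular_equiv : diagram -> diagram -> Prop :=
  clos_refl_sym_trans diagram (fun D D' =>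
    [/\ singular_diagram m n D, singular_diagram m n D' &
        tangle_move D D' \/ rigid_vertex_move D D']).

End Equivalence.

(* Positive when the overstrand direction followed by the understrand direction
   is a direct basis of the plane. *)
Definition sgn (D : diagram) (c : crossing) : int :=
  sgz (det2 (velocity D (strand1 c)) (velocity D (strand2 c))).

(* The components L1, L2 of an oriented object drawn with strands of D are given
   by the sets of source points of D on them. *)
Definition vlk (D : diagram) (L1 L2 : pred strand) : int :=
  \sum_(d <- crossings D |
        [&& kind d == Classical, L1 (strand1 d) & L2 (strand2 d)]) sgn D d.

Definition wriggle (D : diagram) (L1 L2 : pred strand) : int :=
  vlk D L1 L2 - vlk D L2 L1.

Definition self_crossing (i : 'I_k) (c : crossing) : bool :=
  [&& kind c == Classical, (strand1 c).1 == i & (strand2 c).1 == i].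

(* The parameters met strictly after a and strictly before b, jumping from the
   end 1 to the start 0 of the parameter interval when b < a: for a closed
   component 0 and 1 are the same point, for a long one the jump is over the
   boundary of the square. *)
Definition from_to (a b t : R) : bool :=
  if a < b then a < t < b else (t < b) || (a < t).

(* Component one of L_c, which contains the incoming understrand: it leaves c
   along the overstrand and comes back along the understrand (a long one
   consists of the initial and final pieces when it reaches the ends of T_i). *)
Definition smoothing_one (c : crossing) : pred strand := fun p =>
  (p.1 == (strand1 c).1) && from_to (strand1 c).2 (strand2 c).2 p.2.

Definition smoothing_two (c : crossing) : pred strand := fun p =>
  (p.1 == (strand1 c).1) && from_to (strand2 c).2 (strand1 c).2 p.2.

Definition self_crossing_wriggle (D : diagram) : Laurent.field k :=
  \sum_(i < k) \sum_(c <- crossings D | self_crossing i c)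
    (sgn D c)%:~R *
    (Laurent.var i ^ wriggle D (smoothing_one c) (smoothing_two c) - 1).

(* The classical crossing of given sign (positive for b = true) replacing a
   double point. *)
Definition resolution (D : diagram) (b : bool) (c : crossing) : crossing :=
  if (0 < det2 (velocity D (strand1 c)) (velocity D (strand2 c))) == b
  then (Classical, (strand1 c, strand2 c))
  else (Classical, (strand2 c, strand1 c)).

Fixpoint resolve (V : zmodType) (nu : diagram -> V) (D : diagram)
    (done todo : seq crossing) : V :=
  match todo with
  | [::] => nu (with_crossings D done)
  | c :: s =>
      if kind c == Double
      then resolve nu D (rcons done (resolution D true c)) s
           - resolve nu D (rcons done (resolution D false c)) s
      else resolve nu D (rcons done c) s
  end.

Definition singular_extension (V : zmodType) (nu : diagram -> V) (D : diagram) : V :=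
  resolve nu D [::] (crossings D).

End Diagrams.

(* The value group may depend on the number of components, as it does for the
   self-crossing wriggle polynomial. *)
Definition tangle_invariant (R : realType) (V : nat -> zmodType)
    (nu : forall k, diagram R k -> V k) : Prop :=
  forall m n k (D D' : diagram R k),
  virtual_diagram m n D -> virtual_diagram m n D' ->
  virtual_equiv m n D D' -> nu k D = nu k D'.

(* The extension vanishes on every representative of every singular virtual
   tangle with more than N double points. *)
Definition vassiliev_le (R : realType) (V : nat -> zmodType)
    (nu : forall k, diagram R k -> V k) (N : nat) : Prop :=
  tangle_invariant nu /\
  forall m n k (D D' : diagram R k),
  singular_diagram m n D -> (N < num_double D)%N -> singular_equiv m n D D' ->
  singular_extension (nu k) D' = 0.

Definition vassiliev_of_order (R : realType) (V : nat -> zmodType)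
    (nu : forall k, diagram R k -> V k) (N : nat) : Prop :=
  vassiliev_le nu N /\ forall N', N = N'.+1 -> ~ vassiliev_le nu N'.

(* Main.v *)
From HB Require Import structures.
Require Import Defs.
From mathcomp Require Import all_boot all_order all_algebra.
From mathcomp Require Import all_classical all_reals all_analysis.
From mathcomp Require Import ring lra zify.
From mathcomp Require mpoly.

(** Why the theorem is true.

    Give every pair (p, q) of strands crossing each other the sign
    [orient D p q] of the frame formed by their velocities.  At a self-crossing
    c with overstrand p and understrand q, this is the sign of c, and the
    wriggle number of the smoothing at c is the sum over the classical
    crossings, with strands x and y, of [orient D x y * link p q x y], where
    [link] is 1, -1 or 0 according to the component of the smoothing that
    carries x and the one that carries y ([wriggle_index]).  Both factors change
    sign when x and y are exchanged: the wriggle number does not depend on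
    which strand is over at the other crossings, and it changes sign when c
    itself is switched.  The polynomial is thus a sum, over the self-crossings,
    of a weight of their component, sign and index.  This weight vanishes at
    index 0 and is odd in the sign; invariance uses nothing else about it.

    Invariance.  A planar isotopy multiplies all frames by a linear map of
    positive determinant, because the determinant of its differential is
    continuous in time, never zero, and 1 at the start
    ([isotopy_orientation]); a change of parameter preserves the cyclic order of
    the parameters ([from_to_rotate]).  In a local move one arc C moves inside a
    disc where the other strands are chords.  A crossing of C with itself is
    alone in the disc, so that one of its loops has no other crossing and its
    index is 0.  The crossings of C with a chord are the zeros of a function
    along C, with the slope as sign ([sgz_offset]): the two new crossings of the
    second move have opposite signs ([bigon_orient]), and also the same index
    ([link_bigon]), hence cancel.  In the third move the slope of a single zero
    is the side of the chord on which C ends, so that no sign changes.  The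
    order of two crossings along a side of the triangle changes, but the three
    orders are tied together by the signs ([triangle_orient]), and this makes
    the contributions of two crossings of the triangle to the index of the third
    one constant ([triangle_index]).

    Order one.  All the resolutions of a singular diagram have the same
    indices, so that the extension is a sum of contributions of single
    crossings, and it vanishes as soon as there are two double points
    ([resolveE]).  The number of double points is constant on singular tangles
    ([move_double]).  Order zero is excluded by a long trefoil with one double,
    one classical and one virtual crossing: the index of the double point is 1
    or -1, and the extension is t + 1/t - 2 ([trefoil_extension]). *)

Set Implicit Arguments.
Unset Strict Implicit.
Unset Printing Implicit Defensive.
Import Order.TTheory GRing.Theory Num.Theory numFieldNormedType.Exports.
Local Open Scope ring_scope.

(** * Indices of chords *)

Lemma det2C (R : realType) (u v : R * R) : det2 v u = - det2 u v.
Proof. by case: u => a b; case: v => c d; rewrite /det2 /=; ring. Qed.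

(** Sealed: its body is a determinant of limits, which must not be unfolded
    when signs are compared. *)
HB.lock Definition orient (R : realType) (k : nat) (D : diagram R k) (p q : strand R k) : int :=
  sgz (det2 (velocity D p) (velocity D q)).

Lemma orientE (R : realType) (k : nat) (D : diagram R k) (p q : strand R k) :
  orient D p q = sgz (det2 (velocity D p) (velocity D q)).
Proof. by rewrite orient.unlock. Qed.

Section Chords.
Variables (R : realType) (k : nat) (V : zmodType) (T : 'I_k -> int -> int -> V).
Local Notation strand := (strand R k).
Implicit Types (p q x y : strand) (e : strand * strand).
Implicit Types (o : strand -> strand -> int) (L : seq (strand * strand)).

(** When p is the overstrand and q the understrand of a self-crossing, these
    are the points of component one of its smoothing. *)
Definition side p q x : bool := (x.1 == p.1) && from_to p.2 q.2 x.2.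

(** A difference, because the wriggle number is one: 1 if x is on component
    one and y on component two of the smoothing at (p, q), -1 in the opposite
    case. *)
Definition link p q x y : int :=
  (side p q x && side q p y)%:R - (side q p x && side p q y)%:R.

Lemma link_swapr p q x y : link p q y x = - link p q x y.
Proof. by rewrite /link opprB ![_ && side _ _ y]andbC. Qed.

Lemma link_swapl p q x y : link q p x y = - link p q x y.
Proof. by rewrite /link opprB. Qed.

(** Exchanging the strands of a chord of L changes the sign of both
    factors of its contribution, hence the index does not see which strand is
    over. *)
Definition chord_index o L p q : int := \sum_(e <- L) o e.1 e.2 * link p q e.1 e.2.

Definition chord_term o L e : V := T e.1.1 (o e.1 e.2) (chord_index o L e.1 e.2).

Definition chord_poly o L : V :=
  \sum_(e <- L | e.1.1 == e.2.1) chord_term o L e.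

Definition chords_of (s : seq (crossing R k)) : seq (strand * strand) :=
  [seq c.2 | c <- s & kind c == Classical].

Definition chords (D : diagram R k) := chords_of (crossings D).

Lemma index_swap o L p q : chord_index o L q p = - chord_index o L p q.
Proof.
by rewrite /chord_index -sumrN; apply: eq_bigr => e _; rewrite link_swapl mulrN.
Qed.

Lemma orientC D p q : orient D q p = - orient D p q.
Proof. by rewrite !orientE; move: (velocity D p) (velocity D q) => u v; rewrite det2C sgzN. Qed.

(** The two vlk sums of the wriggle number run over the same crossings,
    with opposite roles of the strands; their difference is the sum of the
    values of [link]. *)
Lemma wriggle_index (D : diagram R k) c : (strand1 c).1 = (strand2 c).1 ->
  wriggle D (smoothing_one c) (smoothing_two c)
  = chord_index (orient D) (chords D) (strand1 c) (strand2 c).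
Proof.
move=> Ec; rewrite /wriggle /vlk /chord_index /chords /chords_of big_map big_filter.
rewrite !big_mkcondr -sumrB /=; apply: eq_bigr => d _.
have two x : smoothing_two c x = side (strand2 c) (strand1 c) x.
  by rewrite /smoothing_two /side Ec.
rewrite -!/(strand1 d) -!/(strand2 d) /link !two -!/(side _ _ _) /sgn -!orientE.
rewrite /smoothing_one -!/(side _ _ _).
by case: (side _ _ _ && _); case: (side _ _ _ && _); rewrite /= ?mulr1 ?mulr0; ring.
Qed.

Lemma perm_index o L L' p q : perm_eq L L' -> chord_index o L p q = chord_index o L' p q.
Proof. exact: perm_big. Qed.

Lemma perm_chord_poly o L L' : perm_eq L L' -> chord_poly o L = chord_poly o L'.
Proof.
move=> LL'; rewrite /chord_poly (perm_big _ LL'); apply: eq_bigr => e _.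
by rewrite /chord_term (perm_index _ _ _ LL').
Qed.

Lemma chord_index_cat o L L' p q : chord_index o (L ++ L') p q = chord_index o L p q + chord_index o L' p q.
Proof. exact: big_cat. Qed.

Lemma chord_index_cons o e L p q :
  chord_index o (e :: L) p q = o e.1 e.2 * link p q e.1 e.2 + chord_index o L p q.
Proof. exact: big_cons. Qed.

Lemma chord_index_nil o p q : chord_index o [::] p q = 0.
Proof. exact: big_nil. Qed.

Lemma eq_index o o' L p q : (forall e, e \in L -> o' e.1 e.2 = o e.1 e.2) ->
  chord_index o L p q = chord_index o' L p q.
Proof. by move=> oo'; apply: eq_big_seq => e /oo' ->. Qed.

Lemma eq_chord_poly o o' L L' f : perm_eq L' (map f L) ->
  (forall e, e \in L -> [/\ o' (f e).1 (f e).2 = o e.1 e.2,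
      (f e).1.1 = e.1.1 & (f e).2.1 = e.2.1]) ->
  (forall e d, e \in L -> d \in L -> e.1.1 = e.2.1 ->
      link (f e).1 (f e).2 (f d).1 (f d).2 = link e.1 e.2 d.1 d.2) ->
  chord_poly o L = chord_poly o' L'.
Proof.
move=> LL' of_ linkf; rewrite (perm_chord_poly _ LL') /chord_poly big_map.
rewrite big_mkcond [RHS]big_mkcond; apply: eq_big_seq => e eL /=.
have [oe -> ->] := of_ e eL; case: eqP => // Ee.
rewrite /chord_term oe; have [_ -> _] := of_ e eL; congr (T _ _ _).
rewrite /chord_index big_map; apply: eq_big_seq => d dL.
by have [-> _ _] := of_ d dL; rewrite linkf.
Qed.

(** The form in which a local move is used: L consists of the crossings
    outside the disc, X and X' of the crossings of the moving strand before
    and after. *)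
Lemma eq_chord_poly_cat o o' L X X' :
  (forall e, e \in L -> o' e.1 e.2 = o e.1 e.2) ->
  (forall e, e \in L -> e.1.1 = e.2.1 ->
     chord_index o X e.1 e.2 = chord_index o' X' e.1 e.2) ->
  \sum_(e <- X | e.1.1 == e.2.1) chord_term o (L ++ X) e =
  \sum_(e <- X' | e.1.1 == e.2.1) chord_term o' (L ++ X') e ->
  chord_poly o (L ++ X) = chord_poly o' (L ++ X').
Proof.
move=> oo' XX' S; rewrite /chord_poly !big_cat /= S; congr (_ + _).
rewrite big_mkcond [RHS]big_mkcond; apply: eq_big_seq => e eL.
case: eqP => // Ee; rewrite /chord_term oo' // !chord_index_cat XX' //.
by rewrite (eq_index _ _ oo').
Qed.

(** The overstrand comes first in a chord; b tells whether the moving strand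
    is the overstrand. *)
Definition flip (b : bool) e := if b then e else (e.2, e.1).

(** The moving strand may be over or under all the others without
    changing any index. *)
Lemma index_flip o b L p q : (forall x y, o y x = - o x y) ->
  chord_index o (map (flip b) L) p q = chord_index o L p q.
Proof.
move=> oC; rewrite /chord_index big_map; apply: eq_bigr => -[x y] _.
by case: b; rewrite //= oC link_swapr mulrNN.
Qed.

End Chords.

Definition wriggle_term {k} (i : 'I_k) (s w : int) : Laurent.field k :=
  s%:~R * (Laurent.var i ^ w - 1).

(** The sum over components and their self-crossings becomes a sum over
    all chords with both strands on one component. *)
Lemma self_crossing_wriggleE (R : realType) k (D : diagram R k) :
  self_crossing_wriggle D = chord_poly wriggle_term (orient D) (chords D).
Proof.
rewrite /self_crossing_wriggle /chord_poly /chords /chords_of big_map big_filter_cond.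
rewrite (exchange_big_dep (fun c => (kind c == Classical) && (c.2.1.1 == c.2.2.1))) /=; last first.
  by move=> i c _ /and3P[-> /eqP -> /eqP ->]; rewrite eqxx.
apply: eq_bigr => c /andP[Kc /eqP Ec].
rewrite (big_pred1 (strand1 c).1) /=; last first.
  move=> i; rewrite /self_crossing Kc /strand1 /strand2 -Ec /= andbb eq_sym.
  by [].
by rewrite wriggle_index // /chord_term /wriggle_term orientE.
Qed.

(** * Cyclic order and arcs *)

(** Comparisons with a moving parameter are replaced by comparisons with the
    ends of the interval in which it moves. *)
Lemma range_lt (R : realType) (s e t a : R) :
  s < t < e -> ~~ (s < a < e) -> (t < a) = (e <= a).
Proof.
case/andP=> st te na; apply/idP/idP => [ta|]; last exact: lt_le_trans.
by rewrite leNgt; apply: contra na => ->; rewrite (lt_trans st ta).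
Qed.

Lemma range_gt (R : realType) (s e t a : R) :
  s < t < e -> ~~ (s < a < e) -> (a < t) = (a <= s).
Proof.
case/andP=> st te na; apply/idP/idP => [ta|/le_lt_trans]; last exact.
by rewrite leNgt; apply: contra na => ->; rewrite (lt_trans ta te).
Qed.

Lemma range_before (R : realType) (s e s' e' a b : R) :
  s < a < e -> s' < b < e' -> e < s' -> a < b.
Proof. by move=> /andP[_ ae] /andP[sb _] es; apply: lt_trans ae (lt_trans es sb). Qed.

Lemma from_to_const (R : realType) (a b s e t t' : R) :
  ~~ (s < a < e) -> ~~ (s < b < e) -> s < t < e -> s < t' < e ->
  from_to a b t = from_to a b t'.
Proof.
move=> na nb nt nt'.
by rewrite /from_to (range_gt nt na) (range_gt nt' na) (range_lt nt nb) (range_lt nt' nb).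
Qed.

Lemma from_to_shift (R : realType) (s e s' e' a a' b b' t : R) :
  s < a < e -> s < a' < e -> s' < b < e' -> s' < b' < e' ->
  (e < s') || (e' < s) -> ~~ (s < t < e) -> ~~ (s' < t < e') ->
  from_to a b t = from_to a' b' t.
Proof.
move=> Ha Ha' Hb Hb' dr nt nt'; rewrite /from_to.
rewrite (range_lt Ha nt) (range_lt Ha' nt) (range_gt Hb nt') (range_gt Hb' nt').
case/orP: dr => d; first by rewrite (range_before Ha Hb d) (range_before Ha' Hb' d).
by rewrite !ltNge (ltW (range_before Hb Ha d)) (ltW (range_before Hb' Ha' d)).
Qed.

Lemma from_to_start (R : realType) (s e s' e' a a' b : R) :
  s < a < e -> s < a' < e -> s' < b < e' -> (e < s') || (e' < s) ->
  from_to a b a' = (a < a').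
Proof.
move=> Ha Ha' Hb /orP[] d; rewrite /from_to.
  by rewrite (range_before Ha Hb d) (range_before Ha' Hb d) andbT.
by rewrite ltNge (ltW (range_before Hb Ha d)) (ltNge a') (ltW (range_before Hb Ha' d)).
Qed.

Lemma from_to_end (R : realType) (s e s' e' a b b' : R) :
  s < a < e -> s' < b < e' -> s' < b' < e' -> (e < s') || (e' < s) ->
  from_to a b b' = (b' < b).
Proof.
move=> Ha Hb Hb' /orP[] d; rewrite /from_to.
  by rewrite (range_before Ha Hb d) (range_before Ha Hb' d).
by rewrite ltNge (ltW (range_before Hb Ha d)) (ltNge a) (ltW (range_before Hb' Ha d)) orbF.
Qed.

Lemma from_to_compl (R : realType) (a b t : R) : a != b -> t != a -> t != b ->
  from_to b a t = ~~ from_to a b t.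
Proof.
move=> ab ta tb; rewrite /from_to; case: (ltgtP a b) => [_|_|E]; last by rewrite E eqxx in ab.
- by rewrite negb_and -!leNgt (le_eqVlt t) (le_eqVlt b) (negPf ta) eq_sym (negPf tb).
- by rewrite negb_or -!leNgt (le_eqVlt t) (le_eqVlt b) (negPf ta) eq_sym (negPf tb) andbC.
Qed.

Section Arcs.
Variables (R : realType) (k : nat).
Local Notation strand := (strand R k).
Local Notation subarc := (subarc R k).
Implicit Types (p q x y : strand) (A B C : subarc).

Lemma side_const A p q x x' : p.1 = q.1 -> ~~ on_arc A p -> ~~ on_arc A q ->
  on_arc A x -> on_arc A x' -> side p q x = side p q x'.
Proof.
rewrite /on_arc /side => pq Ap Aq /andP[/eqP-> Ax] /andP[/eqP-> Ax'].
move: Aq Ap; rewrite -pq; case: eqP => /= [->|/eqP Np]; last first.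
  by rewrite eq_sym (negbTE Np).
by rewrite eqxx /= => nq np; apply: (from_to_const np nq).
Qed.

Lemma disjoint_arcsC A B : disjoint_arcs A B = disjoint_arcs B A.
Proof. by rewrite /disjoint_arcs eq_sym [X in _ || X]orbC. Qed.

Lemma disjoint_range A B p q : disjoint_arcs A B -> p.1 = q.1 ->
  on_arc A p -> on_arc B q -> (arc_end A < arc_start B) || (arc_end B < arc_start A).
Proof.
by move=> d pq /andP[/eqP Ap _] /andP[/eqP Bq _]; move: d; rewrite /disjoint_arcs -Ap -Bq pq eqxx.
Qed.

Lemma disjoint_on A B p : disjoint_arcs A B -> on_closed_arc A p -> ~~ on_closed_arc B p.
Proof.
move=> d /andP[/eqP Ap /andP[sA eA]]; apply/negP => /andP[/eqP Bp /andP[sB eB]].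
move: d; rewrite /disjoint_arcs -Ap -Bp eqxx /= => /orP[] h.
  by have := le_lt_trans eA (lt_le_trans h sB); rewrite ltxx.
by have := le_lt_trans eB (lt_le_trans h sA); rewrite ltxx.
Qed.

Lemma on_closed A p : on_arc A p -> on_closed_arc A p.
Proof. by move=> /andP[Ap /andP[/ltW s /ltW e]]; rewrite /on_closed_arc Ap s e. Qed.

Lemma on_arc_range A p : on_arc A p -> arc_start A < p.2 < arc_end A.
Proof. by case/andP. Qed.

Lemma side_shift A B p p' q q' x : disjoint_arcs A B -> p.1 = q.1 ->
  on_arc A p -> on_arc A p' -> on_arc B q -> on_arc B q' ->
  ~~ on_arc A x -> ~~ on_arc B x -> side p q x = side p' q' x.
Proof.
move=> d pq Ap Ap' Bq Bq'.
have dr := disjoint_range d pq Ap Bq.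
have pp' : p.1 = p'.1 by case/andP: Ap => /eqP-> _; case/andP: Ap' => /eqP->.
rewrite /side -pp'; case: eqP => //= xp.
have -> : on_arc A x = (arc_start A < x.2 < arc_end A).
  by rewrite /on_arc xp; case/andP: Ap => ->.
have -> : on_arc B x = (arc_start B < x.2 < arc_end B).
  by rewrite /on_arc xp pq; case/andP: Bq => ->.
exact: (from_to_shift (on_arc_range Ap) (on_arc_range Ap') (on_arc_range Bq) (on_arc_range Bq')).
Qed.

Lemma side_start A B p p' q : disjoint_arcs A B -> p.1 = q.1 ->
  on_arc A p -> on_arc A p' -> on_arc B q -> side p q p' = (p.2 < p'.2).
Proof.
move=> d pq Ap Ap' Bq; have dr := disjoint_range d pq Ap Bq.
have pp' : p.1 = p'.1 by case/andP: Ap => /eqP-> _; case/andP: Ap' => /eqP->.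
rewrite /side -pp' eqxx /=.
exact: (from_to_start (on_arc_range Ap) (on_arc_range Ap') (on_arc_range Bq)).
Qed.

Lemma side_end A B p q q' : disjoint_arcs A B -> p.1 = q.1 ->
  on_arc A p -> on_arc B q -> on_arc B q' -> side p q q' = (q'.2 < q.2).
Proof.
move=> d pq Ap Bq Bq'; have dr := disjoint_range d pq Ap Bq.
have qq' : q.1 = q'.1 by case/andP: Bq => /eqP-> _; case/andP: Bq' => /eqP->.
rewrite /side -qq' pq eqxx /=.
exact: (from_to_end (on_arc_range Ap) (on_arc_range Bq) (on_arc_range Bq')).
Qed.

Lemma strand_eq x y : x.1 = y.1 -> x.2 = y.2 -> x = y.
Proof. by case: x y => [? ?] [? ?] /= -> ->. Qed.

Lemma side_compl p q x : p.1 = q.1 -> p != q -> x != p -> x != q ->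
  side q p x = (x.1 == p.1) && ~~ side p q x.
Proof.
rewrite /side => pq npq xp xq; rewrite -pq; case: eqP => //= Ex.
apply: from_to_compl.
- by apply: contraNneq npq => E; apply/eqP/strand_eq.
- by apply: contraNneq xp => E; apply/eqP/strand_eq.
- by apply: contraNneq xq => E; apply/eqP/strand_eq; rewrite // Ex.
Qed.

(** On the component of the chord the two components of the smoothing are
    complementary, so that the products of indicators become a difference. *)
Lemma linkE p q x y : p.1 = q.1 -> p != q ->
  x != p -> x != q -> y != p -> y != q -> x.1 = y.1 ->
  link p q x y = (side p q x)%:R - (side p q y)%:R.
Proof.
move=> pq npq xp xq yp yq xy; rewrite /link !(side_compl pq npq) // -xy.
rewrite /side -xy; case: eqP => //= _.
by case: from_to; case: from_to.
Qed.

Lemma link_off p q x y : p.1 = q.1 -> x.1 != p.1 \/ y.1 != p.1 -> link p q x y = 0.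
Proof.
move=> pq; rewrite /link /side -pq; case=> /negPf->; by rewrite /= ?andbF subrr.
Qed.

(** The strands of a crossing that slides along arcs free of p and q stay on
    the same components of the smoothing. *)
Lemma link_const A B p q x x' y y' : p.1 = q.1 ->
  ~~ on_arc A p -> ~~ on_arc A q -> ~~ on_arc B p -> ~~ on_arc B q ->
  on_arc A x -> on_arc A x' -> on_arc B y -> on_arc B y' ->
  link p q x y = link p q x' y'.
Proof.
move=> pq Ap Aq Bp Bq Ax Ax' By By'; rewrite /link.
rewrite (side_const pq Ap Aq Ax Ax') (side_const pq Bp Bq By By').
by rewrite (side_const (esym pq) Aq Ap Ax Ax') (side_const (esym pq) Bq Bp By By').
Qed.

(** Only the parameters swept by p and q change component. *)
Lemma link_shift A B p p' q q' x y : disjoint_arcs A B -> p.1 = q.1 ->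
  on_arc A p -> on_arc A p' -> on_arc B q -> on_arc B q' ->
  ~~ on_arc A x -> ~~ on_arc B x -> ~~ on_arc A y -> ~~ on_arc B y ->
  link p q x y = link p' q' x y.
Proof.
move=> d pq Ap Ap' Bq Bq' Ax Bx Ay By; rewrite /link.
rewrite !(side_shift d pq Ap Ap' Bq Bq') //.
by rewrite disjoint_arcsC in d; rewrite !(side_shift d (esym pq) Bq Bq' Ap Ap').
Qed.

(** One of the two loops at a crossing of an arc with itself stays inside
    the arc, and meets nothing. *)
Lemma link_kink A p q x y : on_arc A p -> on_arc A q ->
  ~~ on_arc A x -> ~~ on_arc A y -> link p q x y = 0.
Proof.
move=> Ap Aq.
have pq : p.1 = q.1 by case/andP: Ap => /eqP-> _; case/andP: Aq => /eqP->.
have no a b z : on_arc A a -> on_arc A b -> ~~ on_arc A z -> a.2 < b.2 -> side a b z = false.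
  move=> Aa Ab nz ab; rewrite /side /from_to ab; apply/negP => /and3P[/eqP za az zb].
  move: nz; rewrite /on_arc za; case/andP: Aa => -> /andP[sa _] /=.
  case/andP: Ab => _ /andP[_ be]; by rewrite (lt_trans sa az) (lt_trans zb be).
move=> nx ny; rewrite /link; case: (ltgtP p.2 q.2) => [pq2|qp2|E].
- by rewrite !(no p q) // ?andbF subrr.
- by rewrite !(no q p) // ?andbF subrr.
- rewrite [p]surjective_pairing [q]surjective_pairing pq E; by rewrite andbC subrr.
Qed.

End Arcs.

(** * Bigons and triangles of chords *)

Lemma triangle_arith (u v w : bool) (s t : int) :
  (1 - u%:R * 2) * s = (1 - v%:R * 2) * t ->
  2 * (s * (u%:R - w%:R) + t * ((~~ v)%:R - w%:R)) = (s + t) * (1 - 2 * w%:R).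
Proof. by case: u; case: v; case: w => /=; lia. Qed.

Section LocalIndex.
Variables (R : realType) (k : nat).
Local Notation strand := (strand R k).
Local Notation subarc := (subarc R k).
Implicit Types (p q x y a b z : strand) (A B C : subarc).
Implicit Types (o : strand -> strand -> int) (L : seq (strand * strand)).

Lemma on_arc_comp A p q : on_arc A p -> on_arc A q -> p.1 = q.1.
Proof. by case/andP=> /eqP-> _ /andP[/eqP-> _]. Qed.

Lemma disjoint_off A B p : disjoint_arcs A B -> on_arc A p -> ~~ on_arc B p.
Proof. by move=> d /on_closed/(disjoint_on d); apply: contra => /on_closed. Qed.

Lemma disjoint_neq A B p q : disjoint_arcs A B -> on_arc A p -> on_arc B q -> p != q.
Proof.
by move=> d Ap Bq; apply: contraTneq Bq => <-; apply: disjoint_off Ap.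
Qed.

(** The order of the two crossings along each of the two arcs is exchanged
    with the roles of the crossings. *)
Lemma link_bigon C A x1 x2 y1 y2 : disjoint_arcs C A -> x1.1 = y1.1 ->
  on_arc C x1 -> on_arc C x2 -> on_arc A y1 -> on_arc A y2 ->
  link x1 y1 x2 y2 = - link x2 y2 x1 y1.
Proof.
move=> d E1 Cx1 Cx2 Ay1 Ay2.
have E2 : x2.1 = y2.1 by rewrite -(on_arc_comp Cx1 Cx2) E1; apply: on_arc_comp Ay1 Ay2.
have d' : disjoint_arcs A C by rewrite disjoint_arcsC.
rewrite /link (side_start d E1 Cx1 Cx2 Ay1) (side_start d E2 Cx2 Cx1 Ay2).
rewrite (side_end d E1 Cx1 Ay1 Ay2) (side_end d E2 Cx2 Ay2 Ay1).
rewrite (side_start d' (esym E1) Ay1 Ay2 Cx1) (side_start d' (esym E2) Ay2 Ay1 Cx2).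
rewrite (side_end d' (esym E1) Ay1 Cx1 Cx2) (side_end d' (esym E2) Ay2 Cx2 Cx1).
by rewrite opprB.
Qed.

Definition off A (e : strand * strand) := ~~ on_arc A e.1 && ~~ on_arc A e.2.

Lemma index_shift o L C A x x' y y' : disjoint_arcs C A -> x.1 = y.1 ->
  on_arc C x -> on_arc C x' -> on_arc A y -> on_arc A y' ->
  (forall e, e \in L -> off C e && off A e) ->
  chord_index o L x y = chord_index o L x' y'.
Proof.
move=> d E Cx Cx' Ay Ay' offL; apply: eq_big_seq => e /offL.
case/andP=> /andP[n1 n2] /andP[n3 n4]; congr (_ * _).
exact: (link_shift d E Cx Cx' Ay Ay').
Qed.

Lemma sgz_sub (s t : R) : s != t -> sgz (s - t) = 1 - (s < t)%R%:R * 2.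
Proof.
rewrite neq_lt => /orP[] st; first by rewrite ltr0_sgz ?subr_lt0 // st.
by rewrite gtr0_sgz ?subr_gt0 // ltNge (ltW st).
Qed.

(** With u, v the truth values of the order of the crossings along C and
    along A, and w the position of the arc B with respect to the smoothing at
    (x, y), the sum is od * (u - w) + ok * (not v - w); the relation between
    the signs makes od * u + ok * (not v) equal to half of od + ok. *)
Lemma triangle_link C A B x y x' z a b (od ok : int) :
  disjoint_arcs C A -> disjoint_arcs C B -> disjoint_arcs A B ->
  x.1 = y.1 -> on_arc C x -> on_arc C x' -> on_arc A y -> on_arc A a ->
  on_arc B z -> on_arc B b -> x.2 != x'.2 -> y.2 != a.2 ->
  sgz (x.2 - x'.2) * od = sgz (y.2 - a.2) * ok ->
  2 * (od * link x y x' z + ok * link x y a b)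
  = if b.1 == x.1 then (od + ok) * (1 - 2 * (side x y b)%:R) else 0.
Proof.
move=> dCA dCB dAB E Cx Cx' Ay Aa Bz Bb xx' ya.
have zb := on_arc_comp Bz Bb.
case: eqP => [bx|/eqP bx]; last first.
  rewrite !(link_off E) ?mulr0 ?addr0 ?mulr0 //; right=> //.
  by rewrite zb.
rewrite (linkE E) ?(disjoint_neq dCA Cx Ay) //; first last.
- by rewrite zb bx (on_arc_comp Cx Cx').
- by rewrite eq_sym (disjoint_neq dAB Ay Bz).
- by rewrite eq_sym (disjoint_neq dCB Cx Bz).
- by rewrite (disjoint_neq dCA Cx' Ay).
- by apply: contraNneq xx' => ->.
rewrite (linkE E) ?(disjoint_neq dCA Cx Ay) //; first last.
- by rewrite -(on_arc_comp Ay Aa) bx E.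
- by rewrite eq_sym (disjoint_neq dAB Ay Bb).
- by rewrite eq_sym (disjoint_neq dCB Cx Bb).
- by apply: contraNneq ya => ->.
- by rewrite eq_sym (disjoint_neq dCA Cx Aa).
rewrite (side_start dCA E Cx Cx' Ay) (side_end dCA E Cx Ay Aa).
rewrite (side_const E _ _ Bz Bb) ?(disjoint_off dCB Cx) ?(disjoint_off dAB Ay) //.
rewrite sgz_sub // [in X in _ = X -> _]sgz_sub // (_ : (a.2 < y.2) = ~~ (y.2 < a.2)); last first.
  by case: ltgtP ya.
exact: triangle_arith.
Qed.

(** The closed form of [triangle_link] does not involve the order of the
    crossings along the arcs. *)
Lemma triangle_index C A B x y x' z a b X Y X' Z a' b' (od ok : int) :
  disjoint_arcs C A -> disjoint_arcs C B -> disjoint_arcs A B ->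
  x.1 = y.1 -> on_arc C x -> on_arc C x' -> on_arc A y -> on_arc A a ->
  on_arc B z -> on_arc B b -> x.2 != x'.2 -> y.2 != a.2 ->
  sgz (x.2 - x'.2) * od = sgz (y.2 - a.2) * ok ->
  on_arc C X -> on_arc C X' -> on_arc A Y -> on_arc A a' ->
  on_arc B Z -> on_arc B b' -> X.2 != X'.2 -> Y.2 != a'.2 ->
  sgz (X.2 - X'.2) * od = sgz (Y.2 - a'.2) * ok ->
  od * link x y x' z + ok * link x y a b = od * link X Y X' Z + ok * link X Y a' b'.
Proof.
move=> dCA dCB dAB E Cx Cx' Ay Aa Bz Bb n1 n2 T CX CX' AY Aa' BZ Bb' N1 N2 T'.
have EX : X.1 = Y.1 by rewrite -(on_arc_comp Cx CX) E (on_arc_comp Ay AY).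
apply: (@mulfI _ 2) => //.
rewrite (triangle_link dCA dCB dAB E Cx Cx' Ay Aa Bz Bb n1 n2 T).
rewrite (triangle_link dCA dCB dAB EX CX CX' AY Aa' BZ Bb' N1 N2 T').
rewrite (on_arc_comp Bb Bb') (on_arc_comp Cx CX).
have dBC : disjoint_arcs B C by rewrite disjoint_arcsC.
have dBA : disjoint_arcs B A by rewrite disjoint_arcsC.
rewrite (side_shift dCA E Cx CX Ay AY) ?(disjoint_off dBC Bb) ?(disjoint_off dBA Bb) //.
by rewrite (side_const EX _ _ Bb Bb') ?(disjoint_off dCB CX) ?(disjoint_off dAB AY).
Qed.

End LocalIndex.

(** * Calculus of plane curves *)

Section Calculus.
Local Open Scope classical_set_scope.
Local Open Scope ring_scope.
Variable R : realType.

Lemma derivableE (V : normedModType R) (f : R -> V) t :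
  derivable f t 1 = cvg ((h^-1 *: (f (h + t) - f t)) @[h --> 0^']).
Proof.
rewrite /derivable (_ : (fun h => _) = (fun h => h^-1 *: (f (h + t) - f t))) //.
by apply/funext => h; rewrite [h *: 1]mulr1.
Qed.

Lemma cvg_derive1 (V : normedModType R) (f : R -> V) t : derivable f t 1 ->
  (h^-1 *: (f (h + t) - f t)) @[h --> 0^'] --> derive1 f t.
Proof. by rewrite derivableE. Qed.

Lemma derive1_cvg (V : normedModType R) (f : R -> V) t l :
  (h^-1 *: (f (h + t) - f t)) @[h --> 0^'] --> l ->
  derivable f t 1 /\ derive1 f t = l.
Proof.
move=> fl; split; first by rewrite derivableE; apply: cvgP fl.
exact: (cvg_lim (@norm_hausdorff _ _) fl).
Qed.

(** One of the one-sided derivatives is enough, so that t may be an end of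
    the interval. *)
Lemma eq_derive1_on (V : normedModType R) (f g : R -> V) (a b t : R) :
  a < b -> a <= t <= b -> derivable f t 1 -> derivable g t 1 ->
  (forall u, a <= u <= b -> f u = g u) -> derive1 f t = derive1 g t.
Proof.
move=> ab /andP[a_t t_b] /cvg_derive1 df /cvg_derive1 dg fg.
have [tb|bt] := ltP t b.
  apply: (@cvg_unique _ (@norm_hausdorff _ _) _ _ _ _ (cvg_dnbhs_at_right df)).
  apply: cvg_trans (cvg_dnbhs_at_right dg); apply: near_eq_cvg.
  near=> h; rewrite !fg ?a_t ?t_b //.
  apply/andP; split; first by rewrite (le_trans a_t) // lerDr.
  by rewrite -lerBrDr; near: h; apply: nbhs_right_le; rewrite subr_gt0.
have {}tb : t = b by apply/eqP; rewrite eq_le t_b.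
apply: (@cvg_unique _ (@norm_hausdorff _ _) _ _ _ _ (cvg_dnbhs_at_left df)).
apply: cvg_trans (cvg_dnbhs_at_left dg); apply: near_eq_cvg.
near=> h; rewrite !fg ?a_t ?t_b //.
apply/andP; split; last by rewrite tb gerDr.
by rewrite -lerBlDr; near: h; apply: nbhs_left_ge; rewrite tb subr_lt0.
Unshelve. all: by end_near. Qed.

Lemma cvg_det2 (T : Type) (F : set_system T) {FF : Filter F} (f g : T -> R * R) v w :
  f x @[x --> F] --> v -> g x @[x --> F] --> w ->
  det2 (f x) (g x) @[x --> F] --> det2 v w.
Proof.
move=> fv gw.
have f1 : (f x).1 @[x --> F] --> v.1 by apply: cvg_comp fv _; apply: cvg_fst.
have f2 : (f x).2 @[x --> F] --> v.2 by apply: cvg_comp fv _; apply: cvg_snd.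
have g1 : (g x).1 @[x --> F] --> w.1 by apply: cvg_comp gw _; apply: cvg_fst.
have g2 : (g x).2 @[x --> F] --> w.2 by apply: cvg_comp gw _; apply: cvg_snd.
exact: cvgB (cvgM f1 g2) (cvgM f2 g1).
Qed.

Lemma derive1_det2 (f : R -> R * R) (o w : R * R) t : derivable f t 1 ->
  derivable (fun u => det2 (f u - o) w) t 1 /\
  derive1 (fun u => det2 (f u - o) w) t = det2 (derive1 f t) w.
Proof.
move=> /cvg_derive1 df; apply: derive1_cvg.
rewrite (_ : (fun h => _) = (fun h => det2 (h^-1 *: (f (h + t) - f t)) w)).
  exact: cvg_det2 df (cvg_cst w).
apply/funext => h; move: (f _) (f _) => [a b] [c d]; case: o => e g; case: w => m n.
by rewrite /det2 /= /GRing.scale /=; ring.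
Qed.

Lemma derivable_continuous (V : normedModType R) (f : R -> V) t :
  derivable f t 1 -> {for t, continuous f}.
Proof. by move=> /derivable1_diffP/differentiable_continuous. Qed.

Lemma sgz_mul_gt0 (x y : R) : 0 < x * y -> sgz x = sgz y.
Proof.
case: (ltgtP x 0) => [x0|x0|->]; last by rewrite mul0r ltxx.
  by rewrite nmulr_rgt0 // => y0; rewrite !ltr0_sgz.
by rewrite pmulr_rgt0 // => y0; rewrite !gtr0_sgz.
Qed.

(** A little after x the function has the sign of its derivative at x, and
    it keeps it up to t by the intermediate value theorem. *)
Lemma sgz_right (f : R -> R) (x t : R) :
  x < t -> (forall u, derivable f u 1) -> f x = 0 -> derive1 f x != 0 ->
  (forall u, x < u <= t -> f u != 0) -> sgz (f t) = sgz (derive1 f x).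
Proof.
move=> xt df fx f'x nz.
have [u /andP[xu ut] fu] : exists2 u, x < u <= t & 0 < derive1 f x * f u.
  have := cvg_dnbhs_at_right (cvg_derive1 (df x)); rewrite fx.
  move=> /(cvgMl_tmp (a := derive1 f x)).
  have p : 0 < derive1 f x * derive1 f x by rewrite -expr2 exprn_even_gt0.
  move=> /(cvgr_gt _)/(_ _ p) H.
  near (0 : R)^'+ => h; exists (h + x).
    rewrite ltrDr -lerBrDr; apply/andP; split=> //.
    by near: h; apply: nbhs_right_le; rewrite subr_gt0.
  have h0 : 0 < h by near: h; exact: nbhs_right_gt.
  have : 0 < derive1 f x * (h^-1 *: (f (h + x) - 0)) by near: h.
  by rewrite subr0 /GRing.scale /= mulrCA pmulr_rgt0 ?invr_gt0.
(* Multiplying f by its slope at x makes the discussion of signs unnecessary. *)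
apply/esym/sgz_mul_gt0; rewrite ltNge; apply/negP => le0.
have [||c /itvP cut /eqP] := @IVT R (fun v => derive1 f x * f v) u t 0 ut.
- apply: continuous_subspaceT => v; apply: cvgMl_tmp; exact: derivable_continuous.
- by rewrite ge_min le0 orbT le_max ltW.
rewrite mulf_eq0 (negPf f'x) /= => fc; have := nz c.
by rewrite fc (lt_le_trans xu) ?cut // => /(_ isT).
Unshelve. all: by end_near. Qed.

Lemma sgz_left (f : R -> R) (x t : R) :
  t < x -> (forall u, derivable f u 1) -> f x = 0 -> derive1 f x != 0 ->
  (forall u, t <= u < x -> f u != 0) -> sgz (f t) = - sgz (derive1 f x).
Proof.
move=> tx df fx f'x nz; pose g u := f (- u).
have dg u : derivable g u 1 /\ derive1 g u = - derive1 f (- u).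
  have df' := derivableP (df (- u)).
  split.
    apply/derivable1_diffP; apply: differentiable_comp; last exact/derivable1_diffP.
    exact: differentiableN.
  rewrite (@derive1_comp _ -%R f) ?derive1N // ?derive1_id ?mulrN1 //; exact: derivableN.
have -> : f t = g (- t) by rewrite /g opprK.
rewrite -sgzN -[x]opprK -(dg (- x)).2.
apply: sgz_right => [|u||| u]; rewrite ?ltrN2 //.
- exact: (dg u).1.
- by rewrite /g opprK.
- by rewrite (dg (- x)).2 oppr_eq0 opprK.
- by rewrite /g => /andP[h1 h2]; apply: nz; rewrite lerNr ltrNl h2 h1.
Qed.

Lemma derive1_diff_comp (U W : normedModType R) (F : U -> W) (f : R -> U) t :
  differentiable F (f t) -> derivable f t 1 ->
  derivable (F \o f) t 1 /\ derive1 (F \o f) t = 'd F (f t) (derive1 f t).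
Proof.
move=> dF /derivable1_diffP df; have dFf := differentiable_comp df dF.
split; first exact/derivable1_diffP.
by rewrite !derive1E' // diff_comp.
Qed.

Lemma derive1_reparam (V : normedModType R) (f : R -> V) (h : R -> R) t :
  derivable h t 1 -> derivable f (h t) 1 ->
  derivable (f \o h) t 1 /\ derive1 (f \o h) t = derive1 h t *: derive1 f (h t).
Proof.
move=> dh /derivable1_diffP df.
have [dfh ->] := derive1_diff_comp df dh; split=> //.
by rewrite (derive1E' df) -linearZ /= [_ *: 1]mulr1.
Qed.

Lemma derive1_shift (V : normedModType R) (f : R -> V) z t :
  (forall u, f (u + z) = f u) -> derive1 f (t + z) = derive1 f t.
Proof.
move=> fz; rewrite /derive1 fz.
by under eq_fun do rewrite addrA fz.
Qed.

Lemma periodic_int (T : Type) (f : R -> T) (z : int) t :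
  (forall u, f (u + 1) = f u) -> f (t + z%:~R) = f t.
Proof.
move=> f1; have fn n u : f (u + n%:R) = f u.
  elim: n u => [|n IH] u; first by rewrite addr0.
  by rewrite -natr1 addrA f1.
case: z => n; first exact: fn.
by rewrite NegzE -[in RHS](subrK (n.+1%:R) t) fn mulrNz.
Qed.

(** The scaling makes det2 v (normal w) the coordinate along w of a vector v
    collinear to w. *)
Definition normal (w : R * R) : R * R :=
  (w.1 ^+ 2 + w.2 ^+ 2)^-1 *: (- w.2, w.1).

Lemma collinearE (v w : R * R) : w != 0 -> det2 v w = 0 -> v = det2 v (normal w) *: w.
Proof.
case: v => a b; case: w => c d w0; rewrite /normal /det2 /= => /eqP.
rewrite subr_eq0 => /eqP E; set q := c ^+ 2 + d ^+ 2.
have q0 : q != 0.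
  rewrite paddr_eq0 ?sqr_ge0 // !sqrf_eq0; apply: contra w0 => /andP[/eqP-> /eqP->] //.
have K : a * (q^-1 * c) - b * (q^-1 * - d) = q^-1 * (a * c + b * d) by ring.
have Ea : (a * c + b * d) * c = q * a.
  have -> : (a * c + b * d) * c = a * c ^+ 2 + (b * c) * d by ring.
  by rewrite -E /q; ring.
have Eb : (a * c + b * d) * d = q * b.
  have -> : (a * c + b * d) * d = (a * d) * c + b * d ^+ 2 by ring.
  by rewrite E /q; ring.
by congr pair; rewrite /GRing.scale /= K -mulrA ?Ea ?Eb mulKf.
Qed.

Lemma det2_normal (w : R * R) : w != 0 -> det2 w (normal w) = 1.
Proof.
case: w => c d w0; rewrite /normal /det2 /= /GRing.scale /=; set q := c ^+ 2 + d ^+ 2.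
have q0 : q != 0.
  rewrite paddr_eq0 ?sqr_ge0 // !sqrf_eq0; apply: contra w0 => /andP[/eqP-> /eqP->] //.
have -> : c * (q^-1 * c) - d * (q^-1 * - d) = q^-1 * q by rewrite /q; ring.
by rewrite mulVf.
Qed.

(** The intermediate value theorem between c and t. *)
Lemma constant_sign (f : R -> R) (s e c : R) : continuous f ->
  (forall t, s <= t <= e -> f t != 0) -> s <= c <= e -> 0 < f c ->
  forall t, s <= t <= e -> 0 < f t.
Proof.
move=> cf nz /andP[sc ce] fc t /andP[st te]; rewrite ltNge; apply/negP => ft.
have [a [b [ab sa be [m1 m2]]]] : exists a b, [/\ a <= b, s <= a, b <= e &
    Num.min (f a) (f b) <= 0 /\ 0 <= Num.max (f a) (f b)].
  have [tc|ct] := leP t c; [exists t, c|exists c, t]; split=> //; try exact: ltW.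
    by rewrite ge_min ft le_max (ltW fc) orbT.
  by rewrite ge_min ft orbT le_max (ltW fc).
have [||u /itvP uab fu] := @IVT R f a b 0 ab.
- exact: continuous_subspaceT.
- by rewrite m1 m2.
- by have := nz u; rewrite fu eqxx (le_trans sa) ?(le_trans _ be) ?uab // => /(_ isT).
Qed.

(** The coordinate g along the chord has a continuous derivative without
    zeros, because the curve is immersed; this derivative is positive at the
    point given by the mean value theorem, since g grows from 0 to 1. *)
Lemma straight_arc (f : R -> R * R) (s e : R) : of_class_C1 f -> s < e ->
  (forall t, s <= t <= e -> derive1 f t != 0) -> f e - f s != 0 ->
  (forall t, s <= t <= e -> det2 (f t - f s) (f e - f s) = 0) ->
  exists g : R -> R,
    [/\ continuous g, g s = 0, g e = 1,
        forall t, s <= t <= e -> f t = f s + g t *: (f e - f s) /\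
          exists2 l, 0 < l & derive1 f t = l *: (f e - f s) &
        forall t u, s <= t -> t < u -> u <= e -> g t < g u].
Proof.
move=> [df cf] se nz; set w := f e - f s => w0 line.
pose g u := det2 (f u - f s) (normal w).
have dg u : derivable g u 1 /\ derive1 g u = det2 (derive1 f u) (normal w).
  exact: derive1_det2.
have gs : g s = 0 by rewrite /g subrr /det2 !mul0r subrr.
have ge : g e = 1 by rewrite /g det2_normal.
have f'E t : s <= t <= e -> derive1 f t = derive1 g t *: w.
  move=> st; rewrite (dg t).2; apply: collinearE => //.
  have [d1 <-] := derive1_det2 (f s) w (df t).
  by rewrite (eq_derive1_on se st d1 (derivable_cst 0 t 1) line) derive1_cst.
have cg : continuous (derive1 g).
  move=> t; rewrite (_ : derive1 g = fun u => det2 (derive1 f u) (normal w)); last first.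
    by apply/funext => u; case: (dg u).
  exact: cvg_det2 (cf t) (cvg_cst _).
have nzg t : s <= t <= e -> derive1 g t != 0.
  by move=> /[dup] /f'E E /nz; apply: contra => /eqP E0; rewrite E E0 scale0r.
have cont : continuous g by move=> t; apply/derivable_continuous/(dg t).1.
have pos t : s <= t <= e -> 0 < derive1 g t.
  have [||c] := @MVT R g (derive1 g) s e se.
  - move=> x _; apply: DeriveDef; [exact: (dg x).1 | by rewrite derive1E].
  - exact: continuous_subspaceT.
  move=> /itvP cse E; apply: (constant_sign cg nzg (c := c)); rewrite ?cse //.
  have : 0 < derive1 g c * (e - s) by rewrite -E gs ge subr0.
  by rewrite pmulr_lgt0 // subr_gt0.
exists g; split=> //.
- move=> t st; split; last by exists (derive1 g t); [exact: pos | exact: f'E].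
  by rewrite -collinearE ?line // addrC subrK.
- apply: gtr0_derive1_incr.
  + by move=> x _; case: (dg x).
  + by move=> x /itvP xse; apply: pos; rewrite !xse.
  + exact: continuous_subspaceT.
Qed.

End Calculus.

(** * Crossings and their strands *)

Lemma count1_inj (T : eqType) (P : pred T) s x y : count P s = 1%N ->
  x \in s -> y \in s -> P x -> P y -> x = y.
Proof.
move=> c1 xs ys Px Py; have: size [seq z <- s | P z] = 1%N by rewrite size_filter.
case E : [seq z <- s | P z] => [//|a [|//]] _.
have: x \in [seq z <- s | P z] by rewrite mem_filter Px.
have: y \in [seq z <- s | P z] by rewrite mem_filter Py.
by rewrite E !inE => /eqP-> /eqP->.
Qed.

Lemma matching (T : eqType) (rho : T -> T -> Prop) (s s' : seq T) :
  uniq s -> uniq s' ->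
  (forall c, c \in s -> exists2 c', c' \in s' & rho c c') ->
  (forall c', c' \in s' -> exists2 c, c \in s & rho c c') ->
  (forall c c1 c2, c \in s -> c1 \in s' -> c2 \in s' -> rho c c1 -> rho c c2 -> c1 = c2) ->
  (forall c1 c2 c', c1 \in s -> c2 \in s -> c' \in s' -> rho c1 c' -> rho c2 c' -> c1 = c2) ->
  exists f, perm_eq s' (map f s) /\ forall c, c \in s -> f c \in s' /\ rho c (f c).
Proof.
move=> us us' tot tot' func inj.
have /choice[f Hf] : forall c, exists c', c \in s -> c' \in s' /\ rho c c'.
  move=> c; case: (boolP (c \in s)) => [/tot[c' c's' r]|_]; last by exists c.
  by exists c'.
exists f; split=> //; apply: uniq_perm => //.
  rewrite map_inj_in_uniq // => c d cs ds E.
  have [fs r] := Hf c cs; have [_ r'] := Hf d ds.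
  by apply: (inj _ _ _ cs ds fs r); rewrite E.
move=> c'; apply/idP/mapP => [c's'|[c cs ->]]; last by case: (Hf c cs).
have [c cs r] := tot' _ c's'; exists c => //.
by have [fs r'] := Hf c cs; apply: func r r'.
Qed.

Section Crossings.
Variables (R : realType) (k m n : nat).
Local Notation strand := (strand R k).
Local Notation crossing := (crossing R k).
Implicit Types (D : diagram R k) (p q : strand) (c d : crossing).

Definition strands c := [:: strand1 c; strand2 c].

Lemma crossing_eq c d : kind c = kind d -> strand1 c = strand1 d ->
  strand2 c = strand2 d -> c = d.
Proof.
case: c d => [? [? ?]] [? [? ?]]; rewrite /kind /strand1 /strand2 /=.
by move=> -> -> ->.
Qed.

Lemma crossing_source D c p : singular_diagram m n D -> c \in crossings D ->
  p \in strands c -> in_source D p.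
Proof. by move=> sD /(diag_crossings sD)[? ? _ _ _]; rewrite !inE => /orP[] /eqP->. Qed.

Lemma source01 D p : in_source D p -> 0 <= p.2 <= 1.
Proof. by rewrite /in_source => /andP[-> /=]; case: comp_closed => // /ltW. Qed.

Lemma crossing_position D c p q : singular_diagram m n D -> c \in crossings D ->
  p \in strands c -> q \in strands c -> position D p = position D q.
Proof.
by move=> sD /(diag_crossings sD)[_ _ _ E _]; rewrite !inE => /orP[] /eqP-> /orP[] /eqP->.
Qed.

Lemma lies_at_strands c p q : lies_at p q c -> p \in strands c /\ q \in strands c.
Proof. by rewrite /lies_at !inE => /orP[] /andP[/eqP-> /eqP->]; rewrite !eqxx ?orbT. Qed.

Lemma strands_lies_at c p q : p \in strands c -> q \in strands c -> p != q -> lies_at p q c.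
Proof.
by rewrite /lies_at !inE => /orP[]/eqP-> /orP[]/eqP->; rewrite ?eqxx ?orbT.
Qed.

Lemma crossing_at D p q : singular_diagram m n D -> in_source D p -> in_source D q ->
  p != q -> position D p = position D q ->
  exists2 c, c \in crossings D & lies_at p q c.
Proof.
move=> sD Sp Sq pq E; have := diag_all_crossings sD Sp Sq pq E.
by move=> c1; apply/hasP; rewrite has_count c1.
Qed.

(** Two crossings with a common strand are at the same point of the plane,
    and there are no triple points. *)
Lemma shared_strand D c d p : singular_diagram m n D -> c \in crossings D ->
  d \in crossings D -> p \in strands c -> p \in strands d -> c = d.
Proof.
move=> sD cD dD pc pd.
have other e : e \in crossings D -> p \in strands e -> exists2 q, q \in strands e & p != q.
  move=> eD; have [_ _ ne _ _] := diag_crossings sD eD.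
  rewrite inE => /orP[/eqP->|]; first by exists (strand2 e); rewrite // !inE eqxx orbT.
  by rewrite inE => /eqP->; exists (strand1 e); rewrite ?inE ?eqxx // eq_sym.
have [q qc npq] := other c cD pc; have [r rd npr] := other d dD pd.
have Ep := crossing_position sD cD pc qc.
have Er := crossing_position sD dD pd rd.
have Sp := crossing_source sD cD pc; have Sq := crossing_source sD cD qc.
have Sr := crossing_source sD dD rd.
have [E|E|E] := diag_no_triple sD Sp Sq Sr Ep (etrans (esym Ep) Er).
- by rewrite E eqxx in npq.
- subst r; apply: (count1_inj (diag_all_crossings sD Sp Sq npq Ep)) => //;
  exact: strands_lies_at.
- by rewrite E eqxx in npr.
Qed.

Lemma crossings_uniq D : singular_diagram m n D -> uniq (crossings D).
Proof.
move=> sD; apply: count_mem_uniq => c; case: (boolP (c \in crossings D)) => cD; last first.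
  by apply/count_memPn.
apply/eqP; rewrite eqn_leq -has_count has_pred1 cD andbT.
have [S1 S2 ne E _] := diag_crossings sD cD.
have <- : count (lies_at (strand1 c) (strand2 c)) (crossings D) = true.
  exact: diag_all_crossings sD _ _ S1 S2 ne E.
by apply: sub_count => d /eqP->; rewrite /lies_at !eqxx.
Qed.

(** By [shared_strand] a crossing is determined by any of its two strands,
    so that the exchange of the strands allowed at virtual and double
    crossings is harmless. *)
Lemma corresponds_matching D D' (s s' : seq crossing) (rel : strand -> strand -> Prop) :
  singular_diagram m n D -> singular_diagram m n D' ->
  {subset s <= crossings D} -> {subset s' <= crossings D'} -> uniq s -> uniq s' ->
  same_crossings rel s s' ->
  (forall p p1 p2, in_source D p -> in_source D' p1 -> in_source D' p2 ->
     rel p p1 -> rel p p2 -> p1 = p2) ->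
  (forall p1 p2 p', in_source D p1 -> in_source D p2 -> in_source D' p' ->
     rel p1 p' -> rel p2 p' -> p1 = p2) ->
  exists f, perm_eq s' (map f s) /\
     forall c, c \in s -> f c \in s' /\ corresponds rel c (f c).
Proof.
move=> sD sD' sub sub' us us' [tot tot'] func inj; apply: matching => //.
- have pick c c' : corresponds rel c c' -> exists2 p, p \in strands c' & rel (strand1 c) p.
    by case=> _ [[r _]|[_ r _]]; [exists (strand1 c')|exists (strand2 c')];
      rewrite // !inE eqxx ?orbT.
  move=> c c1 c2 cs c1s c2s /pick[p pc1 r1] /pick[q qc2 r2].
  have Sc : in_source D (strand1 c) by apply: (crossing_source sD (sub _ cs)); rewrite inE eqxx.
  have Sp := crossing_source sD' (sub' _ c1s) pc1.
  have Sq := crossing_source sD' (sub' _ c2s) qc2.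
  have E := func _ _ _ Sc Sp Sq r1 r2; subst q.
  exact: (shared_strand sD' (sub' _ c1s) (sub' _ c2s) pc1).
- have pick c c' : corresponds rel c c' -> exists2 p, p \in strands c & rel p (strand1 c').
    by case=> _ [[r _]|[_ _ r]]; [exists (strand1 c)|exists (strand2 c)];
      rewrite // !inE eqxx ?orbT.
  move=> c1 c2 c c1s c2s cs /pick[p pc1 r1] /pick[q qc2 r2].
  have Sc : in_source D' (strand1 c) by apply: (crossing_source sD' (sub' _ cs)); rewrite inE eqxx.
  have Sp := crossing_source sD (sub _ c1s) pc1.
  have Sq := crossing_source sD (sub _ c2s) qc2.
  have E := inj _ _ _ Sp Sq Sc r1 r2; subst q.
  exact: (shared_strand sD (sub _ c1s) (sub _ c2s) pc1).
Qed.

Lemma matching_kind (f : crossing -> crossing) (s s' : seq crossing) (K : crossing_kind) :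
  perm_eq s' (map f s) -> (forall c, c \in s -> kind (f c) = kind c) ->
  count (fun c => kind c == K) s' = count (fun c => kind c == K) s.
Proof.
move=> ss' fk; rewrite (permP ss') count_map; apply: eq_in_count => c /fk /= -> //.
Qed.

Lemma matching_chords (f : crossing -> crossing) (s s' : seq crossing) :
  perm_eq s' (map f s) -> (forall c, c \in s -> kind (f c) = kind c) ->
  perm_eq (chords_of s') (map (fun e => (f (Classical, e)).2) (chords_of s)).
Proof.
move=> ss' fk; rewrite /chords_of -map_comp.
rewrite [X in perm_eq _ X](_ : _ = map snd (map f [seq c <- s | kind c == Classical])).
  apply: perm_map; apply: (perm_trans (perm_filter _ ss')); rewrite filter_map.
  by rewrite (eq_in_filter (a2 := fun c => kind c == Classical)) // => c /fk /= ->.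
rewrite -map_comp; apply/eq_in_map => -[K e]; rewrite mem_filter /= => /andP[/eqP].
by rewrite /kind /= => -> _.
Qed.

Variables (V : zmodType) (T : 'I_k -> int -> int -> V).
Local Notation poly D := (chord_poly T (orient D) (chords D)).

Lemma chords_crossing D e : e \in chords D ->
  exists c, [/\ c \in crossings D, kind c = Classical, strand1 c = e.1 & strand2 c = e.2].
Proof. by case/mapP => c; rewrite mem_filter => /andP[/eqP Kc cD] ->; exists c. Qed.

(** Global changes of diagram: all that matters is that signs and the
    partition of strands by each smoothing are preserved. *)
Lemma transport D D' (rel : strand -> strand -> Prop) :
  singular_diagram m n D -> singular_diagram m n D' ->
  same_crossings rel (crossings D) (crossings D') ->
  (forall p p1 p2, in_source D p -> in_source D' p1 -> in_source D' p2 ->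
     rel p p1 -> rel p p2 -> p1 = p2) ->
  (forall p1 p2 p', in_source D p1 -> in_source D p2 -> in_source D' p' ->
     rel p1 p' -> rel p2 p' -> p1 = p2) ->
  (forall p p', rel p p' -> p'.1 = p.1) ->
  (forall p q p' q', in_source D p -> in_source D q -> in_source D' p' -> in_source D' q' ->
     position D p = position D q ->
     rel p p' -> rel q q' -> orient D' p' q' = orient D p q) ->
  (forall p q x p' q' x', in_source D p -> in_source D q -> in_source D x ->
     in_source D' p' -> in_source D' q' -> in_source D' x' -> p.1 = q.1 ->
     rel p p' -> rel q q' -> rel x x' -> side p' q' x' = side p q x) ->
  poly D = poly D' /\ num_double D' = num_double D.
Proof.
move=> sD sD' same func inj comp ori sid.
have [f [pf Hf]] := corresponds_matching sD sD' (fun _ h => h) (fun _ h => h)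
  (crossings_uniq sD) (crossings_uniq sD') same func inj.
have fk c : c \in crossings D -> kind (f c) = kind c by move=> /Hf[_ []].
split; last exact: matching_kind pf fk.
pose F e := (f (Classical, e)).2.
have HF e : e \in chords D -> [/\ rel e.1 (F e).1, rel e.2 (F e).2,
    in_source D e.1 /\ in_source D e.2, position D e.1 = position D e.2 &
    in_source D' (F e).1 /\ in_source D' (F e).2].
  move=> /chords_crossing[c [cD Kc E1 E2]].
  have Ec : c = (Classical, e) by exact: crossing_eq.
  subst c; have [fD [kf rf]] := Hf _ cD.
  have [? ? _ ? _] := diag_crossings sD cD; have [? ? _ _ _] := diag_crossings sD' fD.
  by case: rf => [[r1 r2]|[]].
apply: (@eq_chord_poly R k V T _ _ _ _ F).
- exact: (matching_chords pf fk).
- move=> e /HF[r1 r2 [S1 S2] E [S1' S2']].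
  by split; [exact: ori E r1 r2 | exact: comp | exact: comp].
- move=> e d /HF[r1 r2 [S1 S2] E [S1' S2']] /HF[r3 r4 [S3 S4] E' [S3' S4']] e12.
  have s12 z z' : in_source D z -> in_source D' z' -> rel z z' ->
    side (F e).1 (F e).2 z' = side e.1 e.2 z by move=> *; exact: sid.
  have s21 z z' : in_source D z -> in_source D' z' -> rel z z' ->
    side (F e).2 (F e).1 z' = side e.2 e.1 z by move=> *; exact: sid.
  rewrite /link (s12 _ _ S3 S3' r3) (s12 _ _ S4 S4' r4).
  by rewrite (s21 _ _ S3 S3' r3) (s21 _ _ S4 S4' r4).
Qed.

End Crossings.

(** * Planar isotopy and change of parameter *)

Section Isotopy.
Local Open Scope classical_set_scope.
Local Open Scope ring_scope.
Variables (R : realType).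

Lemma det2_linear (L : {linear (R * R)%type -> (R * R)%type}) (v w : R * R) :
  det2 (L v) (L w) = det2 v w * det2 (L (1, 0)) (L (0, 1)).
Proof.
have E u : L u = u.1 *: L (1, 0) + u.2 *: L (0, 1).
  rewrite -!linearZ -linearD; congr (L _); case: u => a b.
  by congr pair; rewrite /= /GRing.scale /= ?mulr1 ?mulr0 ?addr0 ?add0r.
rewrite (E v) (E w); move: (L _) (L _) => [a b] [c d]; case: v w => [e f] [g h].
by rewrite /det2 /= /GRing.scale /=; ring.
Qed.

(** If the images of the basis were collinear, the rows of their matrix
    would give vectors in the kernel. *)
Lemma det2_injective (L : {linear (R * R)%type -> (R * R)%type}) :
  (forall v, L v = 0 -> v = 0) -> det2 (L (1, 0)) (L (0, 1)) != 0.
Proof.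
move=> inj; apply/eqP => D0.
have E a b : L (a, b) = a *: L (1, 0) + b *: L (0, 1).
  rewrite -!linearZ -linearD; congr (L _).
  by congr pair; rewrite /= /GRing.scale /= ?mulr1 ?mulr0 ?addr0 ?add0r.
move: D0 E; case E1 : (L (1, 0)) => [a b]; case E2 : (L (0, 1)) => [c d].
rewrite /det2 /= => D0 E.
(* Combinations of the images that cancel one coordinate cancel the other. *)
have z1 : L (c, - a) = 0.
  rewrite E; congr pair; rewrite /= /GRing.scale /=; first by ring.
  by apply/eqP; rewrite -oppr_eq0 -[X in _ == X]D0; apply/eqP; ring.
have z2 : L (d, - b) = 0.
  rewrite E; congr pair; rewrite /= /GRing.scale /=; last by ring.
  by rewrite -[RHS]D0; ring.
have [c0 /eqP a0] := inj _ z1; have [d0 /eqP b0] := inj _ z2.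
move: a0 b0; rewrite !oppr_eq0 => /eqP a0 /eqP b0.
have /inj[/eqP] : L (1, 0) = 0 by rewrite E1 a0 b0.
by rewrite oner_eq0.
Qed.

(** The determinant of the differential at x is a continuous function of
    time, it is 1 at time 0, and it never vanishes. *)
Lemma isotopy_orientation m n (Phi : R -> (R * R)%type -> (R * R)%type) x : isotopy m n Phi ->
  0 < det2 ('d (Phi 1) x (1, 0)) ('d (Phi 1) x (0, 1)).
Proof.
move=> iso; pose psi u := det2 ('d (Phi u) x (1, 0)) ('d (Phi u) x (0, 1)).
have cpsi : continuous psi.
  move=> u.
  have c : (v, x) @[v --> u] --> (u, x) 
    by apply: (@cvg_pair _ _ _ (nbhs u) (nbhs u) (nbhs x)); [exact: cvg_id | exact: cvg_cst].
  apply: cvg_det2.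
    exact: cvg_comp c (@isotopy_diff_cont _ _ _ _ iso (1, 0) (u, x)).
  exact: cvg_comp c (@isotopy_diff_cont _ _ _ _ iso (0, 1) (u, x)).
have nz u : 0 <= u <= 1 -> psi u != 0.
  by move=> _; apply: det2_injective => v; apply: isotopy_diff_inj iso u x v.
have psi0 : psi 0 = 1.
  have Phi0 : Phi 0 = id by apply/funext => y; apply: isotopy_start iso y.
  have did : 'd (id : R * R -> R * R) x = id :> (R * R -> R * R) by exact: diff_val.
  by rewrite /psi Phi0 did /det2 /=; ring.
apply: (constant_sign cpsi nz (c := 0)); rewrite ?lexx ?ler01 //.
by rewrite psi0 ltr01.
Qed.

Lemma sgz_scale (c x : R) : 0 < c -> sgz (x * c) = sgz x.
Proof. by move=> c0; rewrite sgzM (gtr0_sgz c0) mulr1. Qed.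

Section Invariance.
Variables (k m n : nat) (V : zmodType) (T : 'I_k -> int -> int -> V).
Local Notation poly D := (chord_poly T (orient D) (chords D)).
Implicit Types D : diagram R k.

Lemma singular_derivable D i t : singular_diagram m n D -> derivable (curve D i) t 1.
Proof. by move=> sD; case: (diag_C1 sD i). Qed.
Arguments singular_derivable {D} i t.

Lemma planar_isotopic_invariant D D' :
  singular_diagram m n D -> singular_diagram m n D' -> planar_isotopic m n D D' ->
  poly D = poly D' /\ num_double D' = num_double D.
Proof.
move=> sD sD' [Phi iso [_ curveE same]].
apply: (transport T sD sD' same).
- by move=> p p1 p2 _ _ _ <-.
- by move=> p1 p2 p' _ _ _ -> ->.
- by move=> p p' <-.
- move=> p q p' q' Sp Sq _ _ pq <- <- {p' q'}.
  have velE r : in_source D r -> velocity D' r = 'd (Phi 1) (position D r) (velocity D r).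
    move=> /source01 r01.
    have d := isotopy_diff iso 1 (curve D r.1 r.2).
    have [d1 E] := derive1_diff_comp d (singular_derivable r.1 r.2 sD).
    rewrite /velocity /position -E.
    apply: (eq_derive1_on ltr01 r01 (singular_derivable r.1 r.2 sD') d1) => u.
    exact: curveE.
  rewrite !orientE (velE p Sp) (velE q Sq) -pq.
  move: (velocity D p) (velocity D q) (position D p) => v w x.
  by rewrite det2_linear sgz_scale //; apply: isotopy_orientation iso.
- by move=> p q x p' q' x' _ _ _ _ _ _ _ <- <- <-.
Qed.

Lemma det2_scale (c d : R) (v w : R * R) : det2 (c *: v) (d *: w) = det2 v w * (c * d).
Proof. by case: v w => [? ?] [? ?]; rewrite /det2 /= /GRing.scale /=; ring. Qed.

Lemma from_to_mono (h : R -> R) a b t : {mono h : x y / x < y} ->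
  from_to (h a) (h b) (h t) = from_to a b t.
Proof. by move=> hm; rewrite /from_to !hm. Qed.

Lemma eq_mod1 (x y : R) (z : int) : 0 <= x < 1 -> 0 <= y < 1 -> x = y + z%:~R -> x = y.
Proof.
move=> /andP[x0 x1] /andP[y0 y1] E; suff z0 : z = 0 by rewrite E z0 addr0.
have z1 : z < 1 by rewrite -(ltr_int R); lra.
have z2 : -1 < z by rewrite -(ltr_int R) mulrNz; lra.
by lia.
Qed.

(** The interval from H to H + 1 contains one representative of each class
    modulo 1: the points below the fractional part of H are moved one step
    further than the others. *)
Lemma int_shift (H a : R) (z : int) : 0 <= a < 1 -> H <= a + z%:~R < H + 1 ->
  z = Num.floor H + (a < H - (Num.floor H)%:~R)%R%:R.
Proof.
move=> /andP[a0 a1] /andP[Ha aH]; have := ge_floor H; have := lt_succ_floor H.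
set l := Num.floor H; rewrite intrD => Hl lH.
have z1 : l - 1 < z by rewrite -(ltr_int R) intrB; lra.
have z2 : z < l + 1 + 1 by rewrite -(ltr_int R) !intrD; lra.
case: ltP => /= af.
  suff : l < z by lia.
  by rewrite -(ltr_int R); lra.
suff : z < l + 1 by lia.
by rewrite -(ltr_int R) intrD; lra.
Qed.

Lemma rotate_lt (f a b : R) : 0 <= a < 1 -> 0 <= b < 1 ->
  (a + (a < f)%R%:R < b + (b < f)%R%:R) = if (a < f) == (b < f) then a < b else b < f.
Proof.
move=> /andP[a0 a1] /andP[b0 b1]; case: (ltP a f) => af; case: (ltP b f) => bf /=.
- by rewrite ltrD2r.
- by apply/negP => ?; lra.
- by apply/idP; lra.
- by rewrite !addr0.
Qed.

(** Trivial when a and b are on the same side of f, and otherwise decided by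
    f. *)
Lemma cut_lt (f a b : R) : (a < b) = if (a < f) == (b < f) then a < b else a < f.
Proof.
case: (ltP a f) => af; case: (ltP b f) => bf //=; first by rewrite (lt_le_trans af bf).
by apply/negbTE; rewrite -leNgt ltW // (lt_le_trans bf af).
Qed.

(** Moving the origin of a circle from 0 to H exchanges the two pieces cut
    by the fractional part of H, which preserves the cyclic order. *)
Lemma from_to_rotate (H a b t : R) (za zb zt : int) :
  0 <= a < 1 -> 0 <= b < 1 -> 0 <= t < 1 ->
  H <= a + za%:~R < H + 1 -> H <= b + zb%:~R < H + 1 -> H <= t + zt%:~R < H + 1 ->
  from_to (a + za%:~R) (b + zb%:~R) (t + zt%:~R) = from_to a b t.
Proof.
move=> a1 b1 t1 /(int_shift a1)-> /(int_shift b1)-> /(int_shift t1)->.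
set l := Num.floor H; set f := H - l%:~R.
have E x : x + (l + (x < f)%R%:R)%:~R = x + (x < f)%R%:R + l%:~R.
  by rewrite intrD addrCA addrC; case: (x < f).
rewrite !E /from_to !ltrD2r !rotate_lt // (cut_lt f a b) (cut_lt f a t) (cut_lt f t b).
by case: (a < f); case: (b < f); case: (t < f) => //=; case: (a < b); case: (a < t); case: (t < b).
Qed.

Lemma reparametrized_invariant D D' :
  singular_diagram m n D -> singular_diagram m n D' -> reparametrized D D' ->
  poly D = poly D' /\ num_double D' = num_double D.
Proof.
move=> sD sD' [h [closedE hC1 hper curveE same]].
have dh i t : derivable (h i) t 1 by case: (hC1 i) => -[].
have hincr i : {homo h i : x y / x < y}.
  move=> x y xy; apply: (@gtr0_derive1_incr R (h i) x y) => //.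
  - by move=> t _; case: (hC1 i).
  - by apply: continuous_subspaceT => t; apply: derivable_continuous.
have hmono i : {mono h i : x y / x < y}.
  exact: leW_mono (le_mono (hincr i)).
have hinj i : injective (h i).
  exact: inc_inj (le_mono (hincr i)).
have hint i (z : int) t : comp_closed D i -> h i (t + z%:~R) = h i t + z%:~R.
  move=> ci; apply: (addIr (- (t + z%:~R))); move: (hper i); rewrite ci => h1.
  rewrite (@periodic_int R R (fun t => h i t - t) z t); first by ring.
  by move=> u; rewrite h1; ring.
have src i t : comp_closed D i -> in_source D (i, t) -> 0 <= t < 1.
  by move=> ci; rewrite /in_source /= ci.
have src' i t : comp_closed D i -> in_source D' (i, t) -> 0 <= t < 1.
  by move=> ci; rewrite /in_source /= -closedE ci.
apply: (transport T sD sD' same).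
- move=> [i t] [j u] [l v] S Su Sv /= [E1 H1] [E2 H2]; subst j l; move: H1 H2.
  case: ifP => [ci [z1 H1] [z2 H2]|_ H1 H2]; congr (_, _); last first.
    by apply: (hinj i); rewrite H1 -H2.
  apply: (eq_mod1 (z := z1 - z2)); [exact: src' Su|exact: src' Sv|].
  by apply: (hinj i); rewrite hint // H1 H2 intrB; ring.
- move=> [i t] [j u] [l v] St Su S /= [E1 H1] [E2 H2]; subst i j; move: H1 H2.
  case: ifP => [cl [z1 H1] [z2 H2]|_ H1 H2]; congr (_, _); last by rewrite -H1.
  apply: (eq_mod1 (z := z2 - z1)); [exact: src St|exact: src Su|].
  by rewrite intrB; move: H1; rewrite H2 => H1; rewrite addrA H1 addrK.
- by move=> p p' [->].
- move=> p q p' q' Sp Sq Sp' Sq' _ rp rq.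
  have velE r r' : in_source D' r' ->
      r.1 = r'.1 /\ (if comp_closed D r.1 then exists z : int, h r'.1 r'.2 = r.2 + z%:~R
                     else h r'.1 r'.2 = r.2) ->
      exists2 c, 0 < c & velocity D' r' = c *: velocity D r.
    case: r r' => [i t] [j u] /source01 /= u01 [E]; subst j => H.
    exists (derive1 (h i) u); first by case: (hC1 i).
    have [d1 E] := derive1_reparam (dh i u) (singular_derivable i (h i u) sD).
    have E2 := eq_derive1_on ltr01 u01 (singular_derivable i u sD') d1 (curveE i).
    have per (z : int) : comp_closed D i ->
        derive1 (curve D i) (t + z%:~R) = derive1 (curve D i) t.
      move=> ci; refine (@derive1_shift R _ (curve D i) z%:~R t _) => w.
      by apply: periodic_int => x; case: (diag_closed sD ci x).
    have {E E2} -> : velocity D' (i, u) = derive1 (h i) u *: derive1 (curve D i) (h i u).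
      exact: etrans E2 E.
    have -> : velocity D (i, t) = derive1 (curve D i) t by [].
    move: per H; move: (derive1 (curve D i)) => g per.
    by case: ifP => [ci [z ->]|_ -> //]; rewrite per.
  have [c c0 Ec] := velE _ _ Sp' rp; have [d d0 Ed] := velE _ _ Sq' rq.
  rewrite !orientE Ec Ed; move: (velocity D p) (velocity D q) => v w.
  by rewrite det2_scale sgz_scale // mulr_gt0.
- move=> [i a] [j b] [l t] [i' a'] [j' b'] [l' t'] Sa Sb St Sa' Sb' St' /= E.
  move=> [E1 Ha] [E2 Hb] [E3 Ht]; subst j i' j' l'; rewrite /side /=.
  case: eqP => //= E; subst l; move: Ha Hb Ht; rewrite -(from_to_mono a' b' t' (hmono i)).
  case: ifP => [ci|_ -> -> -> //].
  move=> [za Ha] [zb Hb] [zt Ht]; rewrite Ha Hb Ht.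
  have rng u : in_source D' (i, u) -> h i 0 <= h i u < h i 0 + 1.
    move=> /(src' i u ci)/andP[u0 u1]; rewrite (le_mono (hincr i)) u0.
    by move: (hper i); rewrite ci => <-; rewrite add0r hmono.
  apply: (@from_to_rotate (h i 0)); [exact: src Sa|exact: src Sb|exact: src St|..].
  - by rewrite -Ha rng.
  - by rewrite -Hb rng.
  - by rewrite -Ht rng.
Qed.

End Invariance.
End Isotopy.
Arguments singular_derivable {R k m n D} i t.

(** * Arcs in a disc *)

Section SubarcEq.
Variables (R : realType) (k : nat).
Definition subarc_code (A : subarc R k) := (arc_comp A, arc_start A, arc_end A).
Definition subarc_decode x : subarc R k := Subarc x.1.1 x.1.2 x.2.
Lemma subarc_codeK : cancel subarc_code subarc_decode.
Proof. by case. Qed.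
HB.instance Definition _ := Equality.copy (subarc R k) (can_type subarc_codeK).
End SubarcEq.

Record disc_picture (R : realType) k (o : R * R) (r : R) (arcs : seq (subarc R k))
    (D : diagram R k) : Prop := {
  pic_range : forall A, A \in arcs ->
    [/\ 0 < arc_start A, arc_start A < arc_end A & arc_end A < 1];
  pic_disjoint : forall A B, A \in arcs -> B \in arcs -> A != B -> disjoint_arcs A B;
  pic_arcs : disc_arcs o r arcs D }.

(** The squared distance is a quadratic function of u, with equal values at
    0 and 1. *)
Lemma sqdist_chord (R : realType) (o a w : R * R) (u : R) :
  sqdist o (a + w) = sqdist o a ->
  sqdist o (a + u *: w) = sqdist o a + u * (u - 1) * (w.1 ^+ 2 + w.2 ^+ 2).
Proof.
case: o a w => [x1 x2] [a1 a2] [w1 w2]; rewrite /sqdist /= /GRing.scale /=.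
move/eqP; rewrite -subr_eq0 => /eqP H.
transitivity ((a1 - x1) ^+ 2 + (a2 - x2) ^+ 2 + u * (u - 1) * (w1 ^+ 2 + w2 ^+ 2)
  + u * 0); last by rewrite mulr0 addr0.
by rewrite -H; ring.
Qed.

Section Picture.
Variables (R : realType) (k m n : nat) (o : R * R) (r : R).
Variables (arcs : seq (subarc R k)) (D : diagram R k).
Hypotheses (sD : singular_diagram m n D) (pD : disc_picture o r arcs D).
Local Notation strand := (strand R k).
Implicit Types (p q : strand) (A B C : subarc R k).

Lemma pic_source A p : A \in arcs -> on_closed_arc A p -> in_source D p /\ 0 <= p.2 <= 1.
Proof.
move=> /(pic_range pD)[a0 ae e1] /andP[_ /andP[sp pe]].
have p0 := lt_le_trans a0 sp; have p1 := le_lt_trans pe e1.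
by rewrite /in_source (ltW p0) p1 (ltW p1) /=; case: ifP.
Qed.

Lemma pic_disc A p : A \in arcs -> on_closed_arc A p -> sqdist o (position D p) <= r ^+ 2.
Proof.
move=> Ar Ap; have [_ p01] := pic_source Ar Ap.
by case: (pic_arcs pD) => /(_ p p01)[-> _] _; apply/hasP; exists A.
Qed.

Lemma pic_boundary A p : A \in arcs -> on_closed_arc A p -> ~~ on_arc A p ->
  sqdist o (position D p) = r ^+ 2.
Proof.
move=> Ar Ap nA; apply/eqP; rewrite eq_le (pic_disc Ar Ap) /=.
have [_ p01] := pic_source Ar Ap.
rewrite leNgt; case: (pic_arcs pD) => /(_ p p01)[_ ->] _; apply/hasPn => B Br.
have [<-//|nBA] := eqVneq A B.
by have := disjoint_on (pic_disjoint pD Ar Br nBA) Ap; apply: contra => /on_closed.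
Qed.

(** No crossing lies on the boundary circle, where the arcs end. *)
Lemma pic_crossing_on A c p : A \in arcs -> c \in crossings D -> p \in strands c ->
  on_closed_arc A p -> on_arc A p.
Proof.
move=> Ar cD pc Ap; apply: contraT => nA; have := pic_boundary Ar Ap nA.
have s1 : strand1 c \in strands c by rewrite inE eqxx.
rewrite (crossing_position sD cD pc s1) => E.
by case: (pic_arcs pD) => _ /(_ c cD); rewrite E eqxx.
Qed.

(** The disc contains nothing but the arcs, and both strands of the crossing
    are at the same point of the disc. *)
Lemma pic_crossing_other A c p q : A \in arcs -> c \in crossings D ->
  p \in strands c -> q \in strands c -> on_arc A p ->
  exists2 B, B \in arcs & on_arc B q.
Proof.
move=> Ar cD pc qc /on_closed Ap; have := pic_disc Ar Ap.
rewrite (crossing_position sD cD pc qc).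
have q01 := source01 (crossing_source sD cD qc).
case: (pic_arcs pD) => /(_ q q01)[-> _] _ /hasP[B Br Bq]; exists B => //.
exact: pic_crossing_on Br cD qc Bq.
Qed.

Definition arc_base A := curve D (arc_comp A) (arc_start A).
Definition arc_chord A := curve D (arc_comp A) (arc_end A) - arc_base A.
Definition arc_offset A (x : R * R) := det2 (x - arc_base A) (arc_chord A).

Lemma on_closed_start A : A \in arcs -> on_closed_arc A (arc_comp A, arc_start A).
Proof. by move=> /(pic_range pD)[_ /ltW se _]; rewrite /on_closed_arc /= eqxx lexx se. Qed.

Lemma on_closed_end A : A \in arcs -> on_closed_arc A (arc_comp A, arc_end A).
Proof. by move=> /(pic_range pD)[_ /ltW se _]; rewrite /on_closed_arc /= eqxx lexx se. Qed.

Lemma start_sqdist A : A \in arcs -> sqdist o (arc_base A) = r ^+ 2.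
Proof.
move=> Ar; apply: (pic_boundary Ar (on_closed_start Ar)).
by rewrite /on_arc /= ltxx andbF.
Qed.

Lemma end_sqdist A : A \in arcs -> sqdist o (arc_base A + arc_chord A) = r ^+ 2.
Proof.
move=> Ar; rewrite addrC subrK; apply: (pic_boundary Ar (on_closed_end Ar)).
by rewrite /on_arc /= ltxx !andbF.
Qed.

(** Otherwise the arc would close up in a crossing on the boundary circle. *)
Lemma arc_chord_neq0 A : A \in arcs -> arc_chord A != 0.
Proof.
move=> Ar; have [_ se _] := pic_range pD Ar; apply/eqP => E.
set p := (arc_comp A, arc_start A); set q := (arc_comp A, arc_end A).
have [Sp _] := pic_source Ar (on_closed_start Ar).
have [Sq _] := pic_source Ar (on_closed_end Ar).
have pq : p != q by apply/eqP => -[] E2; rewrite E2 ltxx in se.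
have [|c cD /lies_at_strands[pc _]] := crossing_at sD Sp Sq pq.
  by apply/esym/eqP; rewrite -subr_eq0 -/(arc_base A) -/(arc_chord A) E.
have := pic_crossing_on Ar cD pc (on_closed_start Ar).
by rewrite /on_arc /= ltxx andbF.
Qed.

Section StraightArc.
Variable A : subarc R k.
Hypotheses (Ar : A \in arcs) (stA : straight D A).

Lemma straight_arc_param : exists g : R -> R,
    [/\ continuous g, g (arc_start A) = 0, g (arc_end A) = 1,
        forall p, on_closed_arc A p -> position D p = arc_base A + g p.2 *: arc_chord A /\
          exists2 l, 0 < l & velocity D p = l *: arc_chord A &
        forall t u, arc_start A <= t -> t < u -> u <= arc_end A -> g t < g u].
Proof.
have [s0 se e1] := pic_range pD Ar.
have [|||g [cg gs ge gE gi]] := straight_arc (diag_C1 sD (arc_comp A)) se.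
- move=> t /andP[st te]; apply: (diag_immersed sD (p := (arc_comp A, t))).
  by rewrite /= (le_trans (ltW s0) st) (le_trans te (ltW e1)).
- exact: arc_chord_neq0.
- exact: stA.
exists g; split=> // -[i t] /andP[/eqP/= -> /gE[E1 E2]]; split=> //; exact: E1.
Qed.

Lemma arc_velocity p : on_closed_arc A p ->
  exists2 l, 0 < l & velocity D p = l *: arc_chord A.
Proof. by have [g [_ _ _ gE _]] := straight_arc_param => /gE[]. Qed.

Lemma arc_displacement p q : on_closed_arc A p -> on_closed_arc A q ->
  exists2 u, position D q = position D p + u *: arc_chord A & sgz u = sgz (q.2 - p.2).
Proof.
have [g [_ _ _ gE gi]] := straight_arc_param => Ap Aq.
have [-> _] := gE _ Ap; have [-> _] := gE _ Aq.
exists (g q.2 - g p.2); first by rewrite -addrA -scalerDl [g p.2 + _]addrC subrK.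
move: Ap Aq => /andP[_ /andP[? ?]] /andP[_ /andP[? ?]].
case: (ltgtP q.2 p.2) => [qp|pq|->]; last by rewrite !subrr.
  by rewrite !ltr0_sgz ?subr_lt0 ?gi.
by rewrite !gtr0_sgz ?subr_gt0 ?gi.
Qed.

Lemma arc_offset0 p : on_closed_arc A p -> arc_offset A (position D p) = 0.
Proof.
have [g [_ _ _ gE _]] := straight_arc_param => /gE[-> _].
rewrite /arc_offset addrC addKr; move: (arc_chord A) (g _) => [a b] u.
by rewrite /det2 /= /GRing.scale /=; ring.
Qed.

(** By convexity the line of the chord meets the disc along the chord, and
    the arc runs through it by the intermediate value theorem. *)
Lemma arc_cover x : sqdist o x <= r ^+ 2 -> arc_offset A x = 0 ->
  exists2 p, on_closed_arc A p & position D p = x.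
Proof.
move=> xd /(collinearE (arc_chord_neq0 Ar)); set u := det2 _ _ => xE.
have {xE}xE : x = arc_base A + u *: arc_chord A by rewrite -xE addrC subrK.
have Es := start_sqdist Ar; have Ee := end_sqdist Ar.
have w2 : 0 < (arc_chord A).1 ^+ 2 + (arc_chord A).2 ^+ 2.
  have := arc_chord_neq0 Ar; case: (arc_chord A) => a b /= ab.
  rewrite lt_neqAle addr_ge0 ?sqr_ge0 // andbT eq_sym paddr_eq0 ?sqr_ge0 // !sqrf_eq0.
  by apply: contra ab => /andP[/eqP-> /eqP->].
move: xd; rewrite xE sqdist_chord ?Es // gerDl pmulr_lle0 // => u01.
have {u01}[u0 u1] : 0 <= u /\ u <= 1.
  by split; rewrite leNgt; apply/negP => h; move: u01; rewrite leNgt => /negP; apply; nra.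
have [g [cg gs ge gE _]] := straight_arc_param.
have [s0 se e1] := pic_range pD Ar.
have [||t /itvP tse gt] := @IVT R g _ _ u (ltW se).
- exact: continuous_subspaceT.
- by rewrite gs ge ge_min le_max u0 u1 orbT.
have At : on_closed_arc A (arc_comp A, t) by rewrite /on_closed_arc /= eqxx !tse.
by exists (arc_comp A, t) => //; have [-> _] := gE _ At; rewrite /= gt.
Qed.

Variable C : subarc R k.
Hypotheses (Cr : C \in arcs) (CA : C != A).

(** The moving arc meets the line of a chord only on the chord itself, hence
    at a crossing. *)
Lemma offset_zero p : on_closed_arc C p -> arc_offset A (position D p) = 0 ->
  exists c q, [/\ c \in crossings D, p \in strands c, q \in strands c,
                  on_arc C p & on_arc A q].
Proof.
move=> Cp /(arc_cover (pic_disc Cr Cp))[q Aq E].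
have [Sp _] := pic_source Cr Cp; have [Sq _] := pic_source Ar Aq.
have pq : p != q.
  by apply: contraTneq Aq => <-; apply: disjoint_on Cp; apply: pic_disjoint pD _ _ Cr Ar CA.
have [c cD /lies_at_strands[pc qc]] := crossing_at sD Sp Sq pq (esym E).
by exists c, q; split=> //; [exact: pic_crossing_on Cr cD pc Cp|exact: pic_crossing_on Ar cD qc Aq].
Qed.

Let f u := det2 (curve D (arc_comp C) u - arc_base A) (arc_chord A).

(** The velocity of the chord is a positive multiple of the difference of
    its ends. *)
Lemma offset_derive p q : on_arc C p -> on_arc A q ->
  sgz (derive1 f p.2) = orient D p q.
Proof.
move=> /andP[/eqP Cp _] /on_closed/arc_velocity[l l0 Eq].
have [_ ->] := derive1_det2 (arc_base A) (arc_chord A) (singular_derivable (arc_comp C) p.2 sD).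
rewrite !orientE Eq /velocity Cp; move: (derive1 _ _) (arc_chord A) => v w.
by rewrite -[v in RHS]scale1r det2_scale mul1r sgz_scale.
Qed.

Lemma offset_derivable u : derivable f u 1.
Proof.
by have [] := derive1_det2 (arc_base A) (arc_chord A) (singular_derivable (arc_comp C) u sD).
Qed.

Lemma crossing_orient c p q : c \in crossings D -> p \in strands c -> q \in strands c ->
  p != q -> orient D p q != 0.
Proof.
move=> cD; rewrite !inE => Hp Hq npq.
have n1 : orient D (strand1 c) (strand2 c) != 0.
  by rewrite !orientE sgz_eq0; case: (diag_crossings sD cD).
case/orP: Hp npq => /eqP ->; case/orP: Hq => /eqP -> /eqP npq.
- by case: npq.
- exact: n1.
- by rewrite orientC oppr_eq0; exact: n1.
- by case: npq.
Qed.

(** The function [arc_offset] has along C a single zero, with non-zero slope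
    by transversality. *)
Lemma sgz_offset c p q x : c \in crossings D -> p \in strands c -> q \in strands c ->
  on_arc C p -> on_arc A q ->
  (forall y, on_closed_arc C y -> arc_offset A (position D y) = 0 -> y = p) ->
  on_closed_arc C x -> x != p ->
  sgz (arc_offset A (position D x)) = sgz (x.2 - p.2) * orient D p q.
Proof.
move=> cD pc qc Cp Aq uniq0 Cx xp.
have dis := pic_disjoint pD Cr Ar CA.
have npq : p != q := disjoint_neq dis Cp Aq.
have f'0 : derive1 f p.2 != 0.
  by rewrite -sgz_eq0 (offset_derive Cp Aq); apply: crossing_orient cD pc qc npq.
have fE y : on_closed_arc C y -> arc_offset A (position D y) = f y.2.
  by move=> /andP[/eqP Cy _]; rewrite /arc_offset /position Cy.
have onC u : arc_start C <= u <= arc_end C -> on_closed_arc C (arc_comp C, u).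
  by rewrite /on_closed_arc /= eqxx.
have nz u : arc_start C <= u <= arc_end C -> u != p.2 -> f u != 0.
  move=> /onC Cu; apply: contra => /eqP fu; have := uniq0 _ Cu.
  by rewrite fE // => /(_ fu) <-.
have fp : f p.2 = 0.
  rewrite -fE ?(on_closed Cp) // (crossing_position sD cD pc qc).
  by apply: arc_offset0; apply: on_closed.
have /andP[_ /andP[sx xe]] := Cx; have /andP[_ /andP[/ltW sp /ltW pe]] := Cp.
rewrite fE // -(offset_derive Cp Aq).
case: (ltgtP x.2 p.2) => [lt|lt|E].
- rewrite (@ltr0_sgz _ (x.2 - p.2)) ?subr_lt0 // mulN1r; apply: sgz_left => // [u|u /andP[xu up]].
    exact: offset_derivable.
  by apply: nz; rewrite ?(le_trans sx xu) ?(le_trans (ltW up) pe) // lt_eqF.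
- rewrite (@gtr0_sgz _ (x.2 - p.2)) ?subr_gt0 // mul1r; apply: sgz_right => // [u|u /andP[pu ux]].
    exact: offset_derivable.
  by apply: nz; rewrite ?(le_trans sp (ltW pu)) ?(le_trans ux xe) // gt_eqF.
- have Ec : x.1 = p.1 by case/andP: Cx => /eqP-> _; case/andP: Cp => /eqP->.
  by case/eqP: xp; apply: strand_eq.
Qed.

(** Consecutive simple zeros of a function have slopes of opposite signs. *)
Lemma bigon_orient c d p q x y : c \in crossings D -> d \in crossings D ->
  p \in strands c -> q \in strands c -> x \in strands d -> y \in strands d ->
  on_arc C p -> on_arc A q -> on_arc C x -> on_arc A y -> p.2 < x.2 ->
  (forall z, on_closed_arc C z -> arc_offset A (position D z) = 0 -> z = p \/ z = x) ->
  orient D x y = - orient D p q.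
Proof.
move=> cD dD pc qc xd yd Cp Aq Cx Ay px uniq0.
have dis := pic_disjoint pD Cr Ar CA.
have d0 a b e : e \in crossings D -> a \in strands e -> b \in strands e ->
    on_arc C a -> on_arc A b -> f a.2 = 0 /\ derive1 f a.2 != 0.
  move=> eD ae be Ca Ab; split; last first.
    rewrite -sgz_eq0 (offset_derive Ca Ab); apply: crossing_orient eD ae be _.
    exact: disjoint_neq dis Ca Ab.
  have -> : f a.2 = arc_offset A (position D a).
    by case/andP: (Ca) => /eqP Ea _; rewrite /arc_offset /position Ea.
  by rewrite (crossing_position sD eD ae be); apply: arc_offset0; apply: on_closed.
have [fp f'p] := d0 p q c cD pc qc Cp Aq; have [fx f'x] := d0 x y d dD xd yd Cx Ay.
have /andP[/eqP Ep /andP[/ltW sp _]] := Cp; have /andP[/eqP Ex /andP[_ /ltW xe]] := Cx.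
have nz u : p.2 < u < x.2 -> f u != 0.
  move=> /andP[pu ux]; apply/eqP => fu.
  have Cu : on_closed_arc C (arc_comp C, u).
    by rewrite /on_closed_arc /= eqxx (le_trans sp (ltW pu)) (le_trans (ltW ux) xe).
  have [E|E] := uniq0 _ Cu fu; first by move: pu; rewrite -E ltxx.
  by move: ux; rewrite -E ltxx.
rewrite -(offset_derive Cp Aq) -(offset_derive Cx Ay).
pose mid := (p.2 + x.2) / 2.
have pm : p.2 < mid by rewrite /mid; lra.
have mx : mid < x.2 by rewrite /mid; lra.
rewrite -(sgz_right pm offset_derivable fp f'p); last first.
  by move=> u /andP[pu um]; apply: nz; rewrite pu (le_lt_trans um mx).
rewrite (sgz_left mx offset_derivable fx f'x) ?opprK // => u /andP[mu ux].
by apply: nz; rewrite ux (lt_le_trans pm mu).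
Qed.

End StraightArc.
End Picture.

(** * Chords of the disc *)

Section Lines.
Variables (R : realType) (k m n : nat) (o : R * R) (r : R).
Variables (arcs : seq (subarc R k)) (D : diagram R k).
Hypotheses (sD : singular_diagram m n D) (pD : disc_picture o r arcs D).
Local Notation strand := (strand R k).
Implicit Types (p q : strand) (A B C : subarc R k).

Lemma arc_injective A p q : A \in arcs -> straight D A ->
  on_closed_arc A p -> on_closed_arc A q -> position D p = position D q -> p = q.
Proof.
move=> Ar stA Ap Aq E; have [u Eu su] := arc_displacement sD pD Ar stA Ap Aq.
have u0 : u = 0.
  move: Eu; rewrite -E -[X in X = _]addr0 => /addrI/esym/eqP.
  by rewrite scaler_eq0 (negPf (arc_chord_neq0 sD pD Ar)) orbF => /eqP.
move: su; rewrite u0 sgz0 => /esym/eqP; rewrite sgz_eq0 subr_eq0 => /eqP E2.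
by apply: strand_eq => //; case/andP: Ap => /eqP-> _; case/andP: Aq => /eqP->.
Qed.

Lemma straight_orient A B p q : A \in arcs -> B \in arcs -> straight D A -> straight D B ->
  on_closed_arc A p -> on_closed_arc B q ->
  orient D p q = sgz (det2 (arc_chord D A) (arc_chord D B)).
Proof.
move=> Ar Br stA stB Ap Bq.
have [l l0 El] := arc_velocity sD pD Ar stA Ap.
have [l' l'0 El'] := arc_velocity sD pD Br stB Bq.
rewrite !orientE El El'; move: (arc_chord D A) (arc_chord D B) => v w.
by rewrite det2_scale sgz_scale // mulr_gt0.
Qed.

(** Two lines that are not parallel have one common point. *)
Lemma straight_meet A B c d p q p' q' : A \in arcs -> B \in arcs -> A != B ->
  straight D A -> straight D B -> c \in crossings D -> d \in crossings D ->
  p \in strands c -> q \in strands c -> p' \in strands d -> q' \in strands d ->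
  on_arc A p -> on_arc B q -> on_arc A p' -> on_arc B q' -> c = d.
Proof.
move=> Ar Br AB stA stB cD dD pc qc pd qd Ap Bq Ap' Bq'.
have npq : p != q := disjoint_neq (pic_disjoint pD Ar Br AB) Ap Bq.
have := crossing_orient sD cD pc qc npq.
rewrite (straight_orient Ar Br stA stB (on_closed Ap) (on_closed Bq)) sgz_eq0.
have [u Eu su] := arc_displacement sD pD Ar stA (on_closed Ap) (on_closed Ap').
have [v Ev _] := arc_displacement sD pD Br stB (on_closed Bq) (on_closed Bq').
move: Ev; rewrite -(crossing_position sD cD pc qc) -(crossing_position sD dD pd qd) Eu.
move=> /addrI Euv det0.
have : u * det2 (arc_chord D A) (arc_chord D B) = 0.
  move: Euv; move: (arc_chord D A) (arc_chord D B) => [a1 a2] [b1 b2] [E1 E2].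
  have -> : u * det2 (a1, a2) (b1, b2) = (u * a1) * b2 - (u * a2) * b1.
    by rewrite /det2 /=; ring.
  move: E1 E2; rewrite /GRing.scale /= => -> ->; ring.
move=> /eqP; rewrite mulf_eq0 (negPf det0) orbF => /eqP u0.
move: su; rewrite u0 sgz0 => /esym/eqP; rewrite sgz_eq0 subr_eq0 => /eqP E2.
have Ep : p' = p by apply: strand_eq; rewrite // (on_arc_comp Ap' Ap).
by apply: (shared_strand sD cD dD pc); rewrite -Ep.
Qed.

(** Both sides are the side of the line B on which the crossing of C and A
    lies: seen along C it is given by the position of this crossing with
    respect to the crossing with B, and seen along A by its position with
    respect to the crossing of A and B. *)
Lemma triangle_orient C A B c d e x y x' z a b :
  C \in arcs -> A \in arcs -> B \in arcs -> C != B ->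
  straight D A -> straight D B ->
  c \in crossings D -> d \in crossings D -> e \in crossings D ->
  x \in strands c -> y \in strands c -> x' \in strands d -> z \in strands d ->
  a \in strands e -> b \in strands e ->
  on_arc C x -> on_arc A y -> on_arc C x' -> on_arc B z -> on_arc A a -> on_arc B b ->
  (forall t, on_closed_arc C t -> arc_offset D B (position D t) = 0 -> t = x') ->
  x != x' ->
  sgz (x.2 - x'.2) * orient D x' z = sgz (y.2 - a.2) * orient D a b.
Proof.
move=> Cr Ar Br CB stA stB cD dD eD xc yc x'd zd ae be Cx Ay Cx' Bz Aa Bb uniq0 nx.
rewrite -(sgz_offset sD pD Br stB Cr CB dD x'd zd Cx' Bz uniq0 (on_closed Cx) nx).
rewrite (crossing_position sD cD xc yc).
have [u -> <-] := arc_displacement sD pD Ar stA (on_closed Aa) (on_closed Ay).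
rewrite (straight_orient Ar Br stA stB (on_closed Aa) (on_closed Bb)) -sgzM.
have := arc_offset0 sD pD Br stB (on_closed Bb).
rewrite -(crossing_position sD eD ae be) /arc_offset => E; congr sgz.
rewrite -[RHS]add0r -E; move: (position D a) (arc_base D B) (arc_chord D A) (arc_chord D B).
by move=> [? ?] [? ?] [? ?] [? ?]; rewrite /det2 /= /GRing.scale /=; ring.
Qed.

End Lines.

(** * Local moves *)

Section ChordsOf.
Variables (R : realType) (k m n : nat).
Implicit Types s : seq (crossing R k).

Lemma chords_of_perm s s' : perm_eq s s' -> perm_eq (chords_of s) (chords_of s').
Proof. by move=> ss'; apply/perm_map/perm_filter. Qed.

Lemma chords_of_cat s s' : chords_of (s ++ s') = chords_of s ++ chords_of s'.
Proof. by rewrite /chords_of filter_cat map_cat. Qed.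

Lemma chords_of_uniq s : uniq s -> uniq (chords_of s).
Proof.
move=> us; rewrite map_inj_in_uniq ?filter_uniq // => c d.
rewrite !mem_filter => /andP[/eqP Kc _] /andP[/eqP Kd _] E.
by case: c d Kc Kd E => [K e] [K' e']; rewrite /kind /= => -> -> ->.
Qed.

Lemma mem_chords_of s e : (e \in chords_of s) = ((Classical, e) \in s).
Proof.
apply/mapP/idP => [[[K f]]|es]; last by exists (Classical, e); rewrite // mem_filter.
by rewrite mem_filter /kind /= => /andP[/eqP-> fs] ->.
Qed.

Lemma Forall_mem (T : eqType) (P : T -> Prop) (s : seq T) x :
  List.Forall P s -> x \in s -> P x.
Proof.
elim: s => // y s IH H; inversion H; subst; rewrite inE => /predU1P[->//|]; exact: IH.
Qed.

Lemma pairwise_mem (T : eqType) (r : rel T) (s : seq T) x y : symmetric r ->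
  pairwise r s -> x \in s -> y \in s -> x != y -> r x y.
Proof.
move=> rC; elim: s => //= z s IH /andP[/allP rz ps].
rewrite !inE => /predU1P[->|xs] /predU1P[->|ys]; rewrite ?eqxx // => nxy.
- exact: rz.
- by rewrite rC; apply: rz.
- exact: IH.
Qed.

End ChordsOf.

Section LocalMove.
Variables (R : realType) (k m n : nat) (D D' : diagram R k).
Variables (C : subarc R k) (s : seq (subarc R k)).
Hypotheses (sD : singular_diagram m n D) (sD' : singular_diagram m n D').
Hypothesis mv : moves_strand C s D D'.
Local Notation strand := (strand R k).
Implicit Types (p q : strand) (A B : subarc R k).

Definition still_crossings (E : diagram R k) (X : subarc R k) :=
  [seq c <- crossings E | ~~ touches X c].

Lemma touches_strand c p : p \in strands c -> on_arc C p -> touches C c.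
Proof. by rewrite /touches !inE => /orP[] /eqP-> ->; rewrite ?orbT. Qed.

Lemma moves_pictures : exists o r,
  disc_picture o r (C :: s) D /\ disc_picture o r (C :: s) D'.
Proof.
case: mv => o [r [_ [rng dis] [d d'] _ _]]; exists o, r.
have H A : A \in C :: s -> [/\ 0 < arc_start A, arc_start A < arc_end A & arc_end A < 1].
  by move=> /(allP rng)/andP[/andP[-> ->] ->].
have H' A B : A \in C :: s -> B \in C :: s -> A != B -> disjoint_arcs A B.
  by apply: pairwise_mem dis => ? ?; apply: disjoint_arcsC.
by split; constructor.
Qed.

Lemma moves_position p : 0 <= p.2 <= 1 -> ~~ on_arc C p -> position D p = position D' p.
Proof. by case: mv => o [r [_ _ _ _ [_ H _]]]; apply: H. Qed.

Lemma moves_straight A : A \in s -> straight D A.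
Proof. by case: mv => o [r [_ _ _ H _]] As; apply: Forall_mem As. Qed.

Lemma moves_arc_curve A t : A \in s -> A != C -> arc_start A <= t <= arc_end A ->
  curve D' (arc_comp A) t = curve D (arc_comp A) t.
Proof.
move=> As AC st; have [q [r [pD _]]] := moves_pictures.
have Ar : A \in C :: s by rewrite inE As orbT.
have At : on_closed_arc A (arc_comp A, t) by rewrite /on_closed_arc /= eqxx.
have [_ t01] := pic_source pD Ar At.
apply/esym/(moves_position t01).
have := disjoint_on (pic_disjoint pD Ar (mem_head _ _) AC) At.
by apply: contra => /on_closed.
Qed.

Lemma moves_arc_ends A : A \in s -> A != C ->
  arc_base D' A = arc_base D A /\ arc_chord D' A = arc_chord D A.
Proof.
move=> As AC; have [q [r [pD _]]] := moves_pictures.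
have [_ /ltW se _] := pic_range pD (mem_behead (s := C :: s) As).
by rewrite /arc_chord /arc_base !(moves_arc_curve As AC) ?lexx ?se.
Qed.

Lemma moves_straight' A : A \in s -> A != C -> straight D' A.
Proof.
move=> As AC t st; have [Eb Ec] := moves_arc_ends As AC.
have := moves_straight As st; rewrite -(moves_arc_curve As AC st).
by rewrite -/(arc_base D A) -/(arc_base D' A) -/(arc_chord D A) -/(arc_chord D' A) Eb Ec.
Qed.

Lemma still_strand c p : c \in still_crossings D C -> p \in strands c ->
  ~~ on_closed_arc C p.
Proof.
rewrite mem_filter => /andP[tc cD] pc; have [q [r [pD _]]] := moves_pictures.
apply: contra tc => Cp; apply: (touches_strand pc).
exact: (pic_crossing_on sD pD (mem_head _ _) cD pc Cp).
Qed.

(** Near such a point, on one side at least, the two curves coincide. *)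
Lemma still_velocity p : 0 <= p.2 <= 1 -> ~~ on_closed_arc C p ->
  velocity D' p = velocity D p.
Proof.
move=> p01 nC; have [q [r [pD _]]] := moves_pictures.
have [s0 se e1] := pic_range pD (mem_head _ _).
have H a b : a < b -> a <= p.2 <= b -> 0 <= a -> b <= 1 ->
    (forall u, a <= u <= b -> ~~ on_arc C (p.1, u)) -> velocity D' p = velocity D p.
  move=> ab pab a0 b1 off_; rewrite /velocity.
  apply: (eq_derive1_on ab pab (singular_derivable p.1 p.2 sD') (singular_derivable p.1 p.2 sD)).
  move=> u uab; apply/esym/(moves_position (p := (p.1, u))); last exact: off_.
  by case/andP: uab => au ub; rewrite /= (le_trans a0 au) (le_trans ub b1).
move: nC; rewrite /on_closed_arc; case: eqP => [pc|np _]; last first.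
  by apply: (H 0 1) => //= u _; rewrite /on_arc /=; case: eqP.
rewrite /= negb_and -!ltNge; case/andP: p01 => p0 p1 /orP[ps|ep].
- apply: (H 0 (arc_start C)) => //; first by rewrite p0 ltW.
    by apply/ltW/(lt_trans se).
  by move=> u /andP[_ us]; rewrite /on_arc /= pc eqxx /= ltNge us.
- apply: (H (arc_end C) 1) => //; first by rewrite p1 ltW.
    by apply/ltW/(lt_trans s0).
  by move=> u /andP[eu _]; rewrite /on_arc /= pc eqxx /= [_ < arc_end C]ltNge eu andbF.
Qed.

Lemma still_orient e : e \in chords_of (still_crossings D C) ->
  orient D' e.1 e.2 = orient D e.1 e.2.
Proof.
rewrite mem_chords_of => cs.
have cD : (Classical, e) \in crossings D by move: cs; rewrite mem_filter => /andP[].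
have s1 : e.1 \in strands (Classical, e) by rewrite inE eqxx.
have s2 : e.2 \in strands (Classical, e) by rewrite !inE eqxx orbT.
rewrite !orientE (still_velocity (source01 (crossing_source sD cD s1)) (still_strand cs s1)).
by rewrite (still_velocity (source01 (crossing_source sD cD s2)) (still_strand cs s2)).
Qed.

Lemma still_matching : exists f,
  perm_eq (still_crossings D' C) (map f (still_crossings D C)) /\
  forall c, c \in still_crossings D C -> f c \in still_crossings D' C /\ corresponds eq c (f c).
Proof.
case: mv => o [r [_ _ _ _ [_ _ same]]].
apply: (corresponds_matching sD sD') same _ _.
- by move=> c; rewrite mem_filter => /andP[].
- by move=> c; rewrite mem_filter => /andP[].
- exact/filter_uniq/(crossings_uniq sD).
- exact/filter_uniq/(crossings_uniq sD').
- by move=> p p1 p2 _ _ _ <-.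
- by move=> p1 p2 p' _ _ _ -> ->.
Qed.

Lemma still_chords : perm_eq (chords_of (still_crossings D' C)) (chords_of (still_crossings D C)).
Proof.
have [f [pf Hf]] := still_matching.
have fk c : c \in still_crossings D C -> kind (f c) = kind c by move=> /Hf[_ []].
apply: (perm_trans (matching_chords pf fk)); rewrite [X in perm_eq X _](_ : _ = chords_of (still_crossings D C)) //.
rewrite -[RHS]map_id; apply/eq_in_map => e; rewrite mem_chords_of => /Hf[_ [_ [[E1 E2]|[]]]]; last by case.
by move: E1 E2; rewrite /strand1 /strand2 /=; case: e (f _).2 => [? ?] [? ?] /= -> ->.
Qed.

Lemma chords_split (E : diagram R k) :
  perm_eq (chords E) (chords_of (still_crossings E C) ++ chords_of (strand_crossings E C)).
Proof.
rewrite -chords_of_cat; apply: chords_of_perm.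
by rewrite perm_sym perm_catC; apply/permPl/perm_filterC.
Qed.

Lemma still_double : count (fun c => kind c == Double) (still_crossings D' C)
  = count (fun c => kind c == Double) (still_crossings D C).
Proof.
have [f [pf Hf]] := still_matching; apply: matching_kind pf _.
by move=> c /Hf[_ []].
Qed.

Lemma moves_double :
  (num_double D' + count (fun c => kind c == Double) (strand_crossings D C)
  = num_double D + count (fun c => kind c == Double) (strand_crossings D' C))%N.
Proof.
have E F : num_double F = (count (fun c => kind c == Double) (strand_crossings F C) +
    count (fun c => kind c == Double) (still_crossings F C))%N.
  by rewrite /num_double -count_cat; apply/permP; rewrite perm_sym; apply/permPl/perm_filterC.
rewrite !E still_double; lia.
Qed.

Variables (V : zmodType) (T : 'I_k -> int -> int -> V).
Local Notation poly D := (chord_poly T (orient D) (chords D)).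
Local Notation L := (chords_of (still_crossings D C)).

(** The crossings that do not touch C are the same before and after, with
    the same signs. *)
Lemma moves_poly X X' :
  perm_eq (chords_of (strand_crossings D C)) X ->
  perm_eq (chords_of (strand_crossings D' C)) X' ->
  (forall e, e \in L -> e.1.1 = e.2.1 ->
     chord_index (orient D) X e.1 e.2 = chord_index (orient D') X' e.1 e.2) ->
  \sum_(e <- X | e.1.1 == e.2.1) chord_term T (orient D) (L ++ X) e =
  \sum_(e <- X' | e.1.1 == e.2.1) chord_term T (orient D') (L ++ X') e ->
  poly D = poly D'.
Proof.
move=> pX pX' ind sum.
have split F Y : perm_eq (chords_of (strand_crossings F C)) Y ->
    perm_eq (chords_of (still_crossings F C)) L -> perm_eq (chords F) (L ++ Y).
  by move=> pY pL; apply: perm_trans (chords_split F) (perm_cat pL pY).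
transitivity (chord_poly T (orient D) (L ++ X)).
  exact: perm_chord_poly (split D X pX (perm_refl _)).
transitivity (chord_poly T (orient D') (L ++ X')); last first.
  exact: esym (perm_chord_poly _ _ (split D' X' pX' still_chords)).
exact: eq_chord_poly_cat still_orient ind sum.
Qed.

End LocalMove.

(** * Switched crossings and the first move *)

Section Flip.
Variables (R : realType) (k : nat) (V : zmodType) (T : 'I_k -> int -> int -> V).
Local Notation strand := (strand R k).
Implicit Types (p q x y : strand) (e : strand * strand).

Lemma from_to_start_false (a b : R) : from_to a b a = false.
Proof. by rewrite /from_to ltxx /= orbF; case: ltP. Qed.

Lemma from_to_end_false (a b : R) : from_to a b b = false.
Proof. by rewrite /from_to ltxx andbF /=; case: ltP. Qed.

Lemma link_self p q : link p q p q = 0.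
Proof.
by rewrite /link /side !from_to_start_false !from_to_end_false !andbF subrr.
Qed.

Lemma link_diag p q x : link p q x x = 0.
Proof. by rewrite /link andbC subrr. Qed.

Definition flip_sign (b : bool) : int := if b then 1 else -1.

(** Reduces the crossings where the moving strand is under to those where it
    is over. *)
Lemma chord_term_flip_sign o L b e :
  (forall x y, o y x = - o x y) -> e.1.1 = e.2.1 ->
  chord_term T o L (flip b e) =
  T e.1.1 (flip_sign b * o e.1 e.2) (flip_sign b * chord_index o L e.1 e.2).
Proof.
move=> oC E; rewrite /chord_term; case: b; first by rewrite !mul1r.
by rewrite !mulN1r /= -E index_swap oC.
Qed.

Lemma flip_comp b e : ((flip b e).1.1 == (flip b e).2.1) = (e.1.1 == e.2.1).
Proof. by case: b => //=; rewrite eq_sym. Qed.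

Definition is_over (w : passage) := if w is Over then true else false.

Lemma passes_through C A (c : crossing R k) : passes Through C A c -> kind c = Virtual.
Proof. by case/andP => /eqP. Qed.

Lemma passes_flip w C A (c : crossing R k) : w <> Through -> passes w C A c ->
  exists x y, [/\ on_arc C x, on_arc A y & c = (Classical, flip (is_over w) (x, y))].
Proof.
case: c => K [x y]; case: w => // _; rewrite /passes /meet /kind /strand1 /strand2 /=;
  rewrite orbF => /andP[/eqP-> /andP[H1 H2]].
- by exists x, y.
- by exists y, x.
Qed.

Lemma strands_flip K b x y : x \in strands (K, flip b (x, y)) /\ y \in strands (K, flip b (x, y)).
Proof. by case: b; rewrite !inE /strand1 /strand2 /= !eqxx ?orbT. Qed.

Lemma flip_strands K b x y z : z \in strands (K, flip b (x, y)) -> z = x \/ z = y.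
Proof. by case: b; rewrite !inE => /orP[] /eqP->; auto. Qed.

End Flip.

Section Moves.
Variables (R : realType) (k m n : nat) (V : zmodType) (T : 'I_k -> int -> int -> V).
Hypothesis T0 : forall i s, T i s 0 = 0.
Hypothesis TN : forall i s w, T i (- s) w = - T i s w.
Local Notation strand := (strand R k).
Local Notation poly D := (chord_poly T (orient D) (chords D)).
Implicit Types (D : diagram R k) (p q : strand) (A B C : subarc R k).

Lemma still_off D D' C s e : singular_diagram m n D -> moves_strand C s D D' ->
  e \in chords_of (still_crossings D C) -> off C e.
Proof.
move=> sD mv; rewrite mem_chords_of => cs.
have nC p : p \in strands (Classical, e) -> ~~ on_arc C p.
  move=> pc; have := still_strand sD mv cs pc; apply: contra; exact: on_closed.
by rewrite /off !nC // !inE eqxx ?orbT.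
Qed.

Lemma chords_of_virtual (s : seq (crossing R k)) :
  (forall c, c \in s -> kind c <> Classical) -> chords_of s = [::].
Proof.
move=> H; rewrite /chords_of (@eq_in_filter _ _ pred0) ?filter_pred0 // => c cs /=.
by apply/eqP; exact: H.
Qed.

Lemma moves_virtual D D' C s : singular_diagram m n D -> singular_diagram m n D' ->
  moves_strand C s D D' ->
  (forall E c, E = D \/ E = D' -> c \in strand_crossings E C -> kind c <> Classical) ->
  poly D = poly D'.
Proof.
move=> sD sD' mv H.
apply: (moves_poly sD sD' mv (X := [::]) (X' := [::])).
- by rewrite chords_of_virtual // => c; apply: H; left.
- by rewrite chords_of_virtual // => c; apply: H; right.
- by move=> e _ _; rewrite !chord_index_nil.
- by rewrite !big_nil.
Qed.

(** The new crossing has index 0, and its two strands are on the same free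
    arc, so that it contributes to no other index. *)
Lemma move1_invariant D D' : singular_diagram m n D -> singular_diagram m n D' ->
  move1 D D' -> poly D = poly D'.
Proof.
move=> sD sD' [C [K [c [mv _ tD tD' /andP[/eqP Kc Hc]]]]].
have {Hc}[C1 C2] : on_arc C (strand1 c) /\ on_arc C (strand2 c).
  by case/orP: Hc => [/andP[]|/and3P[_ -> ->]].
have [E|/eqP nK] := eqVneq K Classical; last first.
  apply: (moves_virtual sD sD' mv) => F d [->|->]; rewrite ?tD ?tD' // inE => /eqP->.
  by rewrite Kc.
have Ec : c = (Classical, (strand1 c, strand2 c)) by apply: crossing_eq; rewrite // Kc E.
apply: (moves_poly sD sD' mv (X := [::]) (X' := [:: (strand1 c, strand2 c)])).
- by rewrite tD.
- by rewrite tD' Ec.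
- move=> e eL Ee; rewrite chord_index_nil chord_index_cons chord_index_nil addr0 /=.
  have /andP[n1 n2] := still_off sD mv eL.
  rewrite (link_const Ee n1 n2 n1 n2 C1 C1 C2 C1) link_diag mulr0 //.
- rewrite big_nil big_cons big_nil; case: ifP => //= _; rewrite addr0.
  rewrite /chord_term /= chord_index_cat chord_index_cons chord_index_nil /= link_self mulr0 !addr0.
  rewrite /chord_index big1_seq ?T0 // => e /andP[_ eL].
  have /andP[n1 n2] := still_off sD mv eL.
  by rewrite (link_kink C1 C2 n1 n2) mulr0.
Qed.

End Moves.

(** * The second move *)

Section Moves23.
Variables (R : realType) (k m n : nat) (V : zmodType) (T : 'I_k -> int -> int -> V).
Hypothesis TN : forall i s w, T i (- s) w = - T i s w.
Local Notation strand := (strand R k).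
Local Notation poly D := (chord_poly T (orient D) (chords D)).
Implicit Types (D E : diagram R k) (p q x y z : strand) (A B C : subarc R k).

Lemma disjoint_distinct A B : arc_start A < arc_end A -> disjoint_arcs A B -> A != B.
Proof.
move=> se; apply: contraTneq => <-; rewrite /disjoint_arcs eqxx /=.
by rewrite orbb -leNgt ltW.
Qed.

Lemma moves_range D D' C s A : moves_strand C s D D' -> A \in C :: s ->
  arc_start A < arc_end A.
Proof.
by case=> u [r [_ [/allP rng _] _ _ _]] /rng/andP[/andP[_ ->]].
Qed.

Lemma moves_disjoint D D' C s : moves_strand C s D D' -> pairwise (@disjoint_arcs R k) (C :: s).
Proof. by case=> u [r [_ [_ dis] _ _ _]]. Qed.

Lemma two_crossings E C c d : singular_diagram m n E ->
  perm_eq (strand_crossings E C) [:: c; d] ->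
  [/\ c \in crossings E, d \in crossings E, c != d &
      forall e p, e \in crossings E -> p \in strands e -> on_arc C p -> e = c \/ e = d].
Proof.
move=> sE pE.
have mem e : (e \in crossings E) && touches C e = (e \in [:: c; d]).
  by rewrite -(perm_mem pE) mem_filter andbC.
have sub e : e \in [:: c; d] -> e \in crossings E by rewrite -mem => /andP[].
split.
- by apply: sub; rewrite inE eqxx.
- by apply: sub; rewrite !inE eqxx orbT.
- have : uniq [:: c; d] by rewrite -(perm_uniq pE) filter_uniq // (crossings_uniq sE).
  by rewrite /= inE andbT.
- move=> e p eE pe Cp; have := mem e; rewrite eE (touches_strand pe Cp) /= !inE.
  by move/esym/orP => [] /eqP; auto.
Qed.

Lemma arc_param_neq E A c d p q : singular_diagram m n E -> c \in crossings E ->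
  d \in crossings E -> c != d -> p \in strands c -> q \in strands d ->
  on_arc A p -> on_arc A q -> p.2 != q.2.
Proof.
move=> sE cE dE cd pc qd Ap Aq; apply: contraNneq cd => pq.
have E' : p = q by apply: strand_eq pq; apply: on_arc_comp Ap Aq.
by apply/eqP; apply: (shared_strand sE cE dE pc); rewrite E'.
Qed.

(** Virtual crossings do not enter the polynomial. *)
Lemma through_invariant D D' C s : singular_diagram m n D -> singular_diagram m n D' ->
  moves_strand C s D D' ->
  (forall E c, E = D \/ E = D' -> c \in strand_crossings E C -> kind c = Virtual) ->
  poly D = poly D'.
Proof.
by move=> sD sD' mv H; apply: (moves_virtual T sD sD' mv) => E c hE /(H E c hE) ->.
Qed.

Lemma through_cases (w : passage) : w = Through \/ w <> Through.
Proof. by case: w; [right|right|left]. Qed.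

(** The two new crossings have opposite signs; their contributions to the
    other indices cancel, and so do their own terms because they have the
    same index. *)
Lemma move2_invariant D D' : singular_diagram m n D -> singular_diagram m n D' ->
  move2 D D' -> poly D = poly D'.
Proof.
move=> sD sD' [C [A [w [c [d [mv tD tD' wc wd]]]]]].
case: (through_cases w) => wT.
  rewrite wT in wc wd.
  apply: (through_invariant sD sD' mv) => E e [->|->]; rewrite ?tD // (perm_mem tD') !inE.
  by case/orP=> /eqP->; apply: passes_through; [apply: wc|apply: wd].
have [cD' dD' ncd only] := two_crossings sD' tD'.
have [x1 [y1 [Cx1 Ay1 Ec]]] := passes_flip wT wc.
have [x2 [y2 [Cx2 Ay2 Ed]]] := passes_flip wT wd.
set b := is_over w in Ec Ed.
have [u [r [pD pD']]] := moves_pictures mv.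
have [Cr Ar] : C \in [:: C; A] /\ A \in [:: C; A] by rewrite !inE !eqxx orbT.
have := moves_disjoint mv; rewrite /= !andbT => dCA.
have CA : C != A := disjoint_distinct (moves_range mv Cr) dCA.
have stA : straight D A by apply: (moves_straight mv); rewrite inE.
have stA' : straight D' A by apply: (moves_straight' mv); rewrite ?inE // eq_sym.
have [x1c y1c] := strands_flip Classical b x1 y1; rewrite -Ec in x1c y1c.
have [x2d y2d] := strands_flip Classical b x2 y2; rewrite -Ed in x2d y2d.
have nx : x1.2 != x2.2 := arc_param_neq sD' cD' dD' ncd x1c x2d Cx1 Cx2.
have uniq0 z : on_closed_arc C z -> arc_offset D' A (position D' z) = 0 -> z = x1 \/ z = x2.
  move=> Cz z0; have [e [q [eD' ze qe {}Cz Aq]]] := offset_zero sD' pD' Ar stA' Cr CA Cz z0.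
  have nA t : on_arc A t -> t <> z.
    by move=> At E; move: (disjoint_off dCA Cz); rewrite -E At.
  by case: (only e z eD' ze Cz) => E; move: ze; rewrite E ?Ec ?Ed => /flip_strands[->|E']; auto;
    [case: (nA y1)|case: (nA y2)].
have o12 : orient D' x2 y2 = - orient D' x1 y1.
  case: (ltgtP x1.2 x2.2) nx => // lt _.
    exact: (bigon_orient sD' pD' Ar stA' Cr CA cD' dD' x1c y1c x2d y2d).
  rewrite (bigon_orient sD' pD' Ar stA' Cr CA dD' cD' x2d y2d x1c y1c Cx2 Ay2 Cx1 Ay1 lt) ?opprK //.
  by move=> z Cz z0; case: (uniq0 z Cz z0); auto.
have oC := @orientC R k D'.
set L := chords_of (still_crossings D C).
have offC e : e \in L -> off C e := fun eL => still_off sD mv eL.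
have offA e : e \in L -> off A e.
  move=> eL; have /andP[n1 n2] := offC e eL; move: eL; rewrite mem_chords_of mem_filter => /andP[_ eD].
  have [_ _ ne E _] := diag_crossings sD eD.
  have other p q : p \in strands (Classical, e) -> q \in strands (Classical, e) ->
      position D p = position D q -> p != q -> ~~ on_arc C q -> ~~ on_arc A p.
    move=> pe qe Epq npq nCq; apply/negP => Ap.
    have [B] := pic_crossing_other sD pD Ar eD pe qe Ap.
    rewrite !inE => /orP[] /eqP-> Bq; first by rewrite Bq in nCq.
    case/eqP: npq; exact: (arc_injective sD pD Ar stA (on_closed Ap) (on_closed Bq)).
  have [m1 m2] := strands_flip Classical true e.1 e.2; rewrite /= -surjective_pairing in m1 m2.
  by apply/andP; split; [apply: (other _ e.2)|apply: (other _ e.1)]; rewrite // eq_sym.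
pose X := map (flip b) [:: (x1, y1); (x2, y2)].
apply: (moves_poly sD sD' mv (X := [::]) (X' := X)).
- by rewrite tD.
- by apply: (perm_trans (chords_of_perm tD')); rewrite Ec Ed.
- move=> e eL Ee; rewrite index_flip // !chord_index_cons !chord_index_nil /= addr0 o12.
  have /andP[n1 n2] := offC e eL; have /andP[n3 n4] := offA e eL.
  by rewrite (link_const Ee n1 n2 n3 n4 Cx1 Cx2 Ay1 Ay2) mulNr subrr.
- rewrite big_nil {1}/X big_map !big_cons big_nil !flip_comp /=.
  rewrite -(on_arc_comp Cx1 Cx2) -(on_arc_comp Ay1 Ay2).
  case: eqP => // E1; have E2 : x2.1 = y2.1 by rewrite -(on_arc_comp Cx1 Cx2) E1 (on_arc_comp Ay1 Ay2).
  rewrite !chord_term_flip_sign //= o12 -(on_arc_comp Cx1 Cx2).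
  rewrite (_ : chord_index _ _ x2 y2 = chord_index (orient D') (L ++ X) x1 y1).
    by rewrite mulrN TN addr0 subrr.
  rewrite !chord_index_cat (index_shift (orient D') dCA E1 Cx1 Cx2 Ay1 Ay2); last first.
    by move=> e eL; rewrite offC ?offA.
  congr (_ + _); rewrite !index_flip // !chord_index_cons !chord_index_nil /= !link_self o12.
  by rewrite (link_bigon dCA E1 Cx1 Cx2 Ay1 Ay2) !mulr0 !addr0 add0r mulrNN.
Qed.

End Moves23.

(** * The third move: the triangle *)

Lemma sgz_subC (R : realType) (s t : R) : sgz (s - t) = - sgz (t - s).
Proof. by rewrite -sgzN opprB. Qed.

Lemma sgz_sub_sqr (R : realType) (s t : R) : s != t -> sgz (s - t) * sgz (s - t) = 1.
Proof.
by rewrite -subr_eq0; case: sgzP => // _ _; rewrite ?mulr1 ?mulrNN ?mulr1.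
Qed.

(** The relations at two corners of the triangle imply the relation at the
    third one. *)
Lemma triangle_sign (u v w t s1 s2 : int) : u * u = 1 ->
  u * s2 = v * t -> - u * s1 = w * - t -> - v * - s1 = - w * - s2.
Proof.
move=> uu E2 E1.
have -> : - v * - s1 = v * (u * u) * s1 by rewrite uu; ring.
have -> : v * (u * u) * s1 = - (v * u) * (- u * s1) by ring.
have -> : - w * - s2 = w * (u * u) * s2 by rewrite uu; ring.
have -> : w * (u * u) * s2 = w * u * (u * s2) by ring.
by rewrite E1 E2; ring.
Qed.

Section Move3.
Variables (R : realType) (k m n : nat) (V : zmodType) (T : 'I_k -> int -> int -> V).
Local Notation strand := (strand R k).
Local Notation poly D := (chord_poly T (orient D) (chords D)).
Implicit Types (D E : diagram R k) (p q x y z a b : strand) (A B C : subarc R k).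

(** Along C the offset from A has a single zero, so that its slope there has
    the sign of the offset at the end of C, which does not move. *)
Lemma end_side E u r C A B c d x y :
  singular_diagram m n E -> disc_picture u r [:: C; A; B] E ->
  disjoint_arcs C A -> disjoint_arcs C B -> disjoint_arcs A B -> straight E A ->
  (forall e p, e \in crossings E -> p \in strands e -> on_arc C p -> e = c \/ e = d) ->
  c \in crossings E -> x \in strands c -> y \in strands c ->
  (forall p, p \in strands c -> p = x \/ p = y) ->
  (forall p, p \in strands d -> on_arc C p \/ on_arc B p) ->
  on_arc C x -> on_arc A y ->
  (forall t, on_closed_arc C t -> arc_offset E A (position E t) = 0 -> t = x) /\
  orient E x y = sgz (arc_offset E A (position E (arc_comp C, arc_end C))).
Proof.
move=> sE pE dCA dCB dAB stA only cE xc yc onlyc dstr Cx Ay.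
have Ar : A \in [:: C; A; B] by rewrite !inE eqxx orbT.
have Cr : C \in [:: C; A; B] by rewrite !inE eqxx.
have [_ Cse _] := pic_range pE Cr.
have CA := disjoint_distinct Cse dCA.
have uniq0 t : on_closed_arc C t -> arc_offset E A (position E t) = 0 -> t = x.
  move=> Ct t0; have [e [q [eE te qe {}Ct Aq]]] := offset_zero sE pE Ar stA Cr CA Ct t0.
  have := only e t eE te Ct => -[] Ee; subst e.
    case: (onlyc t te) => // ty; have := disjoint_off dCA Ct.
    by rewrite ty Ay.
  have dAC : disjoint_arcs A C by rewrite disjoint_arcsC.
  case: (dstr q qe) => H; first by have := disjoint_off dAC Aq; rewrite H.
  by have := disjoint_off dAB Aq; rewrite H.
split=> //.
have xe : x.2 < arc_end C by case/andP: Cx => _ /andP[].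
rewrite (sgz_offset sE pE Ar stA Cr CA cE xc yc Cx Ay uniq0 (on_closed_end pE Cr)) /=.
  by rewrite gtr0_sgz ?subr_gt0 // mul1r.
by apply: contraTneq xe => <-; rewrite /= ltxx.
Qed.

(** Before and after the move the crossings of C are described by the same
    signs s1, s2 and by the same two relations between signs and orders; only
    the strands x, y, x', z differ. *)
Definition triangle_config E C A B (a b : strand) (s1 s2 : int) (over : bool)
    (x y x' z : strand) : Prop :=
  [/\ perm_eq (chords_of (strand_crossings E C)) (map (flip over) [:: (x, y); (x', z)]),
      [/\ on_arc C x, on_arc C x', on_arc A y & on_arc B z],
      [/\ x.2 != x'.2, y.2 != a.2 & z.2 != b.2],
      orient E x y = s1 /\ orient E x' z = s2 &
      sgz (x.2 - x'.2) * s2 = sgz (y.2 - a.2) * orient E a b /\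
      sgz (x'.2 - x.2) * s1 = sgz (z.2 - b.2) * orient E b a].

Lemma slide_config E u r C A B w c d e a b :
  singular_diagram m n E -> disc_picture u r [:: C; A; B] E ->
  disjoint_arcs C A -> disjoint_arcs C B -> disjoint_arcs A B ->
  straight E A -> straight E B -> w <> Through ->
  perm_eq (strand_crossings E C) [:: c; d] -> passes w C A c -> passes w C B d ->
  e \in crossings E -> ~~ touches C e -> a \in strands e -> b \in strands e ->
  on_arc A a -> on_arc B b ->
  exists x y x' z, triangle_config E C A B a b
    (sgz (arc_offset E A (position E (arc_comp C, arc_end C))))
    (sgz (arc_offset E B (position E (arc_comp C, arc_end C)))) (is_over w) x y x' z.
Proof.
move=> sE pE dCA dCB dAB stA stB wT tE wc wd eE te ae be Aa Bb.
have [cE dE ncd only] := two_crossings sE tE.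
have [x [y [Cx Ay Ec]]] := passes_flip wT wc.
have [x' [z [Cx' Bz Ed]]] := passes_flip wT wd.
set o := is_over w in Ec Ed *.
have [xc yc] := strands_flip Classical o x y; rewrite -Ec in xc yc.
have [xd zd] := strands_flip Classical o x' z; rewrite -Ed in xd zd.
have Ar : A \in [:: C; A; B] by rewrite !inE eqxx orbT.
have Br : B \in [:: C; A; B] by rewrite !inE eqxx !orbT.
have Cr : C \in [:: C; A; B] by rewrite !inE eqxx.
have [_ Cse _] := pic_range pE Cr.
have CA := disjoint_distinct Cse dCA; have CB := disjoint_distinct Cse dCB.
have dBA : disjoint_arcs B A by rewrite disjoint_arcsC.
have onlyc p : p \in strands c -> p = x \/ p = y by rewrite Ec => /flip_strands.
have onlyd p : p \in strands d -> p = x' \/ p = z by rewrite Ed => /flip_strands.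
have ond p : p \in strands d -> on_arc C p \/ on_arc B p.
  by move=> /onlyd[->|->]; [left|right].
have onc p : p \in strands c -> on_arc C p \/ on_arc A p.
  by move=> /onlyc[->|->]; [left|right].
have [u0A s1] := end_side sE pE dCA dCB dAB stA only cE xc yc onlyc ond Cx Ay.
(* The same disc with the chords in the other order, to see B in the role of A. *)
have pE' : disc_picture u r [:: C; B; A] E.
  have mm X : (X \in [:: C; B; A]) = (X \in [:: C; A; B]) by rewrite !inE (orbC (X == B)).
  have hh (P : pred (subarc R k)) : has P [:: C; B; A] = has P [:: C; A; B].
    by rewrite /= !orbF (orbC (P B)).
  case: pE => h1 h2 [h3 h4]; split=> [X|X Y|]; rewrite ?mm; [exact: h1|exact: h2|].
  by split=> // p p01; rewrite !hh; apply: h3.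
have only' e' p : e' \in crossings E -> p \in strands e' -> on_arc C p -> e' = d \/ e' = c.
  by move=> h1 h2 h3; case: (only e' p h1 h2 h3); auto.
have [u0B s2] := end_side sE pE' dCB dCA dBA stB only' dE xd zd onlyd onc Cx' Bz.
have nxx : x.2 != x'.2 := arc_param_neq sE cE dE ncd xc xd Cx Cx'.
have nce : c != e by apply: contraNneq te => <-; apply: touches_strand xc Cx.
have nde : d != e by apply: contraNneq te => <-; apply: touches_strand xd Cx'.
have xx : x != x' by apply: contraNneq nxx => ->.
exists x, y, x', z; split.
- by apply: (perm_trans (chords_of_perm tE)); rewrite Ec Ed.
- by [].
- split=> //; first exact: (arc_param_neq sE cE eE nce yc ae Ay Aa).
  exact: (arc_param_neq sE dE eE nde zd be Bz Bb).
- by rewrite s1 s2.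
- split.
    rewrite -s2; exact: (triangle_orient sE pE Cr Ar Br CB stA stB cE dE eE xc yc xd zd ae be
      Cx Ay Cx' Bz Aa Bb u0B xx).
  rewrite -s1; rewrite eq_sym in xx.
  exact: (triangle_orient sE pE Cr Br Ar CA stB stA dE cE eE xd zd xc yc be ae
      Cx' Bz Cx Ay Bb Aa u0A xx).
Qed.

(** The index of each of the three crossings of the triangle is constant by
    [triangle_index], used with the three choices of the first side; the other
    indices only see arcs. *)
Lemma triangle_poly_local D D' C A B (a b : strand) s1 s2 over L0
    x y x' z X Y X' Z :
  disjoint_arcs C A -> disjoint_arcs C B -> disjoint_arcs A B ->
  on_arc A a -> on_arc B b ->
  triangle_config D C A B a b s1 s2 over x y x' z ->
  triangle_config D' C A B a b s1 s2 over X Y X' Z ->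
  orient D' a b = orient D a b ->
  (forall e, e \in L0 -> [/\ off C e, off A e, off B e &
      orient D' e.1 e.2 = orient D e.1 e.2]) ->
  let P := map (flip over) [:: (x, y); (x', z)] in
  let P' := map (flip over) [:: (X, Y); (X', Z)] in
  let L := (a, b) :: L0 in
  (forall e, e \in L -> e.1.1 = e.2.1 ->
     chord_index (orient D) P e.1 e.2 = chord_index (orient D') P' e.1 e.2) /\
  \sum_(e <- P | e.1.1 == e.2.1) chord_term T (orient D) (L ++ P) e =
  \sum_(e <- P' | e.1.1 == e.2.1) chord_term T (orient D') (L ++ P') e.
Proof.
move=> dCA dCB dAB Aa Bb [_ [Cx Cx' Ay Bz] [nx ny nz] [e1 e2] [R1 R2]].
move=> [_ [CX CX' AY BZ] [nX nY nZ] [f1 f2] [R1' R2']] oab base P P' L.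
have dBA : disjoint_arcs B A by rewrite disjoint_arcsC.
have dAC : disjoint_arcs A C by rewrite disjoint_arcsC.
have dBC : disjoint_arcs B C by rewrite disjoint_arcsC.
have oC := @orientC R k D; have oC' := @orientC R k D'.
have iP p q : chord_index (orient D) P p q = s1 * link p q x y + s2 * link p q x' z.
  by rewrite index_flip // !chord_index_cons chord_index_nil addr0 e1 e2.
have iP' p q : chord_index (orient D') P' p q = s1 * link p q X Y + s2 * link p q X' Z.
  by rewrite index_flip // !chord_index_cons chord_index_nil addr0 f1 f2.
split.
  move=> e; rewrite inE iP iP' => /predU1P[->|eL] Ee /=.
  - (* At the crossing of the two chords the sides are read in the order
       A, B, C, which exchanges the strands of the two other crossings. *)
    have R2n : - sgz (x.2 - x'.2) * s1 = sgz (z.2 - b.2) * - orient D a b.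
      by rewrite -sgz_subC -oC.
    have R2n' : - sgz (X.2 - X'.2) * s1 = sgz (Z.2 - b.2) * - orient D' a b.
      by rewrite -sgz_subC -oC'.
    have q1 := triangle_sign (sgz_sub_sqr nx) R1 R2n.
    have q2 := triangle_sign (sgz_sub_sqr nX) R1' R2n'.
    rewrite -!sgz_subC in q1 q2; rewrite /= in Ee.
    rewrite eq_sym in ny; rewrite eq_sym in nz; rewrite eq_sym in nY; rewrite eq_sym in nZ.
    have := triangle_index dAB dAC dBC Ee Aa Ay Bb Bz Cx Cx' ny nz q1 Aa AY Bb BZ CX CX' nY nZ q2.
    rewrite !(link_swapr _ _ x y) !(link_swapr _ _ X Y) !(link_swapr _ _ x' z) !(link_swapr _ _ X' Z).
    by rewrite !mulrNN.
  - have [/andP[c1 c2] /andP[a1 a2] /andP[b1 b2] _] := base e eL.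
    by rewrite (link_const Ee c1 c2 a1 a2 Cx CX Ay AY) (link_const Ee c1 c2 b1 b2 Cx' CX' Bz BZ).
have i0 p q : chord_index (orient D') L0 p q = chord_index (orient D) L0 p q.
  by apply/esym/eq_index => e /base[].
have iL p q : chord_index (orient D) (L ++ P) p q =
    orient D a b * link p q a b + chord_index (orient D) L0 p q +
    (s1 * link p q x y + s2 * link p q x' z).
  by rewrite chord_index_cat chord_index_cons iP.
have iL' p q : chord_index (orient D') (L ++ P') p q =
    orient D a b * link p q a b + chord_index (orient D) L0 p q +
    (s1 * link p q X Y + s2 * link p q X' Z).
  by rewrite chord_index_cat chord_index_cons iP' i0 oab.
rewrite {1}/P {1}/P' !big_map [LHS]big_mkcond [RHS]big_mkcond !big_cons !big_nil !flip_comp /=.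
rewrite -(on_arc_comp Cx CX) -(on_arc_comp Ay AY) -(on_arc_comp Cx' CX') -(on_arc_comp Bz BZ).
congr (_ + (_ + _)); case: eqP => // E.
- have E' : X.1 = Y.1 by rewrite -(on_arc_comp Cx CX) E (on_arc_comp Ay AY).
  rewrite !chord_term_flip_sign //= e1 f1 -(on_arc_comp Cx CX); congr (T _ _ (_ * _)).
  rewrite iL iL' !link_self !mulr0 !add0r.
  rewrite (index_shift (orient D) dCA E Cx CX Ay AY); last first.
    by move=> e /base[-> -> _ _].
  rewrite ![orient D a b * _ + _]addrC -!addrA; congr (_ + _).
  rewrite oab in R1'; rewrite ![orient D a b * _ + _]addrC.
  exact: (triangle_index dCA dCB dAB E Cx Cx' Ay Aa Bz Bb nx ny R1 CX CX' AY Aa BZ Bb nX nY R1').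
- have E' : X'.1 = Z.1 by rewrite -(on_arc_comp Cx' CX') E (on_arc_comp Bz BZ).
  rewrite !chord_term_flip_sign //= e2 f2 -(on_arc_comp Cx' CX'); congr (T _ _ (_ * _)).
  rewrite iL iL' !link_self !mulr0 !addr0.
  rewrite (index_shift (orient D) dCB E Cx' CX' Bz BZ); last first.
    by move=> e /base[-> _ -> _].
  rewrite ![orient D a b * _ + _]addrC -!addrA; congr (_ + _).
  rewrite oC' oab -oC in R2'; rewrite eq_sym in nx; rewrite eq_sym in nX.
  have := triangle_index dCB dCA dBA E Cx' Cx Bz Bb Ay Aa nx nz R2 CX' CX BZ Bb AY Aa nX nZ R2'.
  by rewrite oC !mulNr ![link _ _ b a]link_swapr !mulrN !opprK ![s1 * _ + _]addrC.
Qed.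

End Move3.

(** * The third move, and the number of double points *)

Section Slide.
Variables (R : realType) (k m n : nat) (V : zmodType) (T : 'I_k -> int -> int -> V).
Local Notation strand := (strand R k).
Local Notation poly D := (chord_poly T (orient D) (chords D)).
Implicit Types (D E : diagram R k) (p q x y z a b : strand) (A B C : subarc R k).

Lemma perm_chord_term o (L L' : seq (strand * strand)) e : perm_eq L L' ->
  chord_term T o L e = chord_term T o L' e.
Proof. by move=> LL'; rewrite /chord_term (perm_index _ _ _ LL'). Qed.

Lemma slide_virtual w K D D' : w = Through ->
  singular_diagram m n D -> singular_diagram m n D' -> slide w K D D' -> poly D = poly D'.
Proof.
move=> -> sD sD' [C [A [B [mv _ cross]]]].
apply: (through_invariant T sD sD' mv) => E e hE.
have [c [d [pE pc pd]]] := cross E hE; rewrite (perm_mem pE) !inE.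
by case/orP=> /eqP->; apply: passes_through; [apply: pc|apply: pd].
Qed.

(** It remains to see that the crossing of A and B is the only crossing of
    these arcs apart from those with C: a chord does not meet itself, and two
    chords meet at most once. *)
Lemma slide_invariant w D D' :
  singular_diagram m n D -> singular_diagram m n D' -> slide w Classical D D' ->
  poly D = poly D'.
Proof.
move=> sD sD' sl; case: (through_cases w) => [/slide_virtual|] wT; first exact: wT sl.
have [C [A [B [mv /hasP[[K [a b]] eD Hab] cross]]]] := sl.
move: Hab; rewrite /meet /kind /strand1 /strand2 /= orbF => /andP[/eqP EK /andP[Aa Bb]].
subst K; have := moves_disjoint mv; rewrite /= !andbT => /andP[/andP[dCA dCB] dAB].
have [Cr Ar Br] : [/\ C \in [:: C; A; B], A \in [:: C; A; B] & B \in [:: C; A; B]].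
  by rewrite !inE !eqxx !orbT.
have CA := disjoint_distinct (moves_range mv Cr) dCA.
have CB := disjoint_distinct (moves_range mv Cr) dCB.
have AB := disjoint_distinct (moves_range mv Ar) dAB.
have [As Bs] : A \in [:: A; B] /\ B \in [:: A; B] by rewrite !inE !eqxx !orbT.
have [AC BC] : A != C /\ B != C by rewrite !(eq_sym _ C).
have [dAC dBC] : disjoint_arcs A C /\ disjoint_arcs B C by rewrite ![disjoint_arcs _ C]disjoint_arcsC.
have [stA stB] := (moves_straight mv As, moves_straight mv Bs).
have [stA' stB'] := (moves_straight' mv As AC, moves_straight' mv Bs BC).
have [u [r [pD pD']]] := moves_pictures mv.
have te : ~~ touches C (Classical, (a, b)).
  by rewrite /touches /= (negPf (disjoint_off dAC Aa)) (negPf (disjoint_off dBC Bb)).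
set L := chords_of (still_crossings D C).
have abL : (a, b) \in L by rewrite mem_chords_of mem_filter te eD.
have eD' : (Classical, (a, b)) \in crossings D'.
  by move: abL; rewrite -(perm_mem (still_chords sD sD' mv)) mem_chords_of mem_filter => /andP[].
have ae : a \in strands (Classical, (a, b)) by rewrite inE eqxx.
have be : b \in strands (Classical, (a, b)) by rewrite !inE eqxx orbT.
have [c [d [tD wc wd]]] := cross D (or_introl erefl).
have [c' [d' [tD' wc' wd']]] := cross D' (or_intror erefl).
have [x [y [x' [z cfg]]]] := slide_config sD pD dCA dCB dAB stA stB wT tD wc wd eD te ae be Aa Bb.
have := slide_config sD' pD' dCA dCB dAB stA' stB' wT tD' wc' wd' eD' te ae be Aa Bb.
have Eend : position D' (arc_comp C, arc_end C) = position D (arc_comp C, arc_end C).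
  have [_ e01] := pic_source pD Cr (on_closed_end pD Cr).
  by rewrite (moves_position mv e01) // /on_arc /= ltxx !andbF.
have [EA1 EA2] := moves_arc_ends mv As AC; have [EB1 EB2] := moves_arc_ends mv Bs BC.
rewrite /arc_offset EA1 EA2 EB1 EB2 Eend -/(arc_offset D A _) -/(arc_offset D B _).
move=> [X [Y [X' [Z cfg']]]].
pose L0 := rem (a, b) L.
have pL : perm_eq L ((a, b) :: L0) := perm_to_rem abL.
have uL : uniq L by apply/chords_of_uniq/filter_uniq/(crossings_uniq sD).
have oab : orient D' a b = orient D a b := still_orient sD sD' mv abL.
have base e : e \in L0 -> [/\ off C e, off A e, off B e & orient D' e.1 e.2 = orient D e.1 e.2].
  rewrite (mem_rem_uniq _ uL) inE => /andP[/= nab eL].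
  have oC := still_off sD mv eL.
  have fD : (Classical, e) \in crossings D.
    by move: eL; rewrite mem_chords_of mem_filter => /andP[].
  have nfe : (Classical, e) <> (Classical, (a, b)) by case=> E; rewrite E eqxx in nab.
  have [_ _ ne Epos _] := diag_crossings sD fD.
  have s1 : e.1 \in strands (Classical, e) by rewrite inE eqxx.
  have s2 : e.2 \in strands (Classical, e) by rewrite !inE eqxx orbT.
  have other p q : p \in strands (Classical, e) -> q \in strands (Classical, e) ->
      position D p = position D q -> p != q -> ~~ on_arc C q ->
      ~~ on_arc A p /\ ~~ on_arc B p.
    move=> pe qe Epq npq nCq.
    have inj X1 : X1 \in [:: C; A; B] -> straight D X1 -> on_arc X1 p -> on_arc X1 q -> False.
      move=> X1r stX Xp Xq; case/eqP: npq.
      exact: (arc_injective sD pD X1r stX (on_closed Xp) (on_closed Xq)).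
    split; apply/negP => Hp.
      have [X1] := pic_crossing_other sD pD Ar fD pe qe Hp.
      rewrite !inE => /or3P[] /eqP-> Hq; first by rewrite Hq in nCq.
        exact: (inj A).
      exact: nfe (straight_meet sD pD Ar Br AB stA stB fD eD pe qe ae be Hp Hq Aa Bb).
    have [X1] := pic_crossing_other sD pD Br fD pe qe Hp.
    rewrite !inE => /or3P[] /eqP-> Hq; first by rewrite Hq in nCq.
      exact: nfe (straight_meet sD pD Ar Br AB stA stB fD eD qe pe ae be Hq Hp Aa Bb).
    exact: (inj B).
  have /andP[c1 c2] := oC.
  have [a1 b1] := other _ _ s1 s2 Epos ne c2.
  have [a2 b2] : ~~ on_arc A e.2 /\ ~~ on_arc B e.2.
    by apply: (other e.2 e.1) => //; rewrite eq_sym.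
  split; [exact: oC|by rewrite /off a1 a2|by rewrite /off b1 b2|].
  exact: (still_orient sD sD' mv eL).
have [ind sum] := triangle_poly_local T dCA dCB dAB Aa Bb cfg cfg' oab base.
have [[pX _ _ _ _] [pX' _ _ _ _]] := (cfg, cfg').
apply: (moves_poly sD sD' mv pX pX').
  by move=> e eL; apply: ind; rewrite -(perm_mem pL).
move: sum; set P := map _ _; set P' := map _ _ => sum.
have pLc Q : perm_eq (L ++ Q) (((a, b) :: L0) ++ Q) by rewrite perm_cat2r.
rewrite (eq_bigr _ (fun e _ => perm_chord_term _ e (pLc P))) sum.
by apply: eq_bigr => e _; apply: perm_chord_term; rewrite perm_sym pLc.
Qed.

Lemma move3_invariant D D' :
  singular_diagram m n D -> singular_diagram m n D' -> move3 D D' -> poly D = poly D'.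
Proof.
move=> sD sD' [].
- exact: slide_invariant.
- exact: slide_invariant.
- exact: slide_virtual.
- exact: slide_virtual.
Qed.

Hypothesis T0 : forall i s, T i s 0 = 0.
Hypothesis TN : forall i s w, T i (- s) w = - T i s w.

Lemma tangle_move_invariant D D' : singular_diagram m n D -> singular_diagram m n D' ->
  tangle_move m n D D' -> poly D = poly D'.
Proof.
move=> sD sD' [/(planar_isotopic_invariant T sD sD')[]//|[/(reparametrized_invariant T sD sD')[]//|]].
case=> [h|h|h].
- exact: (move1_invariant T0 sD sD' h).
- exact: (move2_invariant TN sD sD' h).
- exact: move3_invariant sD sD' h.
Qed.

End Slide.

Section Doubles.
Variables (R : realType) (k m n : nat).
Implicit Types (D E : diagram R k) (A B C : subarc R k).
Local Notation doubles s := (count (fun c => kind c == Double) s).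

Lemma passes_kind w C A (c : crossing R k) : passes w C A c -> (kind c == Double) = false.
Proof. by case: w => /andP[/eqP->]. Qed.

Lemma slide_double w K D D' : singular_diagram m n D -> singular_diagram m n D' ->
  slide w K D D' -> num_double D' = num_double D.
Proof.
move=> sD sD' [C [A [B [mv _ cross]]]]; have := moves_double sD sD' mv.
have c0 E : E = D \/ E = D' -> doubles (strand_crossings E C) = 0%N.
  move=> /cross[c [d [pE pc pd]]]; rewrite (permP pE) /=.
  by rewrite (passes_kind pc) (passes_kind pd).
by rewrite !c0 ?addn0; auto.
Qed.

(** Outside the disc the crossings correspond to each other with their kinds,
    and the moving strand has as many double points before as after. *)
Lemma move_double D D' : singular_diagram m n D -> singular_diagram m n D' ->
  tangle_move m n D D' \/ rigid_vertex_move D D' -> num_double D' = num_double D.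
Proof.
move=> sD sD'; pose T (i : 'I_k) (s w : int) := 0 : int.
case=> [[|[|[]]]|].
- by case/(planar_isotopic_invariant T sD sD').
- by case/(reparametrized_invariant T sD sD').
- move=> [C [K [c [mv KD tD tD' /andP[/eqP Kc _]]]]]; have := moves_double sD sD' mv.
  by rewrite tD tD' /= Kc; case: eqP => // _; rewrite !addn0.
- move=> [C [A [w [c [d [mv tD tD' pc pd]]]]]]; have := moves_double sD sD' mv.
  by rewrite tD (permP tD') /= (passes_kind pc) (passes_kind pd) !addn0.
- by case; apply: slide_double.
case; try exact: slide_double.
move=> [C [A [x [y [x' [y' [over []]]]]]]] mv tD tD' [/andP[/eqP Kx _] Py _] [/andP[/eqP Kx' _] Py' _].
have := moves_double sD sD' mv; rewrite (permP tD) (permP tD') /=.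
by rewrite Kx Kx' (passes_kind Py) (passes_kind Py') /= => /addIn.
Qed.

Lemma virtual_equiv_poly (V : zmodType) (T : 'I_k -> int -> int -> V) D D' :
  (forall i s, T i s 0 = 0) -> (forall i s w, T i (- s) w = - T i s w) ->
  virtual_equiv m n D D' ->
  chord_poly T (orient D) (chords D) = chord_poly T (orient D') (chords D').
Proof.
move=> T0 TN; elim=> {D D'} [D D' [[sD _] [sD' _] h]|D|D D' _ <-|D D' D'' _ -> _ <-] //.
exact: (tangle_move_invariant T0 TN sD sD' h).
Qed.

Lemma singular_equiv_double D D' : singular_equiv m n D D' -> num_double D' = num_double D.
Proof.
elim=> {D D'} [D D' [sD sD' h]|D|D D' _ <-|D D' D'' _ <- _ <-] //.
exact: move_double h.
Qed.

End Doubles.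

(** * Resolutions of double points *)

Section Resolution.
Variables (R : realType) (k : nat) (V : zmodType) (T : 'I_k -> int -> int -> V).
Variable D : diagram R k.
Local Notation o := (orient D).
Local Notation poly D := (chord_poly T (orient D) (chords D)).
Implicit Types s done todo : seq (crossing R k).

Lemma with_crossings_poly s : poly (with_crossings D s) = chord_poly T o (chords_of s).
Proof.
congr (chord_poly T _ _); apply/funext => p; apply/funext => q.
by rewrite !orientE.
Qed.

(** Double points are kept: every resolution turns them into classical
    crossings, which contribute to the indices in the same way whatever strand
    is over. *)
Definition shadow s := [seq c.2 | c <- s & kind c != Virtual].

Lemma resolution_flip b c : exists b', resolution D b c = (Classical, flip b' c.2).
Proof. by rewrite /resolution; case: ifP => _; [exists true|exists false]; case: c => ? []. Qed.

Let W p q := chord_index o (shadow (crossings D)) p q.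

(** The polynomial with the indices that are common to all resolutions. *)
Definition ideal_poly s : V :=
  \sum_(e <- chords_of s | e.1.1 == e.2.1) T e.1.1 (o e.1 e.2) (W e.1 e.2).

Lemma ideal_poly_rcons s c : ideal_poly (rcons s c) = ideal_poly s + ideal_poly [:: c].
Proof. by rewrite /ideal_poly -cats1 chords_of_cat big_cat. Qed.

Lemma ideal_poly_cons c s : ideal_poly (c :: s) = ideal_poly [:: c] + ideal_poly s.
Proof. by rewrite /ideal_poly -cat1s chords_of_cat big_cat. Qed.

Definition jump c : V :=
  ideal_poly [:: resolution D true c] - ideal_poly [:: resolution D false c].

(** With fixed indices the polynomial is additive in the list of crossings:
    the first alternating difference is the jump of one crossing, and the next
    ones vanish. *)
Lemma resolveE todo done :
  (forall p q, chord_index o (chords_of done) p q + chord_index o (shadow todo) p q = W p q) ->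
  resolve (fun E => poly E) D done todo =
  match count (fun c => kind c == Double) todo with
  | 0%N => ideal_poly done + ideal_poly todo
  | 1%N => \sum_(c <- todo | kind c == Double) jump c
  | _ => 0
  end.
Proof.
elim: todo done => [|c todo IH] done inv /=.
  rewrite with_crossings_poly {2}/ideal_poly big_nil addr0; apply: eq_bigr => e _.
  by rewrite /chord_term -inv [shadow _]/= chord_index_nil addr0.
have step c' :
    (forall p q, chord_index o (chords_of [:: c']) p q = chord_index o (shadow [:: c]) p q) ->
    forall p q, chord_index o (chords_of (rcons done c')) p q
      + chord_index o (shadow todo) p q = W p q.
  move=> E p q; rewrite -cats1 chords_of_cat chord_index_cat E -inv -addrA; congr (_ + _).
  by rewrite -chord_index_cat /shadow -map_cat -filter_cat.
case: ifP => Kc; last first.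
  rewrite IH; last first.
    apply: step => p q; rewrite /chords_of /shadow /=.
    by move: Kc; case: (kind c).
  rewrite add0n big_cons Kc ideal_poly_rcons (ideal_poly_cons c todo).
  by case: count => [|[|n]] //; rewrite addrA.
have res b : forall p q, chord_index o (chords_of (rcons done (resolution D b c))) p q
      + chord_index o (shadow todo) p q = W p q.
  have [b' E] := resolution_flip b c.
  apply: step => p q; rewrite E /shadow /= (eqP Kc) /=.
  rewrite (_ : chords_of _ = map (flip b') [:: c.2]) // index_flip //; exact: orientC.
rewrite !IH // big_cons Kc add1n; case E : count => [|[|n]]; rewrite ?subrr //.
rewrite !ideal_poly_rcons /jump (_ : \sum_(_ <- _ | _) _ = 0); last first.
  rewrite big_mkcond big1_seq // => d /andP[_ dt]; case: ifP => // Kd.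
  by have : has (fun c => kind c == Double) todo; [apply/hasP; exists d|rewrite has_count E].
by rewrite addr0 opprD addrACA subrr addr0 opprD addrACA subrr add0r.
Qed.

Lemma singular_extensionE :
  singular_extension (fun E => poly E) D =
  match num_double D with
  | 0%N => ideal_poly (crossings D)
  | 1%N => \sum_(c <- crossings D | kind c == Double) jump c
  | _ => 0
  end.
Proof.
rewrite /singular_extension resolveE /num_double; last first.
  by move=> p q; rewrite chord_index_nil add0r.
by case: count => // ; rewrite {1}/ideal_poly big_nil add0r.
Qed.

End Resolution.

(** * A long trefoil *)

Lemma derive1_pair (R : realType) (f g : R -> R) t :
  derivable f t 1 -> derivable g t 1 ->
  derivable (fun u => (f u, g u)) t 1 /\
  derive1 (fun u => (f u, g u)) t = (derive1 f t, derive1 g t).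
Proof.
move=> /cvg_derive1 df /cvg_derive1 dg; apply: derive1_cvg.
exact: (@cvg_pair _ _ _ _ (nbhs (derive1 f t)) (nbhs (derive1 g t)) _ _ _ _ _ df dg).
Qed.

Section Trefoil.
Variable R : realType.

Definition time (u : R) : R := 2 * u - 1.

Definition trefoil_time : {poly R} := 2 *: 'X - 1.
(** The curve v |-> (81 v^3 - 49 v, 81 v^4 - 73 v^2) is chosen with rational
    double points: a pair s, t of parameters has 81 (s^2 + s t + t^2) = 49 and
    either s + t = 0 or 81 (s^2 + t^2) = 73, which gives 9 s, 9 t = 7, -7, or
    8, -3, or -8, 3.  The parameters -1 and 1 are sent to the two points on
    the top side. *)
Definition trefoil_x : {poly R} :=
  2^-1%:P + 192%:R^-1 *: (81%:R *: trefoil_time ^+ 3 - 49%:R *: trefoil_time).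
Definition trefoil_y : {poly R} :=
  25%:R^-1 *: (81%:R *: trefoil_time ^+ 4 - 73%:R *: trefoil_time ^+ 2 + 17%:R%:P).

Lemma trefoil_timeE u : trefoil_time.[u] = time u.
Proof. by rewrite /trefoil_time !hornerE. Qed.

Lemma trefoil_time_deriv : trefoil_time^`() = 2%:P.
Proof. by rewrite /trefoil_time !derivCE subr0 alg_polyC. Qed.

Lemma trefoil_xE u : trefoil_x.[u] = 2^-1 + (81 * time u ^+ 3 - 49 * time u) / 192.
Proof.
by rewrite /trefoil_x !(trefoil_timeE, hornerD, hornerN, hornerZ, horner_exp, hornerC) [_ / _]mulrC.
Qed.

Lemma trefoil_yE u : trefoil_y.[u] = (81 * time u ^+ 4 - 73 * time u ^+ 2 + 17) / 25.
Proof.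
by rewrite /trefoil_y !(trefoil_timeE, hornerD, hornerN, hornerZ, horner_exp, hornerC) [_ / _]mulrC.
Qed.

Lemma trefoil_x_deriv u : trefoil_x^`().[u] = (243 * time u ^+ 2 - 49) / 96.
Proof.
rewrite /trefoil_x !(trefoil_time_deriv, derivD, derivN, derivC, derivZ, deriv_exp).
rewrite !(trefoil_timeE, hornerD, hornerN, hornerZ, hornerMn, hornerM, horner_exp, hornerC) /=.
by move: (time u) => v; field.
Qed.

Lemma trefoil_y_deriv u : trefoil_y^`().[u] = (648 * time u ^+ 3 - 292 * time u) / 25.
Proof.
rewrite /trefoil_y !(trefoil_time_deriv, derivD, derivN, derivC, derivZ, deriv_exp).
rewrite !(trefoil_timeE, hornerD, hornerN, hornerZ, hornerMn, hornerM, horner_exp, hornerC) /=.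
by move: (time u) => v; field.
Qed.

(** In the parameter u = (v + 1) / 2 the double points are at multiples of
    1/18. *)
Definition trefoil_strand (j : nat) : strand R 1 := (ord0, j%:R / 18).

Definition trefoil_crossing (K : crossing_kind) (i j : nat) : crossing R 1 :=
  (K, (trefoil_strand i, trefoil_strand j)).

(** The crossing (6, 17) separates the strands of the double point (2, 16);
    it is the only one that contributes to its index. *)
Definition trefoil : diagram R 1 :=
  Diagram (fun _ => false) (fun _ u => (trefoil_x.[u], trefoil_y.[u]))
    [:: trefoil_crossing Double 2 16; trefoil_crossing Classical 6 17;
        trefoil_crossing Virtual 1 12].

Lemma trefoil_velocity (p : strand R 1) :
  velocity trefoil p = (trefoil_x^`().[p.2], trefoil_y^`().[p.2]).
Proof.
have dx : derivable (horner trefoil_x) p.2 1 by exact: derivable_horner.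
have dy : derivable (horner trefoil_y) p.2 1 by exact: derivable_horner.
by have [_ E] := derive1_pair dx dy; rewrite /velocity E !derivE.
Qed.

Lemma trefoil_strand_eq i j : (trefoil_strand i == trefoil_strand j) = (i == j).
Proof.
rewrite /trefoil_strand xpair_eqE eqxx /=.
by rewrite (inj_eq (mulIf _)) ?eqr_nat // invr_eq0 pnatr_eq0.
Qed.

Definition trefoil_pairs : seq (nat * nat) :=
  [:: (2, 16); (16, 2); (6, 17); (17, 6); (1, 12); (12, 1)]%N.

Lemma time_strand (p : strand R 1) (j : nat) : 9 * time p.2 = j%:R - 9 -> p = trefoil_strand j.
Proof.
rewrite /time => E; apply: strand_eq; first by rewrite [LHS]ord1.
rewrite /trefoil_strand /=; lra.
Qed.

Lemma trefoil_double_points (p q : strand R 1) : p != q ->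
  position trefoil p = position trefoil q ->
  exists2 ij, ij \in trefoil_pairs & p = trefoil_strand ij.1 /\ q = trefoil_strand ij.2.
Proof.
move=> npq; rewrite /position /= !trefoil_xE !trefoil_yE => -[Ex Ey].
set s := time p.2 in Ex Ey *; set t := time q.2 in Ex Ey *.
have st : s - t != 0.
  rewrite subr_eq0; apply: contraNneq npq => E; apply/eqP/strand_eq.
    by rewrite [LHS]ord1 [RHS]ord1.
  by move: E; rewrite /s /t /time => E; lra.
(* Divide the equations of the two coordinates by s - t. *)
have E1 : 81 * (s ^+ 2 + s * t + t ^+ 2) = 49.
  apply/eqP; rewrite -subr_eq0; apply/eqP/(mulfI st); rewrite mulr0.
  transitivity (81 * s ^+ 3 - 49 * s - (81 * t ^+ 3 - 49 * t)); first by ring.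
  by lra.
have E2 : (s + t) * (81 * (s ^+ 2 + t ^+ 2) - 73) = 0.
  apply: (mulfI st); rewrite mulr0.
  transitivity (81 * s ^+ 4 - 73 * s ^+ 2 - (81 * t ^+ 4 - 73 * t ^+ 2)); first by ring.
  by lra.
have found i j : (i, j) \in trefoil_pairs -> 9 * s = i%:R - 9 -> 9 * t = j%:R - 9 ->
    exists2 ij, ij \in trefoil_pairs & p = trefoil_strand ij.1 /\ q = trefoil_strand ij.2.
  by move=> ij /time_strand Ep /time_strand Eq; exists (i, j).
move/eqP: E2; rewrite mulf_eq0 => /orP[] /eqP E2.
  have E3 : (9 * s - 7) * (9 * s + 7) = 0.
    have Et : t = - s by lra.
    by rewrite Et in E1; rewrite -[RHS](subrr 49) -[X in _ = X - _]E1; ring.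
  move/eqP: E3; rewrite mulf_eq0 => /orP[] /eqP E3.
    by apply: (found 16%N 2%N); rewrite ?inE //; lra.
  by apply: (found 2%N 16%N); rewrite ?inE //; lra.
have E3 : 81 * (s * t) = - 24 by lra.
(* The values of s t and of s^2 + t^2 give the squares of s + t and s - t. *)
have E4 : (9 * (s + t) - 5) * (9 * (s + t) + 5) = 0.
  transitivity (81 * (s ^+ 2 + s * t + t ^+ 2) + 81 * (s * t) - 25); first by ring.
  by rewrite E1 E3; ring.
have E5 : (9 * (s - t) - 11) * (9 * (s - t) + 11) = 0.
  transitivity (81 * (s ^+ 2 + s * t + t ^+ 2) - 3 * (81 * (s * t)) - 121); first by ring.
  by rewrite E1 E3; ring.
move/eqP: E4; rewrite mulf_eq0 => /orP[] /eqP E4;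
  move/eqP: E5; rewrite mulf_eq0 => /orP[] /eqP E5.
- by apply: (found 17%N 6%N); rewrite ?inE //; lra.
- by apply: (found 6%N 17%N); rewrite ?inE //; lra.
- by apply: (found 12%N 1%N); rewrite ?inE //; lra.
- by apply: (found 1%N 12%N); rewrite ?inE //; lra.
Qed.

End Trefoil.

Section TrefoilDiagram.
Variable R : realType.
Local Notation trefoil := (trefoil R).
Local Notation trefoil_strand := (trefoil_strand R).
Local Notation trefoil_crossing := (trefoil_crossing R).

Lemma time_strandE j : time (trefoil_strand j).2 = (j%:R - 9) / 9.
Proof. by rewrite /time /=; field. Qed.

Lemma trefoil_C1 i : of_class_C1 (curve trefoil i).
Proof.
have dx u : derivable (horner (trefoil_x R)) u 1 by exact: derivable_horner.
have dy u : derivable (horner (trefoil_y R)) u 1 by exact: derivable_horner.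
split=> u; first by have [] := derive1_pair (dx u) (dy u).
rewrite (_ : derive1 _ = fun u => ((trefoil_x R)^`().[u], (trefoil_y R)^`().[u])); last first.
  by apply/funext => w; have [_ E] := derive1_pair (dx w) (dy w); rewrite E !derivE.
have cx := @continuous_horner R (trefoil_x R)^`() u.
have cy := @continuous_horner R (trefoil_y R)^`() u.
exact: (@cvg_pair _ _ _ _ (nbhs (trefoil_x R)^`().[u]) (nbhs (trefoil_y R)^`().[u]) _ _ _ _ _ cx cy).
Qed.

Lemma trefoil_immersed p : velocity trefoil p != 0.
Proof.
rewrite trefoil_velocity trefoil_x_deriv trefoil_y_deriv; move: (time _) => v.
apply/eqP => -[Ex Ey].
have v2 : v ^+ 2 = 49 / 243 by lra.
have v3 : v ^+ 3 = v * (49 / 243) by rewrite exprS v2.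
have v0 : v = 0 by lra.
by move: v2; rewrite v0 expr0n /= => E; lra.
Qed.

(** Each bound is a factorization or a completed square in v. *)
Lemma trefoil_inside (u : R) : 0 < u < 1 -> in_open_square ((trefoil_x R).[u], (trefoil_y R).[u]).
Proof.
move=> /andP[u0 u1]; rewrite /in_open_square /= trefoil_xE trefoil_yE.
have : -1 < time u by rewrite /time; lra.
have : time u < 1 by rewrite /time; lra.
move: (time u) => v v1 v2.
have a1 : (1 - v) * (81 * v ^+ 2 + 81 * v + 32) > 0.
  by apply: mulr_gt0; [lra|nra].
have a2 : (1 + v) * (81 * v ^+ 2 - 81 * v + 32) > 0.
  by apply: mulr_gt0; [lra|nra].
have a3 : (1 - v) * (1 + v) * (81 * v ^+ 2 + 8) > 0.
  by apply: mulr_gt0; [apply: mulr_gt0; lra|nra].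
have a4 : (18 * v ^+ 2 - 73 / 9) ^+ 2 >= 0 by exact: sqr_ge0.
have e1 : (1 - v) * (81 * v ^+ 2 + 81 * v + 32) = 32 - (81 * v ^+ 3 - 49 * v) by ring.
have e2 : (1 + v) * (81 * v ^+ 2 - 81 * v + 32) = 32 + (81 * v ^+ 3 - 49 * v) by ring.
have e3 : (1 - v) * (1 + v) * (81 * v ^+ 2 + 8) = 8 - (81 * v ^+ 4 - 73 * v ^+ 2) by ring.
have e4 : (18 * v ^+ 2 - 73 / 9) ^+ 2 = 4 * (81 * v ^+ 4 - 73 * v ^+ 2) + 5329 / 81 by field.
by apply/andP; split; apply/andP; split; lra.
Qed.

Lemma trefoil_endpoints : perm_eq (endpoints R 2 0)
  [seq curve trefoil i e | i <- [seq i <- enum 'I_1 | ~~ comp_closed trefoil i],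
                           e <- [:: 0; 1]].
Proof.
rewrite filter_predT enum_ordSl enum_ord0 /= /endpoints /= !trefoil_xE !trefoil_yE.
rewrite (_ : (2^-1 + _, _) = (1%:R / 3%:R, 1)); last by rewrite /time; congr pair; field.
rewrite (_ : (2^-1 + _, _) = (2%:R / 3%:R, 1)) //; by rewrite /time; congr pair; field.
Qed.

Lemma lies_at_trefoil K a b i j :
  lies_at (trefoil_strand i) (trefoil_strand j) (trefoil_crossing K a b) =
  (a == i) && (b == j) || (a == j) && (b == i).
Proof. by rewrite /lies_at /strand1 /strand2 /= !trefoil_strand_eq. Qed.

Lemma trefoil_crossing_facts K i j : (i, j) \in [:: (2, 16); (6, 17); (1, 12)]%N ->
  let c := trefoil_crossing K i j in
  [/\ in_source trefoil (strand1 c), in_source trefoil (strand2 c),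
      strand1 c != strand2 c,
      position trefoil (strand1 c) = position trefoil (strand2 c) &
      det2 (velocity trefoil (strand1 c)) (velocity trefoil (strand2 c)) != 0].
Proof.
have src l : (l <= 18)%N -> in_source trefoil (trefoil_strand l).
  rewrite -(ler_nat R) /in_source /= => l18.
  by rewrite divr_ge0 //= ler_pdivrMr // mul1r.
rewrite !inE => ij c.
rewrite /c /trefoil_crossing /strand1 /strand2 /= trefoil_strand_eq !trefoil_velocity.
rewrite /position /= !trefoil_xE !trefoil_yE !trefoil_x_deriv !trefoil_y_deriv.
rewrite -[i%:R / 18]/((trefoil_strand i).2) -[j%:R / 18]/((trefoil_strand j).2) !time_strandE.
case/or3P: ij => /eqP[-> ->]; split; try exact: src; try by [].
all: try by congr pair; field.
all: by rewrite /det2 /=; apply/eqP => E; lra.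
Qed.

Lemma trefoil_singular : singular_diagram 2 0 trefoil.
Proof.
split.
- exact: trefoil_C1.
- by move=> p _; apply: trefoil_immersed.
- by [].
- by move=> i _ t; apply: trefoil_inside.
- move=> i _; rewrite !trefoil_velocity /= !trefoil_y_deriv /time.
  by split; apply/eqP => E; lra.
- exact: trefoil_endpoints.
- by move=> c; rewrite !inE => /or3P[] /eqP->; apply: trefoil_crossing_facts.
- move=> p q _ _ npq E; have [[i j] ij [-> ->]] := trefoil_double_points npq E.
  rewrite /= !lies_at_trefoil; move: ij; rewrite !inE.
  by do 5?[case/orP => [/eqP[-> ->] //|]] => /eqP[-> ->].
- move=> p q r _ _ _ E1 E2.
  have [|n1] := eqVneq p q; first by constructor 1.
  have [|n2] := eqVneq q r; first by constructor 2.
  have [[i j] ij [-> Eq]] := trefoil_double_points n1 E1.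
  have [[i' j'] ij' [Eq' ->]] := trefoil_double_points n2 E2.
  move: Eq'; rewrite Eq => /eqP; rewrite trefoil_strand_eq => /eqP /= Ej; constructor 3.
  suff -> : i = j' by []; move: ij ij'; rewrite -Ej /= !inE.
  by do 5?[case/orP => [/eqP[-> ->] /=|]] => [|||||/eqP[-> ->] /=];
    rewrite /= ?orbF /= => /eqP[->].
Qed.

End TrefoilDiagram.

(** * The variables of the Laurent polynomial ring *)

Module LaurentVariable.
Import -(notations) mpoly.

(** Evaluation of polynomials at an arbitrary integer. *)
Lemma var_constant k (i : 'I_k) (c : int) :
  Laurent.var i = tofrac (mpolyC k c) -> forall a : int, a = c.
Proof.
move=> /eqP; rewrite /Laurent.var tofrac_eq => /eqP E a.
by have := f_equal (meval (fun=> a)) E; rewrite mevalXU mevalC.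
Qed.

Lemma var_neq0 k (i : 'I_k) : Laurent.var i != 0.
Proof.
apply/eqP => E; have /(_ _ 1) := @var_constant k i 0.
by rewrite E mpolyC0 tofrac0 => /(_ erefl).
Qed.

Lemma var_neq1 k (i : 'I_k) : Laurent.var i != 1.
Proof.
apply/eqP => E; have /(_ _ 0) := @var_constant k i 1.
by rewrite E mpolyC1 tofrac1 => /(_ erefl).
Qed.

End LaurentVariable.

(** * The theorem *)

Lemma wriggle_term0 k (i : 'I_k) s : wriggle_term i s 0 = 0.
Proof. by rewrite /wriggle_term expr0z subrr mulr0. Qed.

Lemma wriggle_termN k (i : 'I_k) s w : wriggle_term i (- s) w = - wriggle_term i s w.
Proof. by rewrite /wriggle_term rmorphN mulNr. Qed.

(** The left-hand side is t + 1/t - 2 = (t - 1)^2 / t. *)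
Lemma reciprocal_sum_neq2 (F : fieldType) (t : F) (w : int) :
  t != 0 -> t != 1 -> w = 1 \/ w = - 1 ->
  1%:~R * (t ^ w - 1) - (- 1)%:~R * (t ^ (- w) - 1) != 0.
Proof.
move=> t0 t1 Hw.
have -> : 1%:~R * (t ^ w - 1) - (- 1)%:~R * (t ^ (- w) - 1) = t^-1 * (t - 1) ^+ 2.
  by case: Hw => ->; rewrite ?opprK expr1z exprN1; field.
by rewrite mulf_neq0 ?invr_eq0 // expf_neq0 // subr_eq0.
Qed.

Lemma wriggle_jump k (i : 'I_k) (w : int) : w = 1 \/ w = - 1 ->
  wriggle_term i 1 w - wriggle_term i (- 1) (- w) != 0.
Proof.
exact: (@reciprocal_sum_neq2 (Laurent.field k) (Laurent.var i) w
  (LaurentVariable.var_neq0 i) (LaurentVariable.var_neq1 i)).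
Qed.

Section Jump.
Variables (R : realType) (k : nat) (V : zmodType) (T : 'I_k -> int -> int -> V).
Local Notation W D := (chord_index (orient D) (shadow (crossings D))).

(** Switching the crossing changes its sign and its index; w is the index of
    the positive resolution. *)
Lemma jumpE (D : diagram R k) (p q : strand R k) K :
  p.1 = q.1 -> orient D p q = 1 \/ orient D p q = - 1 ->
  exists w, (w = W D p q \/ w = - W D p q) /\
    jump T D (K, (p, q)) = T p.1 1 w - T p.1 (- 1) (- w).
Proof.
move=> pq o1.
have ideal x y : x.1 = y.1 ->
    ideal_poly T D [:: (Classical, (x, y))] = T x.1 (orient D x y) (W D x y).
  by move=> xy; rewrite /ideal_poly /= big_cons big_nil xy eqxx addr0.
have res b : resolution D b (K, (p, q)) =
    (Classical, if (0 < orient D p q) == b then (p, q) else (q, p)).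
  by rewrite /resolution /strand1 /strand2 /= -sgz_gt0 -orientE; case: ifP.
rewrite /jump !res; case: o1 => E; rewrite E /=.
  exists (W D p q); split; first by left.
  by rewrite !ideal // (orientC D p q) E (index_swap _ _ p q) pq.
exists (- W D p q); split; first by right.
by rewrite !ideal // (orientC D p q) E (index_swap _ _ p q) !opprK pq.
Qed.

End Jump.

Section Trefoil.
Variable R : realType.
Local Notation trefoil := (trefoil R).
Local Notation ts := (trefoil_strand R).

Lemma trefoil_orient i j : (i, j) \in [:: (2, 16); (6, 17)]%N ->
  orient trefoil (ts i) (ts j) = 1 \/ orient trefoil (ts i) (ts j) = - 1.
Proof.
move=> ij; have [|_ _ _ _] := @trefoil_crossing_facts R Virtual i j.
  by move: ij; rewrite !inE => /orP[] ->; rewrite ?orbT.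
rewrite /strand1 /strand2 /= orientE.
by move: (det2 _ _) => d; case: sgzP; auto.
Qed.

Lemma side_trefoil i j l : (i < j)%N ->
  side (ts i) (ts j) (ts l) = (i < l < j)%N /\
  side (ts j) (ts i) (ts l) = ((l < i) || (j < l))%N.
Proof.
move=> ij; have lt a b : (ts a).2 < (ts b).2 = (a < b)%N.
  by rewrite /= ltr_pM2r ?ltr_nat // invr_gt0 ltr0n.
by rewrite /side !eqxx /from_to !lt ij [(j < i)%N]ltnNge (ltnW ij).
Qed.

Lemma trefoil_index : chord_index (orient trefoil) (shadow (crossings trefoil)) (ts 2) (ts 16)
  = orient trefoil (ts 6) (ts 17).
Proof.
rewrite /shadow /= !chord_index_cons chord_index_nil /= link_self mulr0 add0r addr0.
have [S6 S6'] := @side_trefoil 2 16 6 isT; have [S17 S17'] := @side_trefoil 2 16 17 isT.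
by rewrite /link S6 S6' S17 S17' /= mulr1.
Qed.

Lemma trefoil_extension :
  singular_extension (fun E => chord_poly wriggle_term (orient E) (chords E)) trefoil != 0.
Proof.
rewrite singular_extensionE (_ : num_double trefoil = 1%N) //.
rewrite /= !big_cons big_nil /= addr0.
have [w [Hw ->]] := jumpE wriggle_term Double (erefl : (ts 2).1 = (ts 16).1)
  (trefoil_orient (mem_head _ _)).
apply: wriggle_jump; move: Hw; rewrite trefoil_index.
by case: (@trefoil_orient 6 17 isT) => ->; rewrite ?opprK; case; auto.
Qed.

End Trefoil.

Lemma wriggle_invariant (R : realType) :
  tangle_invariant (V := fun k => Laurent.field k) (fun k => @self_crossing_wriggle R k).
Proof.
move=> m n k D D' _ _ eqv; rewrite !self_crossing_wriggleE.
exact: (virtual_equiv_poly (@wriggle_term0 k) (@wriggle_termN k) eqv).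
Qed.

Lemma wriggle_extensionE (R : realType) k (D : diagram R k) :
  singular_extension (@self_crossing_wriggle R k) D =
  singular_extension (fun E => chord_poly wriggle_term (orient E) (chords E)) D.
Proof.
by congr (singular_extension _ D); apply/funext => E; apply: self_crossing_wriggleE.
Qed.

Theorem theorem3p1p1 (R : realType) :
  tangle_invariant (V := fun k => Laurent.field k)
    (fun k => @self_crossing_wriggle R k) /\
  vassiliev_of_order (V := fun k => Laurent.field k)
    (fun k => @self_crossing_wriggle R k) 1.
Proof.
split; first exact: wriggle_invariant.
split.
  split; first exact: wriggle_invariant.
  move=> m n k D D' _ D1 /singular_equiv_double E.
  rewrite wriggle_extensionE singular_extensionE E.
  by case: (num_double D) D1 => [|[|]].
move=> N' [<-] [_ vanish]; have := trefoil_extension R.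
rewrite -wriggle_extensionE => /eqP; apply.
apply: vanish (trefoil_singular R) _ _ => //.
exact: Relation_Operators.rst_refl.
Qed.
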